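(* Let $\{X_n\}_{n\ge 0}$ be i.i.d. Gaussian random variables with mean $-\delta<0$ and variance $\sigma^2>0$, let $W_0:=0$, $W_{n+1}:=[W_n+X_n]^+$ for $n\ge 0$, and let $\overline W_n:=\frac1n\sum_{i=1}^n W_i$. Then $\{n^{-1}\overline W_n\}_{n\ge1}$ satisfies the large deviation principle in $[0,\infty)$ (at speed $n$) with rate function $$I_{\overline W}(z)=\begin{cases}\dfrac{4\delta}{\sigma^2}\sqrt{\dfrac{z\delta}{6}} & \text{if } z\in[0,\delta/6],\\[2mm] \dfrac{3}{2\sigma^2}\left(z+\dfrac{\delta}{2}\right)^2 & \text{if } z\in[\delta/6,\infty).\end{cases}$$ As $n$ tends to infinity, the most likely paths $\psi^*$ of $t\mapsto n^{-1}W_{\lfloor nt\rfloor}$, $t\in[0,1]$, leading to $\overline W_n\ge nz$ are as follows. (i) If $z\in(0,\delta/6]$, then for any $T_0\in[0,1-\sqrt{6z/\delta}]$, $$\psi^*(t)=\begin{cases}0 & \text{if } t\in[0,T_0]\cup[T_0+\sqrt{6z/\delta},1],\\ \displaystyle \delta(t-T_0)-\delta\sqrt{\frac{\delta}{6z}}\,(t-T_0)^2 & \text{for } t\in[T_0,T_0+\sqrt{6z/\delta}].\end{cases}$$ (ii) If $z\in[\delta/6,\infty)$, then $$\psi^*(t)=3\left(z+\frac{\delta}{2}\right)\left(t-\frac{t^2}{2}\right)-\delta t\quad\text{for } t\in[0,1].$$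
   Context: Here $[x]^+=\max(x,0)$. For $z>0$, the ''most likely paths'' are by definition the minimizers of the following variational problem: minimize $J(\psi)$ over all non-negative càdlàg functions $\psi:[0,1]\to\mathbb{R}$ of finite variation with $\int_0^1\psi(s)\,ds=z$. In the Gaussian case, with $I(x)=\frac{1}{2\sigma^2}(x+\delta)^2$, $$J(\psi)=\int_0^1\Bigl(I(\dot\psi(s))1_{\{\psi(s)>0\}}+\inf_{y\le 0}I(y)\,1_{\{\psi(s)=0\}}\Bigr)ds$$ if $\psi$ is absolutely continuous with $\psi(0)=0$, and $J(\psi)=+\infty$ otherwise (note $\inf_{y\le0}I(y)=I(-\delta)=0$). *)

(* Defs.v *)
From HB Require Import structures.
From mathcomp Require Import all_boot all_order all_algebra.
From mathcomp Require Import all_classical all_reals all_analysis.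
Import Order.TTheory GRing.Theory Num.Theory.
Import numFieldNormedType.Exports.

Set Implicit Arguments.
Unset Strict Implicit.
Unset Printing Implicit Defensive.

Local Open Scope classical_set_scope.
Local Open Scope ring_scope.

Section Probability.
Context {d : measure_display} {T : measurableType d} {R : realType}.
Variable P : probability T R.

Definition mutually_independent (X : nat -> {RV P >-> R}) : Prop :=
  forall (s : seq nat) (B : nat -> set R), uniq s ->
    (forall i, measurable (B i)) ->
    P [set w | forall i, i \in s -> B i (X i w)] =
    (\prod_(i <- s) P (X i @^-1` B i))%E.

(* The second parameter of [normal_prob] is the standard deviation. *)
Definition iid_gaussian (m sigma : R) (X : nat -> {RV P >-> R}) : Prop :=
  mutually_independent X /\
  forall n (A : set R), measurable A ->
    distribution P (X n) A = normal_prob m sigma A.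

(* Rate function on the subspace E of R: nonnegative, with sublevel sets closed
   in the subspace topology (lower semicontinuity). *)
Definition rate_function (E : set R) (I : R -> \bar R) : Prop :=
  (forall x, E x -> (0 <= I x)%E) /\
  (forall a : R, exists2 C : set R, closed C &
     [set x | E x /\ (I x <= a%:E)%E] = E `&` C).

(* Large deviation principle in the subspace E of R, at speed n. The closed
   (open) subsets of E are the traces on E of those of R. The value at n = 0 is
   irrelevant to the limits. *)
Definition ldp (E : set R) (Y : nat -> T -> R) (I : R -> \bar R) : Prop :=
  [/\ forall n w, E (Y n w),
      rate_function E I,
      forall C : set R, closed C ->
        (limn_esup (fun n => (n%:R^-1)%:E * lne (P (Y n @^-1` (E `&` C))))
         <= - ereal_inf (I @` (E `&` C)))%E
    & forall U : set R, open U ->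
        (- ereal_inf (I @` (E `&` U)) <=
         limn_einf (fun n => (n%:R^-1)%:E * lne (P (Y n @^-1` (E `&` U)))))%E].

End Probability.

Section Walk.
Context {R : realType}.

Fixpoint W (x : nat -> R) (n : nat) : R :=
  if n is k.+1 then Num.max (W x k + x k) 0 else 0.

Definition Wbar (x : nat -> R) (n : nat) : R :=
  n%:R^-1 * \sum_(1 <= i < n.+1) W x i.

End Walk.

(* Paths on [0, 1] are total functions R -> R of which only the values on [0, 1]
   are relevant. *)
Section VariationalProblem.
Context {R : realType}.

Definition cadlag (psi : R -> R) : Prop :=
  (forall t : R, 0 <= t < 1 -> psi x @[x --> t^'+] --> psi t) /\
  (forall t : R, 0 < t <= 1 -> cvg (psi x @[x --> t^'-])).

Definition absolutely_continuous (a b : R) (psi : R -> R) : Prop :=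
  forall e : R, 0 < e -> exists2 eta : R, 0 < eta &
    forall (n : nat) (u v : 'I_n -> R),
      (forall i, [/\ a <= u i, u i <= v i & v i <= b]) ->
      trivIset [set: 'I_n] (fun i => `]u i, v i[%classic) ->
      \sum_(i < n) (v i - u i) < eta ->
      \sum_(i < n) `|psi (v i) - psi (u i)| < e.

(* The integrand is specified off a null set: an absolutely continuous path is
   differentiable almost everywhere on ]0, 1[. *)
Definition action (I : R -> R) (psi : R -> R) : \bar R :=
  if `[< absolutely_continuous 0 1 psi /\ psi 0 = 0 >] then
    (\int[@lebesgue_measure R]_(s in `[0%R, 1%R])
       (I (derive1 psi s) * \1_[set r | (0 < psi r)%R] s +
        inf (I @` [set y | (y <= 0)%R]) * \1_[set r | psi r = 0%R] s)%:E)%E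
  else +oo%E.

Definition admissible (z : R) (psi : R -> R) : Prop :=
  [/\ forall t : R, 0 <= t <= 1 -> 0 <= psi t,
      cadlag psi,
      bounded_variation 0 1 psi
    & (\int[@lebesgue_measure R]_(s in `[0%R, 1%R]) (psi s)%:E)%E = z%:E].

Definition most_likely_path (I : R -> R) (z : R) (psi : R -> R) : Prop :=
  admissible z psi /\
  forall phi, admissible z phi -> (action I psi <= action I phi)%E.

(* Cramer rate function of the normal law of mean - delta and variance
   sigma ^ 2. *)
Definition gaussian_rate (delta sigma x : R) : R :=
  1 / (2 * sigma ^+ 2) * (x + delta) ^+ 2.

End VariationalProblem.

Section Formulas.
Context {R : realType}.
Variables delta sigma : R.

Definition Wbar_rate (z : R) : R :=
  if z <= delta / 6 then
    4 * delta / sigma ^+ 2 * Num.sqrt (z * delta / 6)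
  else 3 / (2 * sigma ^+ 2) * (z + delta / 2) ^+ 2.

Definition excursion_path (z T0 t : R) : R :=
  if T0 <= t <= T0 + Num.sqrt (6 * z / delta) then
    delta * (t - T0) - delta * Num.sqrt (delta / (6 * z)) * (t - T0) ^+ 2
  else 0.

Definition full_path (z t : R) : R :=
  3 * (z + delta / 2) * (t - t ^+ 2 / 2) - delta * t.

End Formulas.

(* Main.v *)
Require Import Defs.
From HB Require Import structures.
From mathcomp Require Import all_boot all_order all_algebra.
From mathcomp Require Import all_classical all_reals all_analysis.
From mathcomp Require Import measurable_realfun.
From mathcomp Require Import ring lra.
Import Order.TTheory GRing.Theory Num.Theory.
Import numFieldNormedType.Exports.
Import HBNNSimple.
Local Open Scope classical_set_scope.
Local Open Scope ring_scope.

(** Both halves of the theorem rest on one inequality.  Let L be the total time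
    that a path psi on [0, 1] spends away from 0, let tau t be the part of it
    elapsed before t, and let z be the area below psi.  Since psi grows only
    while it is busy, an integration by parts against the remaining busy time
    L - tau gives
      z + delta L^2 / 2 = \int (L - tau) (psi' + delta) dtau,
    and Cauchy-Schwarz, with \int (L - tau)^2 dtau = L^3 / 3, bounds the energy
    \int (psi' + delta)^2 dtau / (2 sigma^2) from below by
      busy_cost z L = 3 (z + delta L^2 / 2)^2 / (2 sigma^2 L^3).
    The rate function is the minimum of busy_cost z over L in ]0, 1], reached
    only at L = busy_length z = min (1, sqrt (6 z / delta))
    ([rate_le_busy_cost], [rate_busy_length], [busy_cost_eq_rate]).

    Large deviations.  For the upper bound ([area_upper_bound]) time is cut into
    K blocks, with K large but fixed.  Inside a block the walk moves too little
    to matter, except on an event whose decay rate grows with K.  The set of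
    blocks at whose end the waiting time is positive takes at most 2^K values;
    given this set, summation by parts ([busy_summation]) bounds the area by a
    linear statistic of the increments whose weights are the remaining numbers
    of busy blocks.  Its Gaussian tail is the discrete form of the inequality
    above.  For the lower bound ([area_lower_bound]) the law is shifted by the
    increments of the optimal path: an exponential change of measure
    ([tilted_lower_bound]) gives the probability that the partial sums follow
    that path, and the waiting times are a 2-Lipschitz function of the partial
    sums for the uniform norm ([W_lipschitz]).

    Most likely paths.  For an absolutely continuous psi the integration by
    parts is the fundamental theorem of calculus applied to
      2 c psi (L - tau) - delta c (L - tau)^2 + c^2 (L - tau)^3 / 3,
    with c = 3 (z + delta L^2 / 2) / L^3; the action then exceeds busy_cost z L
    by the integral of a square ([busy_cost_le_action]).  That theorem for
    absolutely continuous functions ([AC_FTC]) is obtained from the Jordan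
    decomposition: the two Stieltjes measures have equal values on Lebesgue-null
    sets, so their difference has a Radon-Nikodym density, and the primitive of
    a density is differentiable almost everywhere.  A minimizer makes the square
    vanish, so psi' = c (L - tau) - delta on the busy set, and psi is a fixed
    parabola taken at the time tau ([minimal_action_profile]), with
    L = busy_length z.  The parabola is positive strictly between 0 and L, so tau
    has slope 1 as long as it stays strictly between 0 and L: the busy set is a
    single interval.  If L = 1 this interval is the whole of [0, 1]; otherwise
    its left end T0 is free ([most_likely_excursion], [most_likely_full_path]).
    Conversely, all these paths have an action equal to the rate
    ([profile_path_action]). *)

(** * Gaussian linear statistics: tails and change of measure *)

Section ExtendFromIndicators.
Local Open Scope ereal_scope.

Let integral_density_nnsfun {d} {T : measurableType d} {R : realType}
    (m : {measure set T -> \bar R}) (G : T -> \bar R) (X : T -> R)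
    (h : {nnsfun R >-> R}) :
  measurable_fun [set: T] G -> (forall x, 0 <= G x) -> measurable_fun setT X ->
  \int[m]_x (G x * (h (X x))%:E) =
  \sum_(y \in range h) (y%:E * \int[m]_x (G x * (\1_(h @^-1` [set y]) (X x))%:E)).
Proof.
move=> mG G0 mX.
have mi y : measurable_fun setT (fun x => (\1_(h @^-1` [set y]) (X x))%:E : \bar R).
  apply/measurable_EFinP; apply: measurableT_comp => //.
have m1 y : measurable_fun setT (fun x => G x * (\1_(h @^-1` [set y]) (X x))%:E).
  by apply: emeasurable_funM.
transitivity (\int[m]_x (\sum_(y \in range h)
    (y%:E * (G x * (\1_(h @^-1` [set y]) (X x))%:E)))).
  apply: eq_integral => x _; rewrite (fimfunE h (X x)).
  rewrite -fsumEFin// ge0_mule_fsumr//; last first.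
    move=> y; rewrite EFinM lee_fin; have [y0|y0] := leP 0%R y.
      by rewrite mulr_ge0// indicE; case: (_ \in _).
    by rewrite preimage_nnfun0// indic0 mulr0.
  by apply: eq_fsbigr => y _; rewrite EFinM muleCA.
rewrite ge0_integral_fsum//.
- apply: eq_fsbigr => y /[!inE] -[x _ <-].
  rewrite ge0_integralZl// ?lee_fin//.
  by move=> ? _; rewrite mule_ge0// lee_fin indicE; case: (_ \in _).
- by move=> y; apply: measurable_funeM.
- move=> y x _; have [y0|y0] := leP 0%R y.
    by rewrite mule_ge0// mule_ge0// lee_fin indicE; case: (_ \in _).
  by rewrite preimage_nnfun0// indic0 !mule0.
Qed.

(** Both sides are linear and monotone continuous in the integrated function, so
    an equality known for indicators propagates along simple functions.  This is
    used to replace indicators by general functions in the product rule of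
    independence, and to pass from the law of a variable to its density. *)
Lemma integral_density_eq {d1 d2} {T1 : measurableType d1} {T2 : measurableType d2}
    {R : realType} (m1 : {measure set T1 -> \bar R}) (m2 : {measure set T2 -> \bar R})
    (G1 : T1 -> \bar R) (G2 : T2 -> \bar R) (X1 : T1 -> R) (X2 : T2 -> R)
    (f : R -> R) :
  measurable_fun [set: T1] G1 -> (forall x, 0 <= G1 x) -> measurable_fun setT X1 ->
  measurable_fun [set: T2] G2 -> (forall x, 0 <= G2 x) -> measurable_fun setT X2 ->
  measurable_fun setT f -> (forall x, (0 <= f x)%R) ->
  (forall B, measurable B -> \int[m1]_x (G1 x * (\1_B (X1 x))%:E) =
                             \int[m2]_x (G2 x * (\1_B (X2 x))%:E)) ->
  \int[m1]_x (G1 x * (f (X1 x))%:E) = \int[m2]_x (G2 x * (f (X2 x))%:E).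
Proof.
move=> mG1 G10 mX1 mG2 G20 mX2 mf f0 H.
have mEf : measurable_fun [set: R] (EFin \o f) by apply/measurable_EFinP.
pose h := nnsfun_approx measurableT mEf.
have hf x : (EFin \o h^~ x) @ \oo --> (f x)%:E.
  by apply: (@cvg_nnsfun_approx _ _ _ _ _ (EFin \o f)) => // y _; rewrite lee_fin.
have lim_int d (T : measurableType d) (m : {measure set T -> \bar R})
    (G : T -> \bar R) (X : T -> R) : measurable_fun [set: T] G ->
    (forall x, 0 <= G x) -> measurable_fun setT X ->
    \int[m]_x (G x * (f (X x))%:E) = limn (fun n => \int[m]_x (G x * (h n (X x))%:E)).
  move=> mG G0 mX; rewrite -monotone_convergence//.
  - apply: eq_integral => x _; apply/esym/cvg_lim => //.
    have := G0 x; case: (G x) => [r|_|]// => [_|].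
      exact: (cvgeZl _ (hf (X x))).
    have [fx0|fx0] := eqVneq (f (X x)) 0%R.
      rewrite fx0 mule0; apply: cvg_near_cst; apply: nearW => n.
      suff -> : h n (X x) = 0%R by rewrite mule0.
      apply/eqP; rewrite eq_le fun_ge0 andbT -fx0 -lee_fin /h nnsfun_approxE.
      by apply: le_approx => // y _; rewrite lee_fin.
    apply: (cvgeM _ (cvg_cst _) (hf (X x))).
    by rewrite /mule_def/= ?eqe ?(negbTE fx0) ?orbT ?andbF.
  - move=> n; apply: emeasurable_funM => //; apply/measurable_EFinP.
    exact: measurableT_comp.
  - by move=> n x _; rewrite mule_ge0// lee_fin.
  - by move=> x _ a b ab; rewrite lee_wpmul2l// lee_fin; exact/lefP/nd_nnsfun_approx.
rewrite !lim_int//; congr (limn _); apply/funext => n.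
rewrite !integral_density_nnsfun//; apply: eq_fsbigr => y _; congr (_ * _).
exact: H.
Qed.

End ExtendFromIndicators.

Section GaussianVector.
Context {d : measure_display} {T : measurableType d} {R : realType}.
Variables (P : probability T R) (X : nat -> {RV P >-> R}).

(** Independence is stated for events, that is for products of indicators.  The
    indicators are replaced by general nonnegative functions one coordinate at a
    time. *)
Lemma expectation_prod_indep (N : nat) (g : nat -> R -> R) :
  mutually_independent X ->
  (forall i, measurable_fun [set: R] (g i)) -> (forall i x, 0 <= g i x) ->
  (\int[P]_w (\prod_(i < N) g i (X i w))%:E =
   \prod_(i < N) \int[P]_w (g i (X i w))%:E)%E.
Proof.
move=> indep mg g0.
(* the coordinates of index at least j still carry indicators *)
suff H j : forall g : nat -> R -> R,
    (forall i, measurable_fun [set: R] (g i)) -> (forall i x, 0 <= g i x) ->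
    (forall i, (i < N)%N -> (j <= i)%N -> exists2 B, measurable B & g i = \1_B) ->
    (\int[P]_w (\prod_(i < N) g i (X i w))%:E =
     \prod_(i < N) \int[P]_w (g i (X i w))%:E)%E.
  by apply: (H N) => // i; rewrite ltnNge => /negbTE ->.
elim: j => [|j IH] {mg g0}g mg g0 gB.
  have [B mB gE] : exists2 B : nat -> set R, (forall i, measurable (B i)) &
      forall i, (i < N)%N -> g i = \1_(B i).
    have /choice[B HB] : forall i, exists B, measurable B /\ ((i < N)%N -> g i = \1_B).
      move=> i; case: (ltnP i N) => iN; last by exists set0; split.
      by have [B mB ->] := gB i iN (leq0n i); exists B.
    by exists B => i; have [] := HB i.
  have := indep (index_iota 0 N) B (iota_uniq _ _) mB.
  rewrite big_mkord => E.
  transitivity (P [set w | forall i, i \in index_iota 0 N -> B i (X i w)]).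
    rewrite -[X in P X]setIT -integral_indic//; last first.
      rewrite (_ : [set w | _] =
        \bigcap_(i in [set i | (i < N)%N]) (X i @^-1` B i)).
        by apply: bigcap_measurableType => i _; exact: measurable_funPTI.
      by apply/seteqP; split => w /= H i; have := H i; rewrite mem_index_iota.
    apply: eq_integral => w _; congr EFin; rewrite indicE.
    case: (pselect (forall i, i \in index_iota 0 N -> B i (X i w))) => [H|nH].
      rewrite mem_set// big1// => i _; rewrite gE// indicE mem_set//.
      by apply: H; rewrite mem_index_iota/=.
    rewrite memNset//; move/existsNP : nH => [i /not_implyP[]].
    rewrite mem_index_iota /= => iN nB.
    by rewrite (bigD1 (Ordinal iN))//= gE// indicE memNset// mul0r.
  rewrite E; apply: eq_bigr => i _; rewrite gE//.
  rewrite -[X in P X]setIT -integral_indic//; exact: measurable_funPTI.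
case: (ltnP j N) => [jN|Nj]; last first.
  apply: IH => // i iN ji; apply: gB => //.
  by have := leq_trans iN (leq_trans Nj ji); rewrite ltnn.
pose oj := Ordinal jN.
pose G w := \prod_(i < N | i != oj) g i (X i w).
pose C := (\prod_(i < N | i != oj) \int[P]_w (g i (X i w))%:E)%E.
have C0 : (0 <= C)%E.
  by apply: prode_ge0 => i _; apply: integral_ge0 => w _; rewrite lee_fin.
have mgX i : measurable_fun [set: T] (fun w => g i (X i w)).
  exact: measurableT_comp.
have mG : measurable_fun [set: T] (EFin \o G).
  apply/measurable_EFinP; rewrite /G; under eq_fun do rewrite -big_filter.
  exact: measurable_prod.
rewrite [RHS](bigD1 oj)//= -/C.
transitivity (\int[P]_w ((EFin \o G) w * (g j (X j w))%:E))%E.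
  by apply: eq_integral => w _; rewrite (bigD1 oj)//= EFinM muleC.
have mgj : measurable_fun [set: T] (fun w => (g j (X j w))%:E).
  exact/measurable_EFinP.
rewrite muleC -ge0_integralZl//; [|by move=> w _; rewrite lee_fin].
apply: (integral_density_eq _ _ _ (cst C)) => //.
  by move=> w; rewrite lee_fin prodr_ge0.
move=> B mB.
pose g' i := if i == j then \1_B else g i.
have mg' i : measurable_fun [set: R] (g' i).
  by rewrite /g'; case: ifP => // _; exact: measurable_indic.
have g'0 i x : 0 <= g' i x by rewrite /g'; case: ifP => // _; rewrite indicE.
have := IH g' mg' g'0.
have -> : (\int[P]_w (\prod_(i < N) g' i (X i w))%:E =
          \int[P]_w ((EFin \o G) w * (\1_B (X j w))%:E))%E.
  apply: eq_integral => w _; rewrite (bigD1 oj)//= EFinM muleC /g' eqxx.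
  congr (_%:E * _)%E; apply: eq_bigr => i.
  by rewrite -val_eqE /= => /negbTE ->.
move=> ->; last first.
  move=> i iN ji; rewrite /g'; case: ifPn => [_|ij]; first by exists B.
  by apply: gB => //; rewrite ltn_neqAle eq_sym ij.
have mBj : measurable_fun [set: T] (fun w => (\1_B (X j w))%:E : \bar R).
  by apply/measurable_EFinP; apply: measurableT_comp => //; exact: measurable_indic.
rewrite ge0_integralZl//.
rewrite (bigD1 oj)//= muleC /g' eqxx; congr (_ * _)%E.
by apply: eq_bigr => i; rewrite -val_eqE /= => /negbTE ->.
Qed.

Section MomentGeneratingFunction.
Variables (delta sigma : R).
Hypothesis (sigma_gt0 : 0 < sigma) (X_iid : iid_gaussian (- delta) sigma X).

Lemma gaussian_mgf (n : nat) (c : R) :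
  (\int[P]_w (expR (c * (X n w + delta)))%:E = (expR (sigma ^+ 2 * c ^+ 2 / 2))%:E)%E.
Proof.
have s0 : sigma != 0 by rewrite gt_eqF.
have mexp : measurable_fun [set: R] (fun x => expR (c * (x + delta))).
  apply: measurableT_comp; first exact: measurable_expR.
  by apply: measurable_funM => //; exact: measurable_funD.
have mpdf m : measurable_fun [set: R] (EFin \o normal_pdf m sigma).
  by apply/measurable_EFinP; exact: measurable_normal_pdf.
have pdf0 m x : (0 <= (EFin \o normal_pdf m sigma) x)%E.
  by rewrite lee_fin normal_pdf_ge0.
transitivity (\int[P]_w (cst 1%E w * (expR (c * (X n w + delta)))%:E))%E.
  by apply: eq_integral => w _; rewrite mul1e.
rewrite (@integral_density_eq _ _ _ _ _ P lebesgue_measure (cst 1%E)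
  (EFin \o normal_pdf (- delta) sigma) (X n) idfun
  (fun x => expR (c * (x + delta))))//; last 3 first.
  exact: mpdf.
  exact: measurable_id.
  move=> B mB; under eq_integral do rewrite mul1e.
  rewrite [LHS](_ : _ = \int[P]_w (\1_(X n @^-1` B) w)%:E)%E//.
  rewrite integral_indic//; last exact: measurable_funPTI.
  rewrite setIT; have /= := X_iid.2 n B mB; rewrite /distribution/pushforward => ->.
  rewrite /normal_prob integral_mkcond; apply: eq_integral => x _.
  by rewrite patchE indicE; case: (x \in B); rewrite ?mule1 ?mule0.
transitivity (\int[lebesgue_measure]_x ((expR (sigma ^+ 2 * c ^+ 2 / 2))%:E *
   (EFin \o normal_pdf (- delta + c * sigma ^+ 2) sigma) x))%E.
  apply: eq_integral => x _; rewrite /= -!EFinM; congr EFin.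
  rewrite !normal_pdfE//= [RHS]mulrCA -[LHS]mulrA; congr (_ * _).
  rewrite /normal_fun -!expRD; congr expR.
  by rewrite -mulr_natr; field.
rewrite ge0_integralZl// ?lee_fin ?expR_ge0//.
  by rewrite /= integral_normal_pdf mule1.
exact: mpdf.
Qed.

Definition linear_statistic (n : nat) (c : nat -> R) (w : T) : R :=
  \sum_(i < n) c i * (X i w + delta).

Lemma measurable_linear_statistic n c : measurable_fun [set: T] (linear_statistic n c).
Proof.
apply: measurable_sum => i; apply: measurable_funM => //.
exact: measurable_funD.
Qed.

Lemma linear_statisticD n c b w : linear_statistic n (c \+ b) w = linear_statistic n c w + linear_statistic n b w.
Proof. by rewrite /linear_statistic -big_split; apply: eq_bigr => i _; rewrite /= mulrDl. Qed.

Lemma linear_statisticZ n k c w : linear_statistic n (fun i => k * c i) w = k * linear_statistic n c w.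
Proof. by rewrite /linear_statistic mulr_sumr; apply: eq_bigr => i _; rewrite mulrA. Qed.

Lemma mgf_linear_statistic n c :
  (\int[P]_w (expR (linear_statistic n c w))%:E =
   (expR (sigma ^+ 2 / 2 * \sum_(i < n) c i ^+ 2))%:E)%E.
Proof.
have := @expectation_prod_indep n (fun i x => expR (c i * (x + delta))) X_iid.1.
move=> H; have {H} := H _ _.
under eq_integral do rewrite -expR_sum.
rewrite /linear_statistic => ->; last 2 first.
- move=> i; apply: measurableT_comp; first exact: measurable_expR.
  by apply: measurable_funM => //; exact: measurable_funD.
- by move=> i x; rewrite expR_ge0.
under eq_bigr do rewrite gaussian_mgf.
rewrite prodEFin; congr EFin; rewrite mulr_sumr expR_sum.
by apply: eq_bigr => i _; congr expR; ring.
Qed.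

Let mge n c a : measurable [set w | a <= linear_statistic n c w].
Proof.
rewrite (_ : [set w | _] = linear_statistic n c @^-1` `[a, +oo[).
  by rewrite -[X in measurable X]setTI; exact: measurable_linear_statistic.
by apply/seteqP; split => w /=; rewrite in_itv/= andbT.
Qed.

Let mexp_linear n c : measurable_fun [set: T] (fun w => expR (linear_statistic n c w)).
Proof. by apply: measurableT_comp; [exact: measurable_expR|exact: measurable_linear_statistic]. Qed.

(** On the event, expR a is at most the exponential of the statistic with
    weights c, which merges with the factor of weights b.  The case b = 0 is the
    Chernoff bound; a general b gives the same bound under the shifted law. *)
Lemma exp_chebyshev n (b c : nat -> R) (a : R) :
  (\int[P]_w (expR (linear_statistic n b w) * \1_[set w | (a <= linear_statistic n c w)%R] w)%:E <=
   (expR (sigma ^+ 2 / 2 * \sum_(i < n) (b i + c i) ^+ 2 - a))%:E)%E.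
Proof.
rewrite expRD EFinM -(mgf_linear_statistic n (b \+ c)) muleC -ge0_integralZl//.
all: try solve [exact/measurable_EFinP | by rewrite ?lee_fin ?expR_ge0 |
  by move=> w _; rewrite lee_fin expR_ge0].
apply: ge0_le_integral => //.
- by apply/measurable_EFinP; apply: measurable_funM => //; exact: measurable_indic.
- by apply: measurable_funeM; exact/measurable_EFinP.
- move=> w _; rewrite -EFinM lee_fin linear_statisticD expRD indicE.
  case: (boolP (w \in _)) => [|_]; last by rewrite mulr0 !mulr_ge0// expR_ge0.
  rewrite inE/= => aw; rewrite mulr1 mulrCA ler_peMr ?expR_ge0//.
  by rewrite -expRD -expR0 ler_expR addrC subr_ge0.
Qed.

Lemma linear_statistic_tail n (c : nat -> R) (a v : R) : 0 <= a -> 0 < v -> \sum_(i < n) c i ^+ 2 <= v ->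
  (P [set w | (a <= linear_statistic n c w)%R] <= (expR (- (a ^+ 2 / (2 * sigma ^+ 2 * v))))%:E)%E.
Proof.
move=> a0 v0 cv.
have s20 : 0 < sigma ^+ 2 by rewrite exprn_gt0.
have [->|an0] := eqVneq a 0.
  by rewrite expr0n/= mul0r oppr0 expR0 probability_le1//; exact: mge.
have {an0}a0 : 0 < a by rewrite lt_neqAle eq_sym an0.
(* the minimizer of sigma ^+ 2 / 2 * th ^+ 2 * v - th * a *)
pose th := a / (sigma ^+ 2 * v).
have th0 : 0 < th by rewrite divr_gt0// mulr_gt0.
have := exp_chebyshev n (cst 0) (fun i => th * c i) (th * a).
rewrite (_ : [set w | th * a <= _] = [set w | a <= linear_statistic n c w]); last first.
  by apply/seteqP; split => w /=; rewrite linear_statisticZ ler_pM2l.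
rewrite (_ : (\int[P]_w _)%E = P [set w | a <= linear_statistic n c w]); last first.
  rewrite -[RHS](_ : \int[P]_w (\1_[set w | a <= linear_statistic n c w] w)%:E = _)%E; last first.
    by rewrite integral_indic ?setIT//; exact: mge.
  apply: eq_integral => w _; rewrite (_ : linear_statistic n (cst 0) w = 0) ?expR0 ?mul1r//.
  by rewrite /linear_statistic big1// => i _; rewrite mul0r.
move=> /le_trans; apply; rewrite lee_fin ler_expR.
under eq_bigr do rewrite add0r exprMn.
rewrite -mulr_sumr.
apply: (@le_trans _ _ (sigma ^+ 2 / 2 * (th ^+ 2 * v) - th * a)).
  rewrite lerD2r ler_wpM2l ?divr_ge0 ?(ltW s20)//.
  by rewrite ler_wpM2l// sqr_ge0.
rewrite /th le_eqVlt; apply/orP; left; apply/eqP; field.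
by rewrite !gt_eqF.
Qed.

(** Change of measure to the law whose increments have their means shifted by b.
    There, each statistic with weights [ds k] has mean \sum_i b i * ds k i and
    exceeds it by a with small probability, so the event has probability at
    least the left-hand side.  As b itself is one of the constraints, the density
    of the shift is bounded on the event by the exponential factor on the
    right. *)
Lemma tilted_lower_bound n m (b : nat -> R) (ds : nat -> nat -> R) (a v : R) :
  0 < a -> 0 < v -> ds 0%N = b ->
  (forall k, (k <= m)%N -> \sum_(i < n) ds k i ^+ 2 <= v) ->
  ((1 - m.+1%:R * expR (- (a ^+ 2 / (2 * sigma ^+ 2 * v))))%:E <=
   (expR ((\sum_(i < n) b i ^+ 2 / 2 + a) / sigma ^+ 2))%:E *
   P [set w | forall k, (k <= m)%N ->
        (linear_statistic n (ds k) w < a + \sum_(i < n) b i * ds k i)%R])%E.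
Proof.
move=> a0 v0 d0 dv.
have s20 : 0 < sigma ^+ 2 by rewrite exprn_gt0.
set Q := expR (- _).
set G := [set w | _].
pose th := a / (sigma ^+ 2 * v).
have th0 : 0 < th by rewrite divr_gt0// mulr_gt0.
pose B k := [set w | th * (a + \sum_(i < n) b i * ds k i) <=
                     linear_statistic n (fun i => th * ds k i) w].
have mB k : measurable (B k) by exact: mge.
have BE k w : ~ B k w -> linear_statistic n (ds k) w < a + \sum_(i < n) b i * ds k i.
  by rewrite /B/= linear_statisticZ ler_pM2l// => /negP; rewrite -ltNge.
have GE : G = \bigcap_(k in [set k | (k <= m)%N]) ~` B k.
  apply/seteqP; split => w /= H k km; last exact/BE/H.
  by rewrite /B/= linear_statisticZ ler_pM2l//; apply/negP; rewrite -ltNge; exact: H.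
have mG : measurable G.
  by rewrite GE; apply: bigcap_measurableType => k _; exact/measurableC.
pose b' i := (sigma ^+ 2)^-1 * b i.
pose sb := \sum_(i < n) b i ^+ 2.
pose K := expR (- (sb / (2 * sigma ^+ 2))).
have Kn0 : 0 < K by rewrite expR_gt0.
have bnd k : (k <= m)%N ->
  (\int[P]_w (expR (linear_statistic n b' w) * \1_(B k) w)%:E <= (Q / K)%:E)%E.
  move=> km; apply: (le_trans (exp_chebyshev _ _ _ _)).
  rewrite lee_fin ler_pdivlMr// -expRD ler_expR.
  rewrite (_ : \sum_(i < n) _ = (sigma ^+ 2)^-2 * sb +
    2 * (sigma ^+ 2)^-1 * th * \sum_(i < n) b i * ds k i +
    th ^+ 2 * \sum_(i < n) ds k i ^+ 2); last first.
    rewrite !mulr_sumr -!big_split/=; apply: eq_bigr => i _.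
    by rewrite /b'; field; rewrite gt_eqF.
  apply: (@le_trans _ _ (sigma ^+ 2 / 2 * (th ^+ 2 * v) - th * a)); last first.
    rewrite /th le_eqVlt; apply/orP; left; apply/eqP; field.
    by rewrite !gt_eqF.
  have : sigma ^+ 2 / 2 * (th ^+ 2 * \sum_(i < n) ds k i ^+ 2) <=
         sigma ^+ 2 / 2 * (th ^+ 2 * v).
    rewrite ler_wpM2l ?divr_ge0 ?(ltW s20)//.
    by rewrite ler_wpM2l ?sqr_ge0// dv.
  rewrite -(lerD2r (- (th * a))); apply: le_trans.
  rewrite le_eqVlt; apply/orP; left; apply/eqP; field.
  by rewrite gt_eqF.
have intD : (\int[P]_w (expR (linear_statistic n b' w))%:E = (K^-1)%:E)%E.
  rewrite mgf_linear_statistic /K -expRN opprK; congr (expR _)%:E.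
  rewrite (_ : \sum_(i < n) b' i ^+ 2 = (sigma ^+ 2)^-2 * sb); last first.
    by rewrite mulr_sumr; apply: eq_bigr => i _; rewrite /b'; field; rewrite gt_eqF.
  by field; rewrite gt_eqF.
have onG : (\int[P]_w (expR (linear_statistic n b' w) * \1_G w)%:E <=
            (expR ((sb + a) / sigma ^+ 2))%:E * P G)%E.
  rewrite -[in leRHS](setIT G) -integral_indic// -ge0_integralZl//.
  all: try solve [by apply/measurable_EFinP; exact: measurable_indic |
    by rewrite lee_fin expR_ge0 | by move=> w _; rewrite lee_fin indicE].
  apply: ge0_le_integral => //.
  - by apply/measurable_EFinP; apply: measurable_funM => //; exact: measurable_indic.
  - apply: measurable_funeM.
    by apply/measurable_EFinP; exact: measurable_indic.
  move=> w _; rewrite -EFinM lee_fin !indicE.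
  case: (boolP (w \in G)) => [|_]; last by rewrite !mulr0.
  rewrite inE !mulr1 ler_expR => /(_ 0%N (leq0n _)); rewrite d0.
  rewrite /b' linear_statisticZ mulrC ler_pM2r ?invr_gt0// => /ltW/le_trans; apply.
  by rewrite addrC lerD2r; apply: ler_sum => i _; rewrite expr2.
(* the total mass of the shifted law is shared between the event and the
   failures B k of the constraints *)
have cover : (\int[P]_w (expR (linear_statistic n b' w))%:E <=
   \int[P]_w (expR (linear_statistic n b' w) * \1_G w)%:E +
   \sum_(k < m.+1) \int[P]_w (expR (linear_statistic n b' w) * \1_(B k) w)%:E)%E.
  have mD A : measurable A -> measurable_fun [set: T]
      (fun w => (expR (linear_statistic n b' w) * \1_A w)%:E).
    move=> mA; apply/measurable_EFinP; apply: measurable_funM.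
      exact: mexp_linear.
    exact: measurable_indic.
  have D0 A w : (0 <= (expR (linear_statistic n b' w) * \1_A w)%:E)%E.
    by rewrite lee_fin mulr_ge0 ?expR_ge0// indicE.
  rewrite -ge0_integral_sum//; last by move=> k; exact: mD.
  rewrite -ge0_integralD//; [|exact: mD|by move=> w _; exact: sume_ge0|]; last first.
    by apply: emeasurable_sum => k; exact: mD.
  apply: ge0_le_integral => //.
  - by apply/measurable_EFinP.
  - apply: emeasurable_funD; first exact: mD.
    by apply: emeasurable_sum => k; exact: mD.
  move=> w _; have [wG|wG] := pselect (G w).
    by rewrite indicE mem_set// mulr1 leeDl// sume_ge0.
  move: wG; rewrite GE => /existsNP[k /not_implyP[/= km /contrapT Bk]].
  rewrite (bigD1 (Ordinal (km : k < m.+1)%N))//= [X in (_ + (X + _))%E]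
    (_ : _ = (expR (linear_statistic n b' w))%:E); last by rewrite indicE mem_set// mulr1.
  by rewrite addeCA leeDl// adde_ge0// sume_ge0.
have {cover} : (K^-1%:E <= (expR ((sb + a) / sigma ^+ 2))%:E * P G +
    (m.+1%:R * (Q / K))%:E)%E.
  rewrite -intD (le_trans cover)// leeD//.
  apply: (@le_trans _ _ (\sum_(k < m.+1) (Q / K)%:E)%E).
    by apply: lee_sum => k _; apply: bnd; rewrite -ltnS.
  by rewrite sumEFin sumr_const card_ord mulr_natl.
have PGf : P G \is a fin_num by rewrite fin_num_measure.
rewrite -(fineK PGf) -!EFinM -EFinD !lee_fin => H.
have -> : (\sum_(i < n) b i ^+ 2 / 2 + a) / sigma ^+ 2 =
  (sb + a) / sigma ^+ 2 + - (sb / (2 * sigma ^+ 2)).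
  by rewrite -mulr_suml -/sb; field; rewrite gt_eqF.
rewrite expRD -/K lerBlDr -(ler_pM2r (_ : 0 < K^-1)) ?invr_gt0// mul1r.
apply: (le_trans H); rewrite mulrDl le_eqVlt; apply/orP; left; apply/eqP.
by field; rewrite gt_eqF.
Qed.

End MomentGeneratingFunction.
End GaussianVector.

(** * The rate function as a minimum over busy lengths *)

Section RateFunction.
Context {R : realType}.
Variables (delta sigma : R).
Hypothesis (delta_gt0 : 0 < delta) (sigma_gt0 : 0 < sigma).

(** Least energy of a path enclosing the area z during a busy time l. *)
Definition busy_cost (z l : R) : R :=
  3 * (z + delta / 2 * l ^+ 2) ^+ 2 / (2 * sigma ^+ 2 * l ^+ 3).

Definition busy_length (z : R) : R := Num.min 1 (Num.sqrt (6 * z / delta)).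

Let rate z := Wbar_rate delta sigma z.

(** In the variable r = sqrt (6 z / delta) the square roots disappear and the
    comparisons below become polynomial. *)
Lemma sqrt_param z : 0 <= z ->
  z = delta * Num.sqrt (6 * z / delta) ^+ 2 / 6.
Proof.
move=> z0; rewrite sqr_sqrtr; first by field; rewrite gt_eqF.
by rewrite divr_ge0 ?mulr_ge0// ltW.
Qed.

Lemma busy_length_gt0 z : 0 < z -> 0 < busy_length z.
Proof. by move=> z0; rewrite lt_min ltr01 sqrtr_gt0 divr_gt0// mulr_gt0. Qed.

Lemma busy_length_le1 z : busy_length z <= 1.
Proof. by rewrite ge_min lexx. Qed.

Lemma sqrt_le1 z : 0 <= z -> (Num.sqrt (6 * z / delta) <= 1) = (z <= delta / 6).
Proof.
move=> z0; rewrite -[X in _ <= X]sqrtr1 ler_sqrt ?ltr01//.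
by rewrite ler_pdivrMr// mul1r ler_pdivlMr// mulrC.
Qed.

Lemma busy_length_small z : 0 <= z <= delta / 6 ->
  busy_length z = Num.sqrt (6 * z / delta).
Proof. by case/andP => z0 z1; apply/min_r; rewrite sqrt_le1. Qed.

Lemma busy_length_large z : delta / 6 <= z -> busy_length z = 1.
Proof.
move=> z1; have z0 : 0 <= z by apply: le_trans z1; rewrite divr_ge0 ?ltW.
apply/min_l; rewrite leNgt; apply/negP => H.
have z6 : z = delta / 6 by apply/eqP; rewrite eq_le -sqrt_le1// ltW.
by move: H; rewrite z6 mulrCA divff// mulr1 divff ?gt_eqF// sqrtr1 ltxx.
Qed.

Lemma rate_sqr (r : R) : 0 <= r <= 1 ->
  rate (delta * r ^+ 2 / 6) = 2 * delta ^+ 2 * r / (3 * sigma ^+ 2).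
Proof.
case/andP => r0 r1; rewrite /rate /Wbar_rate ifT; last first.
  by rewrite ler_pM2r// ger_pMr// exprn_ile1.
rewrite (_ : _ * delta / 6 = (delta * r / 6) ^+ 2); last by field.
rewrite sqrtr_sqr ger0_norm ?divr_ge0 ?mulr_ge0 ?(ltW delta_gt0)//.
by field; rewrite gt_eqF.
Qed.

Let rate_large (r : R) : 1 <= r ->
  rate (delta * r ^+ 2 / 6) = delta ^+ 2 * (r ^+ 2 + 3) ^+ 2 / (24 * sigma ^+ 2).
Proof.
rewrite le_eqVlt => /predU1P[<-|r1].
  by rewrite rate_sqr ?ler01 ?lexx//; field; rewrite gt_eqF.
rewrite /rate /Wbar_rate ifF; first by field; rewrite gt_eqF.
apply/negbTE; rewrite -ltNge ltr_pM2r ?invr_gt0// ltr_pMr//.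
by rewrite exprn_egt1.
Qed.

Let cost_param (r l : R) : 0 < l ->
  busy_cost (delta * r ^+ 2 / 6) l =
  delta ^+ 2 * (r ^+ 2 + 3 * l ^+ 2) ^+ 2 / (24 * sigma ^+ 2 * l ^+ 3).
Proof. by move=> l0; rewrite /busy_cost; field; rewrite !gt_eqF. Qed.

(** For r <= 1 the excess of the cost over the rate has the explicit factor
    (r - l)^2, hence the unique minimizer l = r. *)
Let cost_small (r l : R) : 0 <= r <= 1 -> 0 < l ->
  busy_cost (delta * r ^+ 2 / 6) l = rate (delta * r ^+ 2 / 6) +
   delta ^+ 2 * (r - l) ^+ 2 * (r ^+ 2 + 2 * r * l + 9 * l ^+ 2) /
     (24 * sigma ^+ 2 * l ^+ 3).
Proof.
by move=> r01 l0; rewrite cost_param// rate_sqr//; field; rewrite !gt_eqF.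
Qed.

(** For r >= 1 the minimum over ]0, 1] is at the end point l = 1.  With l = s^2,
    the square roots of cost and rate compare through
      r^2 + 3 s^4 - s^3 (r^2 + 3)
        = (r^2 - 1) (1 - s^3) + (1 - s)^2 (1 + 2 s + 3 s^2) >= 0. *)
Let cost_large (r l : R) : 1 <= r -> 0 < l <= 1 ->
  rate (delta * r ^+ 2 / 6) <= busy_cost (delta * r ^+ 2 / 6) l
    ?= iff (l == 1).
Proof.
move=> r1 /andP[l0 l1]; rewrite cost_param// rate_large//.
pose s := Num.sqrt l.
have s0 : 0 < s by rewrite sqrtr_gt0.
have lE : l = s ^+ 2 by rewrite sqr_sqrtr// ltW.
have s1 : s <= 1 by rewrite -sqrtr1 ler_wsqrtr.
have r21 : 1 <= r ^+ 2 by rewrite exprn_ege1.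
have p : (r ^+ 2 + 3 * s ^+ 4) - s ^+ 3 * (r ^+ 2 + 3) =
  (r ^+ 2 - 1) * (1 - s ^+ 3) + (1 - s) ^+ 2 * (1 + 2 * s + 3 * s ^+ 2) by ring.
have p0 : 0 <= (r ^+ 2 - 1) * (1 - s ^+ 3).
  by rewrite mulr_ge0// subr_ge0// exprn_ile1// ltW.
have q0 : 0 < 1 + 2 * s + 3 * s ^+ 2 by rewrite !addr_gt0// mulr_gt0// exprn_gt0.
have A0 : 0 < s ^+ 3 * (r ^+ 2 + 3).
  by rewrite mulr_gt0 ?exprn_gt0// ltr_wpDl ?sqr_ge0.
have AB : s ^+ 3 * (r ^+ 2 + 3) <= r ^+ 2 + 3 * s ^+ 4.
  by rewrite -subr_ge0 p addr_ge0// mulr_ge0 ?sqr_ge0// ltW.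
have k0 : 0 < delta ^+ 2 / (24 * sigma ^+ 2 * s ^+ 6).
  by rewrite divr_gt0 ?mulr_gt0 ?exprn_gt0.
have e1 : delta ^+ 2 * (r ^+ 2 + 3) ^+ 2 / (24 * sigma ^+ 2) =
  delta ^+ 2 / (24 * sigma ^+ 2 * s ^+ 6) * (s ^+ 3 * (r ^+ 2 + 3)) ^+ 2.
  by field; rewrite !gt_eqF.
have e2 : delta ^+ 2 * (r ^+ 2 + 3 * l ^+ 2) ^+ 2 / (24 * sigma ^+ 2 * l ^+ 3) =
  delta ^+ 2 / (24 * sigma ^+ 2 * s ^+ 6) * (r ^+ 2 + 3 * s ^+ 4) ^+ 2.
  by rewrite lE; field; rewrite !gt_eqF.
rewrite e1 e2; split.
  by rewrite ler_pM2l// ler_sqr ?nnegrE ?(ltW A0)// (le_trans (ltW A0)).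
rewrite (inj_eq (mulfI (lt0r_neq0 k0))) eqrXn2 ?(ltW A0) ?(le_trans (ltW A0))//.
apply/eqP/eqP => [E|lE1]; last first.
  by rewrite (_ : s = 1) ?/s ?lE1 ?sqrtr1//; ring.
have : (1 - s) ^+ 2 * (1 + 2 * s + 3 * s ^+ 2) <= 0.
  by rewrite -subr_ge0 -E subrr in p *; rewrite sub0r lerNr oppr0; lra.
rewrite pmulr_lle0// real_exprn_even_le0//= ?num_real// subr_eq0 => /eqP s1E.
by rewrite lE -s1E expr1n.
Qed.

Lemma rate_le_busy_cost z l : 0 <= z -> 0 < l <= 1 -> rate z <= busy_cost z l.
Proof.
move=> z0 l01; rewrite (sqrt_param z)//; set r := Num.sqrt _.
have r0 : 0 <= r by rewrite sqrtr_ge0.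
have [r1|/ltW r1] := leP r 1; last by have [] := cost_large r l r1 l01.
case/andP : l01 => l0 l1.
rewrite cost_small ?r0// lerDl; apply: divr_ge0; last first.
  by rewrite !mulr_ge0 ?exprn_ge0// ltW.
apply: mulr_ge0; first by rewrite mulr_ge0 ?sqr_ge0.
by rewrite !addr_ge0 ?mulr_ge0 ?sqr_ge0// ltW.
Qed.

Let length_param r : 0 <= r -> busy_length (delta * r ^+ 2 / 6) = Num.min 1 r.
Proof.
move=> r0; rewrite /busy_length (_ : _ / delta = r ^+ 2).
  by rewrite sqrtr_sqr ger0_norm.
by field; rewrite gt_eqF.
Qed.

Lemma rate_busy_length z : 0 < z -> rate z = busy_cost z (busy_length z).
Proof.
move=> z0; have := sqrt_param z (ltW z0).
have : 0 < Num.sqrt (6 * z / delta) by rewrite sqrtr_gt0 divr_gt0// mulr_gt0.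
move: (Num.sqrt _) => r r0 -> {z0}; rewrite length_param ?(ltW r0)//.
have [r1|/ltW r1] := leP r 1.
  rewrite cost_small ?(ltW r0)//.
  by rewrite subrr expr0n/= mulr0 !mul0r addr0.
have [] := cost_large r 1 r1 _; first by rewrite ltr01 lexx.
by rewrite eqxx => _ /eqP.
Qed.

Lemma busy_cost_eq_rate z l : 0 < z -> 0 < l <= 1 ->
  rate z = busy_cost z l -> l = busy_length z.
Proof.
move=> z0 l01; have := sqrt_param z (ltW z0).
have : 0 < Num.sqrt (6 * z / delta) by rewrite sqrtr_gt0 divr_gt0// mulr_gt0.
move: (Num.sqrt _) => r r0 -> {z0}; rewrite length_param ?(ltW r0)//.
have [r1|/ltW r1] := leP r 1; last first.
  by move=> /eqP; have [_ ->] := cost_large r l r1 l01; move/eqP.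
case/andP : l01 => l0 l1.
rewrite cost_small ?(ltW r0)// -[LHS]addr0 => /addrI/esym/eqP.
have p0 : 0 < r ^+ 2 + 2 * r * l + 9 * l ^+ 2.
  by rewrite !addr_gt0 ?mulr_gt0 ?exprn_gt0.
have c0 : 0 < delta ^+ 2 * (r ^+ 2 + 2 * r * l + 9 * l ^+ 2) /
     (24 * sigma ^+ 2 * l ^+ 3).
  by rewrite divr_gt0 ?mulr_gt0 ?exprn_gt0.
rewrite (_ : _ / _ = (r - l) ^+ 2 * (delta ^+ 2 *
  (r ^+ 2 + 2 * r * l + 9 * l ^+ 2) / (24 * sigma ^+ 2 * l ^+ 3))); last first.
  by field; rewrite !gt_eqF.
by rewrite mulf_eq0 (gt_eqF c0) orbF sqrf_eq0 subr_eq0 => /eqP.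
Qed.

Lemma rate0 : rate 0 = 0.
Proof. by rewrite /rate /Wbar_rate ifT ?divr_ge0 ?ltW// !mul0r sqrtr0 mulr0. Qed.

Lemma busy_cost_mono u y z l : 0 <= u -> 0 <= z -> u * z <= y -> 0 < l -> u <= 1 ->
  u ^+ 2 * busy_cost z l <= busy_cost y l.
Proof.
move=> u0 z0 uzy l0 u1; rewrite /busy_cost mulrA ler_pM2r; last first.
  by rewrite invr_gt0 !mulr_gt0 ?exprn_gt0.
have q0 : 0 <= delta / 2 * l ^+ 2.
  by apply: mulr_ge0; [rewrite divr_ge0// ltW|rewrite exprn_ge0// ltW].
have y0 : 0 <= y by rewrite (le_trans _ uzy)// mulr_ge0.
rewrite mulrCA ler_pM2l// -exprMn ler_sqr ?nnegrE ?mulr_ge0 ?addr_ge0//.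
by rewrite mulrDr lerD// ler_piMl.
Qed.

Lemma rate_ge0 z : 0 <= z -> 0 <= rate z.
Proof.
rewrite le_eqVlt => /predU1P[<-|z0]; first by rewrite rate0.
rewrite rate_busy_length// /busy_cost; apply: divr_ge0.
  by rewrite mulr_ge0 ?sqr_ge0.
have l0 := ltW (busy_length_gt0 z z0).
by apply: mulr_ge0; [rewrite mulr_ge0 ?sqr_ge0|rewrite exprn_ge0].
Qed.

(** A monotonicity with room: it gives that the rate is nondecreasing (u = 1) and
    also, letting u tend to 1, its lower semicontinuity, without any continuity
    argument on the formula. *)
Lemma rate_scale u y z : 0 <= u <= 1 -> 0 <= z -> u * z <= y -> 
  u ^+ 2 * rate z <= rate y.
Proof.
move=> /andP[u0 u1] z0 uzy.
have y0 : 0 <= y by rewrite (le_trans _ uzy) ?mulr_ge0.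
move: y0; rewrite le_eqVlt => /predU1P[y0|y0].
  move: uzy; rewrite -y0 => uz0; have {uz0} : u * z == 0.
    by rewrite eq_le uz0 mulr_ge0.
  by rewrite mulf_eq0 => /orP[]/eqP ->; rewrite ?expr0n/= rate0 ?mul0r ?mulr0.
have l0 := busy_length_gt0 y y0; have l1 := busy_length_le1 y.
rewrite (rate_busy_length y)//.
apply: le_trans (busy_cost_mono u y z _ u0 z0 uzy l0 u1).
by rewrite ler_wpM2l ?sqr_ge0// rate_le_busy_cost// l0 l1.
Qed.

End RateFunction.

(** * The Lindley recursion and summation over busy periods *)

Section Lindley.
Context {R : realType}.
Implicit Types (x y : nat -> R).

Definition walk x (n : nat) : R := \sum_(i < n) x i.

Lemma walkS x n : walk x n.+1 = walk x n + x n.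
Proof. by rewrite /walk big_ord_recr. Qed.

Lemma W_ge0 x n : 0 <= W x n.
Proof. by case: n => //= n; rewrite le_max lexx orbT. Qed.

Lemma W_ge_walk x i j : (i <= j)%N -> walk x j - walk x i <= W x j.
Proof.
elim: j => [|j IH]; first by rewrite leqn0 => /eqP ->; rewrite subrr.
rewrite leq_eqVlt => /predU1P[->|]; first by rewrite subrr W_ge0.
rewrite ltnS => /IH H; rewrite /= le_max walkS; apply/orP; left.
by rewrite addrAC lerD2r.
Qed.

(** With [W_ge_walk], this is the reflection formula: the waiting time is the
    maximum over i <= j of the increments of the walk from i to j. *)
Lemma W_walk x j : exists2 i, (i <= j)%N & W x j = walk x j - walk x i.
Proof.
elim: j => [|j [i ij IH]]; first by exists 0%N => //=; rewrite subrr.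
have [H|H] := leP 0 (W x j + x j).
  exists i; first exact: leqW.
  by rewrite /= max_l// IH walkS addrAC.
by exists j.+1 => //=; rewrite max_r ?(ltW H)// subrr.
Qed.

Lemma W_lipschitz x y n (a : R) :
  (forall j, (j <= n)%N -> `|walk x j - walk y j| <= a) ->
  forall j, (j <= n)%N -> `|W x j - W y j| <= 2 * a.
Proof.
move=> xy j jn.
have [i ij xE] := W_walk x j; have [k kj yE] := W_walk y j.
have xk := W_ge_walk x k j kj; have yi := W_ge_walk y i j ij.
have := xy j jn; have := xy i (leq_trans ij jn); have := xy k (leq_trans kj jn).
by rewrite !ler_norml; lra.
Qed.

Local Arguments W {R} x n : simpl never.

Lemma WS x n : W x n.+1 = Num.max (W x n + x n) 0.
Proof. by []. Qed.

(** Summation by parts for the Lindley recursion.  The weight b j decreases by 1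
    at each busy step, so that b j.+1 * W x j.+1 - b j * W x j is equal to
    b j * x j - W x j.+1 at a busy step, and at most 0 at an idle one, where
    W x j.+1 = 0. *)
Lemma busy_summation x (b : nat -> R) K :
  (forall j, (j < K)%N -> b j = b j.+1 + (0 < W x j.+1)%R%:R) ->
  (forall j, 0 <= b j) ->
  b K * W x K + \sum_(j < K) W x j.+1 <= \sum_(j < K) (0 < W x j.+1)%R%:R * b j * x j.
Proof.
move=> bE b0; elim: K bE => [|K IH] bE; first by rewrite !big_ord0 mulr0 addr0.
rewrite !big_ord_recr/=.
have {}IH := IH (fun j jK => bE j (ltnW jK)).
have bK := bE K (ltnSn K).
have [w0|w0] := ltP 0 (W x K.+1).
  rewrite w0 mulr1n in bK.
  have WK : W x K.+1 = W x K + x K.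
    by move: w0; rewrite WS; case: (leP (W x K + x K) 0); rewrite ?ltxx.
  apply: le_trans (lerD IH (lexx _)); rewrite mul1r WK bK.
  rewrite le_eqVlt; apply/orP; left; apply/eqP; ring.
have WK : W x K.+1 = 0 by apply/eqP; rewrite eq_le w0 W_ge0.
rewrite WK mulr0 add0r !mul0r !addr0.
by apply: le_trans IH; rewrite lerDr mulr_ge0 ?W_ge0.
Qed.

End Lindley.

Section BusyCounting.
Context {R : realType}.
Variables (O : nat -> bool) (K : nat).

(** The weights for which the summation by parts above returns the plain sum of
    the waiting times: O is the busy pattern, and the weight vanishes at the
    end. *)
Definition remaining (j : nat) : nat := \sum_(j <= k < K) O k.

Lemma remainingK : remaining K = 0%N.
Proof. by rewrite /remaining big_geq. Qed.

Lemma remainingS j : (j < K)%N -> remaining j = (remaining j.+1 + O j)%N.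
Proof. by move=> jK; rewrite /remaining big_ltn// addnC. Qed.

Lemma remaining0_le : (remaining 0 <= K)%N.
Proof.
rewrite /remaining (leq_trans (n := \sum_(0 <= k < K) 1)%N)//.
  by apply: leq_sum => i _; case: (O i).
by rewrite sum_nat_const_nat subn0 muln1.
Qed.

(** Over the busy indices, [remaining] runs through remaining 0, ..., 2, 1. *)
Lemma sum_busy (g f : R -> R) : g 0 = 0 ->
  (forall t : nat, f t.+1%:R = g t.+1%:R - g t%:R) ->
  \sum_(j < K) (O j)%:R * f (remaining j)%:R = g (remaining 0)%:R.
Proof.
move=> g0 fg.
transitivity (\sum_(j < K) (g (remaining j)%:R - g (remaining j.+1)%:R)).
  apply: eq_bigr => j _; rewrite remainingS//; case: (O j).
    by rewrite mul1r addn1 fg.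
  by rewrite mul0r addn0 subrr.
rewrite -(big_mkord xpredT (fun j => g (remaining j)%:R - g (remaining j.+1)%:R)).
rewrite (telescope_sumr_eq (fun j => - g (remaining j)%:R))//.
  by rewrite remainingK g0 oppr0 add0r opprK.
by move=> j _; rewrite opprK addrC.
Qed.

Lemma sum_busy1 : \sum_(j < K) (O j)%:R * (remaining j)%:R =
  (remaining 0)%:R * ((remaining 0)%:R + 1) / 2 :> R.
Proof.
rewrite (sum_busy (fun t => t * (t + 1) / 2) id)// ?mul0r// => t.
by rewrite -natr1; field.
Qed.

Lemma sum_busy2 : \sum_(j < K) (O j)%:R * (remaining j)%:R ^+ 2 =
  (remaining 0)%:R * ((remaining 0)%:R + 1) * (2 * (remaining 0)%:R + 1) / 6 :> R.
Proof.
rewrite (sum_busy (fun t => t * (t + 1) * (2 * t + 1) / 6) (fun t => t ^+ 2))//.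
  by rewrite !mul0r.
by move=> t; rewrite -natr1; field.
Qed.

End BusyCounting.

(** * Lower bound on probabilities: following the optimal path *)

Section OptimalDrift.
Context {R : realType}.
Variables (delta c L : R).
Hypotheses (delta_gt0 : 0 < delta) (L_gt0 : 0 < L) (L_le1 : L <= 1)
  (cL_ge : 2 * delta <= c * L) (cL_eq : L < 1 -> c * L = 2 * delta).

Local Arguments W {R} x n : simpl never.

Let u (t : R) : R := Num.max (L - t) 0.

(** The parabola of the optimal path until the time L, continued by the line of
    slope - delta: the path of the walk, before reflection at 0. *)
Definition free_path (t : R) : R := c * (L ^+ 2 - u t ^+ 2) / 2 - delta * t.

Definition optimal_path (t : R) : R := free_path (Num.min t L).

Definition optimal_drift (n i : nat) : R :=
  n%:R * (free_path (i.+1%:R / n%:R) - free_path (i%:R / n%:R)).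

Let c_gt0 : 0 < c.
Proof.
by rewrite -(pmulr_lgt0 _ L_gt0) (lt_le_trans _ cL_ge)// mulr_gt0.
Qed.

Let u_small t : t <= L -> u t = L - t.
Proof. by move=> tL; rewrite /u max_l// subr_ge0. Qed.

Let u_large t : L <= t -> u t = 0.
Proof. by move=> tL; rewrite /u max_r// subr_le0. Qed.

Let u_ge0 t : 0 <= u t.
Proof. by rewrite /u le_max lexx orbT. Qed.

Let free0 : free_path 0 = 0.
Proof. by rewrite /free_path u_small ?ltW// subr0 subrr !mulr0 mul0r subr0. Qed.

Let free_small t : t <= L -> free_path t = t * ((c * L / 2 - delta) + c / 2 * (L - t)).
Proof. by move=> tL; rewrite /free_path u_small//; field. Qed.

Let free_ge0 t : 0 <= t <= L -> 0 <= free_path t.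
Proof.
move=> /andP[t0 tL]; rewrite free_small// mulr_ge0// addr_ge0//.
  by have := cL_ge; lra.
by rewrite mulr_ge0 ?subr_ge0// divr_ge0// ltW.
Qed.

Let free_large t : L < 1 -> L <= t -> free_path t = delta * (L - t).
Proof.
move=> L1 tL; rewrite /free_path u_large// expr0n/= subr0.
rewrite (_ : c * L ^+ 2 = c * L * L); last by ring.
by rewrite cL_eq//; field.
Qed.

(** Until the time L the free path is nonnegative and is not reflected.  After
    it, which occurs only if L < 1, it starts from 0 and decreases, so the
    reflected path stays at 0. *)
Lemma W_drift n j : (0 < n)%N -> (j <= n)%N ->
  W (optimal_drift n) j = n%:R * optimal_path (j%:R / n%:R).
Proof.
move=> n0; have n0R : 0 < n%:R :> R by rewrite ltr0n.
elim: j => [_|j IH jn].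
  by rewrite mul0r /optimal_path min_l ?(ltW L_gt0)// free0 mulr0.
rewrite WS IH ?(ltnW jn)//.
have t0 : 0 <= j%:R / n%:R :> R by rewrite divr_ge0.
have tt' : j%:R / n%:R <= j.+1%:R / n%:R :> R by rewrite ler_pM2r ?invr_gt0// ler_nat.
have t'1 : j.+1%:R / n%:R <= 1 :> R by rewrite ler_pdivrMr// mul1r ler_nat.
rewrite /optimal_drift -mulrDr /optimal_path.
have [t'L|Lt'] := leP (j.+1%:R / n%:R) L.
  have tL := le_trans tt' t'L.
  rewrite (min_l tL) addrCA subrr addr0 max_l//.
  by rewrite mulr_ge0 ?free_ge0// t'L andbT (le_trans t0).
have L1 := lt_le_trans Lt' t'1.
rewrite (free_large L)// subrr mulr0 mulr0 max_r// mulr_ge0_le0 ?(ltW n0R)//.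
have [tL|Lt] := leP (j%:R / n%:R) L.
  rewrite addrCA subrr addr0 free_large ?(ltW Lt')//.
  by rewrite mulr_ge0_le0 ?subr_le0 ?(ltW Lt')// ltW.
rewrite (free_large L)// subrr mulr0 add0r !free_large ?(ltW Lt') ?(ltW Lt)//.
by rewrite -mulrBr mulr_ge0_le0 ?(ltW delta_gt0)//; lra.
Qed.

Let F t := c * (L * t ^+ 2 / 2 - t ^+ 3 / 6) - delta * t ^+ 2 / 2.

Let path_cell t h : 0 <= t -> 0 < h -> t + h <= 1 ->
  `|h * optimal_path (t + h) - (F (Num.min (t + h) L) - F (Num.min t L))|
  <= (c * L + delta) * h ^+ 2.
Proof.
move=> t0 h0 th1; rewrite /optimal_path.
have C0 : 0 <= c * L + delta by rewrite addr_ge0 ?mulr_ge0 ?ltW.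
have cell a w : 0 <= a -> 0 <= w -> a + w <= L -> w <= h ->
  `|w * free_path (a + w) - (F (a + w) - F a)| <= (c * L + delta) * h ^+ 2.
  move=> a0 w0 aw wh.
  have -> : w * free_path (a + w) - (F (a + w) - F a) =
    w ^+ 2 * (c * L / 2 - delta / 2 - c * (3 * a + 2 * w) / 6).
    by rewrite free_small// /F; field.
  rewrite normrM ger0_norm ?sqr_ge0// mulrC.
  apply: ler_pM; rewrite ?sqr_ge0 ?normr_ge0//; last first.
    by rewrite ler_sqr ?nnegrE// (le_trans w0).
  have c0 := ltW c_gt0.
  have p0 : 0 <= c * (3 * a + 2 * w) by apply: mulr_ge0 => //; lra.
  have p1 : c * (3 * a + 2 * w) <= c * (3 * L) by apply: ler_wpM2l => //; lra.
  have d0 := delta_gt0.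
  move: p0 p1; rewrite ler_norml => p0 p1; lra.
have [thL|Lth] := leP (t + h) L.
  have tL : t <= L by lra.
  by rewrite (min_l tL); apply: cell => //; exact: ltW.
have L1 : L < 1 by apply: lt_le_trans th1.
have fL : free_path L = 0 by rewrite free_large// subrr mulr0.
have [tL|Lt] := leP t L; last first.
  by rewrite fL subrr mulr0 subr0 normr0 mulr_ge0// sqr_ge0.
have := cell t (L - t) t0; rewrite subr_ge0 tL addrC subrK fL !mulr0.
by apply => //; rewrite lerBlDl ltW.
Qed.

(** A Riemann sum: F is a primitive of [free_path] on [0, L], and its value at L is the area below the optimal path. *)
Lemma mean_optimal_path n : (0 < n)%N ->
  `|n%:R^-1 * (n%:R^-1 * \sum_(1 <= i < n.+1) W (optimal_drift n) i)
     - (c * L ^+ 3 / 3 - delta * L ^+ 2 / 2)| <= (c * L + delta) / n%:R.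
Proof.
move=> n0; have n0R : 0 < n%:R :> R by rewrite ltr0n.
pose h : R := n%:R^-1.
have h0 : 0 < h by rewrite invr_gt0.
have tS i : i.+1%:R / n%:R = i%:R / n%:R + h by rewrite -natr1 mulrDl mul1r.
rewrite big_add1 /= big_mkord.
have -> : h * (h * \sum_(i < n) W (optimal_drift n) i.+1) =
  \sum_(i < n) h * optimal_path (i%:R / n%:R + h).
  rewrite mulrA mulr_sumr; apply: eq_bigr => i _.
  by rewrite W_drift// tS mulrA /h mulrVK ?unitfE ?gt_eqF.
have -> : c * L ^+ 3 / 3 - delta * L ^+ 2 / 2 =
  \sum_(i < n) (F (Num.min (i%:R / n%:R + h) L) - F (Num.min (i%:R / n%:R) L)).
  under eq_bigr do rewrite -tS.
  rewrite -(big_mkord xpredT (fun i => F (Num.min (i.+1%:R / n%:R) L) -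
    F (Num.min (i%:R / n%:R) L))) (telescope_sumr _ (leq0n n)).
  by rewrite mul0r divff ?gt_eqF// (min_r L_le1) (min_l (ltW L_gt0)) /F; field.
rewrite -sumrB (le_trans (ler_norm_sum _ _ _))//.
apply: (@le_trans _ _ (\sum_(i < n) (c * L + delta) * h ^+ 2)).
  apply: ler_sum => i _; apply: path_cell => //.
  by rewrite -tS ler_pdivrMr// mul1r ler_nat.
rewrite sumr_const card_ord -mulr_natr /h le_eqVlt; apply/orP; left; apply/eqP.
by field; rewrite gt_eqF.
Qed.

(** The Riemann sum of (c u)^2, where u is the remaining busy time, compared cell
    by cell with the primitive c^2 u^3 / 3. *)
Lemma drift_energy n : (0 < n)%N ->
  \sum_(i < n) (optimal_drift n i + delta) ^+ 2 <= n%:R * (c ^+ 2 * L ^+ 3 / 3).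
Proof.
move=> n0; have n0R : 0 < n%:R :> R by rewrite ltr0n.
pose h : R := n%:R^-1.
have h0 : 0 < h by rewrite invr_gt0.
have tS i : i.+1%:R / n%:R = i%:R / n%:R + h by rewrite -natr1 mulrDl mul1r.
have nh : n%:R * h = 1 by rewrite /h mulfV// gt_eqF.
pose v i := u (i%:R / n%:R).
apply: (@le_trans _ _ (\sum_(i < n) n%:R * c ^+ 2 / 3 * (v i ^+ 3 - v i.+1 ^+ 3))).
  apply: ler_sum => i _.
  rewrite /optimal_drift /free_path -/(v i) -/(v i.+1).
  have -> : n%:R * (c * (L ^+ 2 - v i.+1 ^+ 2) / 2 - delta * (i.+1%:R / n%:R) -
     (c * (L ^+ 2 - v i ^+ 2) / 2 - delta * (i%:R / n%:R))) + delta =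
     n%:R * c * (v i ^+ 2 - v i.+1 ^+ 2) / 2.
    by rewrite -natr1; field; rewrite gt_eqF.
  have v0 : 0 <= v i.+1 by exact: u_ge0.
  have vv : v i.+1 <= v i.
    by rewrite /v /u tS; case: (leP (L - i%:R / n%:R) 0);
      case: (leP (L - (i%:R / n%:R + h)) 0); lra.
  have vh : v i <= v i.+1 + h.
    by rewrite /v /u tS; case: (leP (L - i%:R / n%:R) 0);
      case: (leP (L - (i%:R / n%:R + h)) 0); lra.
  set a := v i in vv vh *; set b := v i.+1 in v0 vv vh *.
  have -> : (n%:R * c * (a ^+ 2 - b ^+ 2) / 2) ^+ 2 =
    n%:R * c ^+ 2 / 3 * (n%:R * (a - b) * (3 / 4 * (a - b) * (a + b) ^+ 2)) by field.
  apply: ler_wpM2l; first by rewrite divr_ge0// mulr_ge0 ?sqr_ge0.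
  have nab : n%:R * (a - b) <= 1 by rewrite -[leRHS]nh ler_pM2l//; lra.
  have ab0 : 0 <= a - b by lra.
  apply: (@le_trans _ _ (3 / 4 * (a - b) * (a + b) ^+ 2)).
    by apply: ler_piMl => //; apply: mulr_ge0; [rewrite mulr_ge0|exact: sqr_ge0].
  rewrite -subr_ge0 (_ : _ - _ = (a - b) ^+ 3 / 4); last by field.
  by rewrite divr_ge0 ?exprn_ge0.
rewrite -mulr_sumr -(big_mkord xpredT (fun i => v i ^+ 3 - v i.+1 ^+ 3)).
rewrite (telescope_sumr_eq (fun i => - v i ^+ 3))//; last first.
  by move=> i _; rewrite opprK addrC.
rewrite opprK /v mul0r divff ?gt_eqF// u_large// u_small ?(ltW L_gt0)// subr0.
by rewrite expr0n/= oppr0 add0r le_eqVlt; apply/orP; left; apply/eqP; field.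
Qed.

End OptimalDrift.

(** From expR y >= 1 + y at y = beta n / 2, squared. *)
Lemma exp_beats_linear {R : realType} (A beta : R) : 0 <= A -> 0 < beta ->
  exists N, forall n, (N <= n)%N -> A * (n%:R + 1) <= expR (beta * n%:R).
Proof.
move=> A0 b0; exists (Num.truncn (8 * A / beta ^+ 2)).+1 => n Nn.
have n1 : 1 <= n%:R :> R by rewrite ler1n (leq_trans _ Nn).
have b2 : 0 < beta ^+ 2 by rewrite exprn_gt0.
have H : 8 * A <= beta ^+ 2 * n%:R.
  rewrite [leRHS]mulrC -ler_pdivrMr//.
  apply: (@le_trans _ _ (Num.truncn (8 * A / beta ^+ 2)).+1%:R).
    exact/ltW/truncnS_gt.
  by rewrite ler_nat.
have -> : beta * n%:R = beta * n%:R / 2 + beta * n%:R / 2 by field.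
rewrite expRD.
have e1 : 1 + beta * n%:R / 2 <= expR (beta * n%:R / 2) by exact: expR_ge1Dx.
have bn0 : 0 <= beta * n%:R by rewrite mulr_ge0 ?(ltW b0).
apply: (@le_trans _ _ ((beta * n%:R / 2) * (beta * n%:R / 2))); last first.
  by apply: ler_pM; lra.
rewrite (_ : beta * n%:R / 2 * (beta * n%:R / 2) = beta ^+ 2 * n%:R * n%:R / 4); last by field.
apply: (@le_trans _ _ (8 * A * n%:R / 4)); last first.
  by rewrite ler_pM2r// ler_wpM2r.
have An : A * 1 <= A * n%:R by apply: ler_wpM2l.
move: An H; rewrite mulr1 => An H; lra.
Qed.

Lemma sum_below {R : realType} (f : nat -> R) n j : (j <= n)%N ->
  \sum_(i < n) f i * (i < j)%N%:R = \sum_(i < j) f i.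
Proof.
move=> jn; rewrite (big_ord_widen n f jn) [RHS]big_mkcond/=.
by apply: eq_bigr => i _; case: ifP => _; rewrite ?mulr1 ?mulr0.
Qed.

Section WaitingTimes.
Context {d : measure_display} {T : measurableType d} {R : realType}.
Variables (P : probability T R) (X : nat -> {RV P >-> R}).

Local Arguments W {R} x n : simpl never.

Definition area (n : nat) (w : T) : R := n%:R^-1 * Wbar (fun k => X k w) n.

Lemma measurable_W n : measurable_fun [set: T] (fun w => W (fun k => X k w) n).
Proof.
elim: n => [|n IH]; first exact: measurable_cst.
apply: measurable_maxr; last exact: measurable_cst.
exact: measurable_funD.
Qed.

Lemma measurable_area n : measurable_fun [set: T] (area n).
Proof.
apply: measurable_funM; first exact: measurable_cst.
apply: measurable_funM; first exact: measurable_cst.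
by apply: measurable_sum => i; exact: measurable_W.
Qed.

Lemma area_ge0 n w : 0 <= area n w.
Proof.
by rewrite /area /Wbar !mulr_ge0 ?invr_ge0// sumr_ge0// => i _; exact: W_ge0.
Qed.

Variables (delta sigma : R).
Hypotheses (delta_gt0 : 0 < delta) (sigma_gt0 : 0 < sigma)
  (X_iid : iid_gaussian (- delta) sigma X).

Let Lam := linear_statistic P X delta.

Let Lam_below n j w : (j <= n)%N ->
  Lam n (fun i => (i < j)%N%:R) w = walk (fun k => X k w) j + j%:R * delta.
Proof.
move=> jn; rewrite /Lam /linear_statistic.
under eq_bigr do rewrite mulrC.
rewrite (sum_below (fun i => X i w + delta))// big_split/=; congr (_ + _).
by rewrite sumr_const card_ord mulr_natl.
Qed.

(** The walk is constrained, at all times j <= n, to stay within eta n of the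
    walk with the optimal drift.  The area is then within e of z, and the energy
    of the drift is n times the rate. *)
Lemma area_lower_bound (z e kappa : R) : 0 < z -> 0 < e -> 0 < kappa ->
  exists N, forall n, (N <= n)%N ->
    ((expR (- (n%:R * (Wbar_rate delta sigma z + kappa))))%:E <=
      P [set w | (`|area n w - z| < e)%R])%E.
Proof.
move=> z0 e0 k0.
pose L := busy_length delta z.
have L0 : 0 < L by exact: busy_length_gt0.
have L1 : L <= 1 by exact: busy_length_le1.
pose c : R := 3 * (z + delta / 2 * L ^+ 2) / L ^+ 3.
have zL : delta * L ^+ 2 / 6 <= z.
  rewrite [leRHS](sqrt_param delta delta_gt0 z (ltW z0)) ler_pM2r// ler_pM2l//.
  by rewrite ler_sqr ?nnegrE ?sqrtr_ge0 ?(ltW L0)// /L /busy_length ge_min lexx orbT.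
have cLE : c * L - 2 * delta = 3 * (z - delta * L ^+ 2 / 6) / L ^+ 2.
  by rewrite /c; field; rewrite gt_eqF.
have cL : 2 * delta <= c * L.
  by rewrite -subr_ge0 cLE divr_ge0 ?sqr_ge0// mulr_ge0// subr_ge0.
have cLeq : L < 1 -> c * L = 2 * delta.
  move=> Llt; apply/eqP; rewrite -subr_eq0 cLE.
  suff -> : z = delta * L ^+ 2 / 6 by rewrite subrr mulr0 mul0r.
  rewrite [LHS](sqrt_param delta delta_gt0 z (ltW z0)).
  rewrite /L /busy_length; move: Llt; rewrite /L /busy_length.
  by case: (leP 1 (Num.sqrt (6 * z / delta))) => // _; rewrite ltxx.
have cz : c * L ^+ 3 / 3 - delta * L ^+ 2 / 2 = z.
  by rewrite /c; field; rewrite gt_eqF.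
have rE : Wbar_rate delta sigma z = c ^+ 2 * L ^+ 3 / (6 * sigma ^+ 2).
  rewrite (rate_busy_length delta sigma delta_gt0 sigma_gt0)// /busy_cost -/L /c.
  by field; rewrite !gt_eqF.
have r0 : 0 <= c ^+ 2 * L ^+ 3 by rewrite mulr_ge0 ?sqr_ge0// exprn_ge0// ltW.
pose V : R := 1 + c ^+ 2 * L ^+ 3 / 3.
have V0 : 0 < V by rewrite /V; lra.
have s20 : 0 < sigma ^+ 2 by rewrite exprn_gt0.
pose eta : R := Num.min (e / 4) (kappa * sigma ^+ 2 / 4).
have eta0 : 0 < eta by rewrite lt_min !divr_gt0// mulr_gt0.
have etae : eta <= e / 4 by rewrite ge_min lexx.
have etak : eta <= kappa * sigma ^+ 2 / 4 by rewrite ge_min lexx orbT.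
pose beta : R := eta ^+ 2 / (2 * sigma ^+ 2 * V).
have beta0 : 0 < beta by rewrite divr_gt0 ?exprn_gt0// !mulr_gt0.
have [N1 HN1] := exp_beats_linear 6 beta (ler0n _ _) beta0.
have [N2 HN2] := exp_beats_linear 2 (kappa / 2) (ler0n _ _) (divr_gt0 k0 (ltr0Sn _ _)).
pose N3 := (Num.truncn (2 * (c * L + delta) / e)).+1.
exists (maxn N1 (maxn N2 N3)) => n; rewrite !geq_max => /and3P[nN1 nN2 nN3].
have n0 : (0 < n)%N by apply: leq_trans nN3.
have n0R : 0 < n%:R :> R by rewrite ltr0n.
pose b i := optimal_drift delta c L n i + delta.
have b2 : \sum_(i < n) b i ^+ 2 <= n%:R * (c ^+ 2 * L ^+ 3 / 3).
  exact: drift_energy.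
(* Constraint 0 is the one on b; constraint j.+1 bounds the walk at time j from
   above, and constraint j + n.+2 from below. *)
pose ds k : nat -> R := if k == 0%N then b
  else if (k <= n.+1)%N then (fun i => (i < k.-1)%N%:R)
  else (fun i => - (i < k - n.+2)%N%:R).
have a0 : 0 < eta * n%:R by rewrite mulr_gt0.
have v0 : 0 < n%:R * V by rewrite mulr_gt0.
have dsv k : (k <= n.*2.+2)%N -> \sum_(i < n) ds k i ^+ 2 <= n%:R * V.
  move=> km.
  have le1 (f : nat -> R) : (forall i, f i ^+ 2 <= 1) ->
      \sum_(i < n) f i ^+ 2 <= n%:R * V.
    move=> f1; apply: (@le_trans _ _ (\sum_(i < n) 1)).
      by apply: ler_sum.
    by rewrite sumr_const card_ord -[leLHS]mulr1 ler_pM2l// /V; lra.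
  rewrite /ds; case: ifP => _.
    apply: (le_trans b2); rewrite ler_pM2l// /V; lra.
  case: ifP => _; [apply: (le1 (fun i => (i < k.-1)%N%:R))|
    apply: (le1 (fun i => - (i < k - n.+2)%N%:R))] => i; rewrite ?sqrrN; case: (_ < _)%N => /=;
    by rewrite ?expr1n ?expr0n.
have := tilted_lower_bound P X delta sigma sigma_gt0 X_iid n n.*2.+2 b ds
  (eta * n%:R) (n%:R * V) a0 v0 erefl dsv.
set G := [set w | _] => tilt.
have mG : measurable G.
  rewrite (_ : G = \bigcap_(k in [set k | (k <= n.*2.+2)%N]) [set w |
     Lam n (ds k) w < eta * n%:R + \sum_(i < n) b i * ds k i])//.
  apply: bigcap_measurableType => k _.
  rewrite (_ : [set w | _] = Lam n (ds k) @^-1`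
    `]-oo, (eta * n%:R + \sum_(i < n) b i * ds k i)[).
    by rewrite -[X in measurable X]setTI; exact: measurable_linear_statistic.
  by apply/seteqP; split => w /=; rewrite in_itv.
have GA : G `<=` [set w | `|area n w - z| < e].
  move=> w Gw /=.
  have walkE j : (j <= n)%N ->
    `|walk (fun k => X k w) j - walk (optimal_drift delta c L n) j| <= eta * n%:R.
    move=> jn.
    have bj : \sum_(i < n) b i * (i < j)%N%:R =
        walk (optimal_drift delta c L n) j + j%:R * delta.
      rewrite sum_below// /b big_split/=; congr (_ + _).
      by rewrite sumr_const card_ord mulr_natl.
    have d1 : ds j.+1 = fun i => (i < j)%N%:R by rewrite /ds ltnS jn.
    have d2 : ds (j + n.+2)%N = fun i => - (i < j)%N%:R.
      have jn4 : (n.+1 < j + n.+2)%N by rewrite ltn_addl.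
      by rewrite /ds addn_eq0 andbF addnK leqNgt jn4.
    have jn2 : (j.+1 <= n.*2.+2)%N.
      by rewrite ltnS (leq_trans jn)// -addnn leqW// leq_addr.
    have := Gw j.+1 jn2; rewrite d1 -/Lam Lam_below// bj => H1.
    have jn3 : (j + n.+2 <= n.*2.+2)%N.
      by rewrite -addnn !addnS !ltnS leq_add2r.
    have := Gw (j + n.+2)%N jn3; rewrite d2.
    under eq_bigr do rewrite mulrN.
    rewrite sumrN bj (_ : linear_statistic _ _ _ _ _ _ = - Lam n (fun i => (i < j)%N%:R) w); last first.
      by rewrite /Lam /linear_statistic -sumrN; apply: eq_bigr => i _; rewrite mulNr.
    by rewrite Lam_below// => H2; rewrite ler_norml; lra.
  have WW := W_lipschitz _ _ _ _ walkE.
  have mean := mean_optimal_path delta c L delta_gt0 L0 L1 cL cLeq n n0.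
  rewrite cz in mean.
  have dd : `|area n w - n%:R^-1 * (n%:R^-1 *
      \sum_(1 <= i < n.+1) W (optimal_drift delta c L n) i)| <= 2 * eta.
    rewrite /area /Wbar -mulrBr -mulrBr -sumrB !normrM.
    rewrite !(ger0_norm (_ : 0 <= n%:R^-1)) ?invr_ge0//.
    rewrite ler_pdivrMl// ler_pdivrMl// (le_trans (ler_norm_sum _ _ _))//.
    rewrite big_nat_cond; apply: (@le_trans _ _ (\sum_(1 <= i < n.+1) 2 * (eta * n%:R))).
      rewrite [leRHS]big_nat_cond; apply: ler_sum => i; rewrite andbT => /andP[_ iN].
      by apply: WW; rewrite -ltnS.
    rewrite sumr_const_nat subn1/= -mulr_natr le_eqVlt.
    by apply/orP; left; apply/eqP; ring.
  have n3 : (c * L + delta) / n%:R < e / 2.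
    rewrite ltr_pdivrMr// -ltr_pdivrMl ?divr_gt0//.
    rewrite (_ : (e / 2)^-1 * (c * L + delta) = 2 * (c * L + delta) / e); last first.
      by field; rewrite gt_eqF.
    by apply: (lt_le_trans (truncnS_gt _)); rewrite ler_nat.
  have := ler_distD (n%:R^-1 * (n%:R^-1 *
      \sum_(1 <= i < n.+1) W (optimal_drift delta c L n) i)) (area n w) z.
  by move: mean dd n3 etae; lra.
apply: (@le_trans _ _ (P G)); last first.
  apply: le_measure => //; rewrite inE//.
  rewrite (_ : [set w | _] = area n @^-1` ball z e).
    by rewrite -[X in measurable X]setTI; apply: measurable_area => //; exact: measurable_ball.
  by apply/seteqP; split => w; rewrite /= -ball_normE /= distrC.
have PGf : P G \is a fin_num by rewrite fin_num_measure.
move: tilt; rewrite -(fineK PGf) -EFinM !lee_fin.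
set p := fine (P G); set S := \sum_(i < n) b i ^+ 2 / 2.
have -> : (eta * n%:R) ^+ 2 / (2 * sigma ^+ 2 * (n%:R * V)) = beta * n%:R.
  by rewrite /beta; field; rewrite !gt_eqF.
move=> tilt.
have half : 2^-1 <= expR ((S + eta * n%:R) / sigma ^+ 2) * p.
  apply: le_trans tilt.
  have H1 := HN1 n nN1; rewrite expRN.
  have E0 := expR_gt0 (beta * n%:R).
  suff : n.*2.+3%:R / expR (beta * n%:R) <= 2^-1 by lra.
  rewrite ler_pdivrMr//; apply: le_trans (_ : 3 * (n%:R + 1) <= _); last by lra.
  by rewrite -addnn -!natr1 natrD; lra.
have p0 : 0 <= p by rewrite fine_ge0.
have Sle : (S + eta * n%:R) / sigma ^+ 2 <= n%:R * (Wbar_rate delta sigma z + kappa / 4).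
  rewrite ler_pdivrMr// rE /S -mulr_suml.
  have -> : n%:R * (c ^+ 2 * L ^+ 3 / (6 * sigma ^+ 2) + kappa / 4) * sigma ^+ 2 =
     n%:R * (c ^+ 2 * L ^+ 3 / 3) / 2 + kappa * sigma ^+ 2 / 4 * n%:R.
    by field; rewrite gt_eqF.
  apply: lerD; first by rewrite ler_pM2r.
  by rewrite ler_pM2r.
have H2 : 2 <= expR (n%:R * (kappa / 2)).
  have := HN2 n nN2; rewrite mulrC [n%:R * _]mulrC => H; apply: le_trans H.
  by have n00 := ltW n0R; lra.
have H3 : 2^-1 <= expR (n%:R * (Wbar_rate delta sigma z + kappa / 4)) * p.
  by apply: (le_trans half); rewrite ler_wpM2r// ler_expR.
rewrite (_ : - (n%:R * _) = - (n%:R * (Wbar_rate delta sigma z + kappa / 4)) - n%:R * (kappa / 2)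
   - n%:R * (kappa / 4)); last by field.
rewrite !expRD.
set E1 := expR (n%:R * (Wbar_rate delta sigma z + kappa / 4)) in H3 *.
set E2 := expR (n%:R * (kappa / 2)) in H2 *.
have E10 : 0 < E1 by exact: expR_gt0.
have E20 : 0 < E2 by exact: expR_gt0.
rewrite !expRN -/E1 -/E2.
have E3 : (expR (n%:R * (kappa / 4)))^-1 <= 1.
  rewrite -expRN -expR0 ler_expR oppr_le0 mulr_ge0// ?(ltW n0R)//.
  by rewrite divr_ge0 ?(ltW k0).
apply: (@le_trans _ _ (E1^-1 * 2^-1 * 1)).
  apply: ler_pM => //; rewrite ?mulr_ge0 ?invr_ge0 ?expR_ge0 ?(ltW E10) ?(ltW E20)//.
  by rewrite ler_pM2l ?invr_gt0// lef_pV2 ?posrE.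
by rewrite mulr1 ler_pdivrMl.
Qed.

End WaitingTimes.

(** * Upper bound on probabilities: decomposition into blocks *)

Lemma measure_finite_union_le {d} {T : measurableType d} {R : realType}
    (P : {measure set T -> \bar R}) (I : eqType) (s : seq I) (B : I -> set T) (A : set T) :
  measurable A -> (forall i, measurable (B i)) ->
  (forall w, A w -> exists2 i, i \in s & B i w) ->
  (P A <= \sum_(i <- s) P (B i))%E.
Proof.
move=> mA mB; elim: s A mA => [|i s IH] A mA AB.
  rewrite big_nil (_ : A = set0) ?measure0//.
  by apply/seteqP; split => // w /AB[].
rewrite big_cons; apply: (@le_trans _ _ (P (B i) + P (A `\` B i))%E).
  apply: (le_trans _ (measureU2 _ _ _)) => //; last exact: measurableD.
  apply: le_measure; rewrite ?inE//.
    by apply: measurableU => //; exact: measurableD.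
  by move=> w Aw; have [Bw|Bw] := pselect (B i w); [left|right].
apply: leeD => //; apply: IH; first exact: measurableD.
move=> w [/AB[j]]; rewrite inE => /predU1P[->//|js] Bj nB.
by exists j.
Qed.

Lemma sum_blocks {R : realType} (F : nat -> R) K q :
  \sum_(i < K * q) F i = \sum_(j < K) \sum_(r < q) F (j * q + r)%N.
Proof.
elim: K => [|K IH]; first by rewrite mul0n !big_ord0.
rewrite big_ord_recr/= -IH -!(big_mkord xpredT) mulSn addnC.
rewrite (@big_cat_nat _ _ _ (K * q)) ?leq_addr//=; congr (_ + _).
rewrite -{1}(add0n (K * q)%N) big_addn addKn big_mkord.
by apply: eq_bigr => i _; rewrite addnC.
Qed.

Section WaitingTimesUpper.
Context {d : measure_display} {T : measurableType d} {R : realType}.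
Variables (P : probability T R) (X : nat -> {RV P >-> R}).
Variables (delta sigma : R).
Hypotheses (delta_gt0 : 0 < delta) (sigma_gt0 : 0 < sigma)
  (X_iid : iid_gaussian (- delta) sigma X).

Local Arguments W {R} x n : simpl never.
Let Lam := linear_statistic P X delta.
Let Xw (w : T) (k : nat) : R := X k w.

Section Blocks.
Variables (K q : nat) (q_gt0 : (0 < q)%N).
Let N := (K * q)%N.

(** Increments of the walk over the blocks. *)
Let xB (w : T) (j : nat) : R := \sum_(r < q) X (j * q + r)%N w.

Let walk_block w j : walk (xB w) j = walk (Xw w) (j * q).
Proof. by rewrite /walk (sum_blocks (Xw w)). Qed.

(** The maximizing indices of the reflection formula can be moved to the left
    ends of their blocks at the cost of the two fluctuations. *)
Let W_block w (a : R) :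
  (forall j r, (j < K)%N -> (r < q)%N ->
     `|walk (Xw w) (j * q + r) - walk (Xw w) (j * q)| <= a) ->
  forall i, (i < N)%N -> W (Xw w) i <= W (xB w) (i %/ q) + 2 * a.
Proof.
move=> H i iN; have [k ki ->] := W_walk (Xw w) i.
have dK j : (j < N)%N -> (j %/ q < K)%N by rewrite ltn_divLR.
have Hi := H (i %/ q)%N (i %% q)%N (dK i iN) (ltn_pmod _ q_gt0).
have Hk := H (k %/ q)%N (k %% q)%N (dK k (leq_ltn_trans ki iN)) (ltn_pmod _ q_gt0).
rewrite -!divn_eq in Hi Hk.
have := W_ge_walk (xB w) _ _ (leq_div2r q ki).
rewrite !walk_block; move: Hi Hk; rewrite !ler_norml.
by lra.
Qed.

Let sum_W_block w (a : R) :
  (forall j r, (j < K)%N -> (r < q)%N ->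
     `|walk (Xw w) (j * q + r) - walk (Xw w) (j * q)| <= a) ->
  \sum_(i < N) W (Xw w) i <= q%:R * \sum_(j < K) W (xB w) j.+1 + 2 * a * N%:R.
Proof.
move=> H.
apply: (@le_trans _ _ (\sum_(i < N) (W (xB w) (i %/ q)%N + 2 * a))).
  by apply: ler_sum => i _; exact: W_block.
rewrite big_split/= sumr_const card_ord -(mulr_natr (2 * a)) lerD2r.
rewrite (sum_blocks (fun i => W (xB w) (i %/ q)%N)).
rewrite mulr_sumr.
under eq_bigr => j _.
  under eq_bigr => r _ do rewrite divnMDl// divn_small// addn0.
  rewrite sumr_const card_ord -mulr_natl; over.
have S (k : nat) : \sum_(j < k) q%:R * W (xB w) j + q%:R * W (xB w) k =
    \sum_(j < k) q%:R * W (xB w) j.+1.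
  elim: k => [|k IH]; first by rewrite !big_ord0 add0r mulr0.
  by rewrite big_ord_recr/= IH big_ord_recr.
by rewrite -S lerDl mulr_ge0// W_ge0.
Qed.

(** A tuple of booleans is the set of busy blocks; its statistic weighs each
    increment of a busy block with the number of busy blocks from this one on. *)
Let Oof (s : K.-tuple bool) (j : nat) : bool := nth false s j.
Let weight (s : K.-tuple bool) (i : nat) : R :=
  (Oof s (i %/ q))%:R * (remaining (Oof s) K (i %/ q))%:R.
Let mm (s : K.-tuple bool) : R := (remaining (Oof s) K 0)%:R.

Let Lam_weight s w : Lam N (weight s) w =
  \sum_(j < K) (Oof s j)%:R * (remaining (Oof s) K j)%:R * xB w j +
    q%:R * delta * (mm s * (mm s + 1) / 2).
Proof.
rewrite /Lam /linear_statistic (sum_blocks (fun i => weight s i * (X i w + delta))).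
rewrite /mm -sum_busy1 mulr_sumr -big_split/=; apply: eq_bigr => j _.
under eq_bigr => r _ do rewrite /weight divnMDl// divn_small// addn0 mulrDr.
rewrite big_split/= -mulr_sumr -/(xB w j) sumr_const card_ord -mulr_natl.
by congr (_ + _); ring.
Qed.

Let weight_sq s : \sum_(i < N) weight s i ^+ 2 <= q%:R * (mm s + 2^-1) ^+ 3 / 3.
Proof.
rewrite (sum_blocks (fun i => weight s i ^+ 2)).
have E (j : 'I_K) : true -> \sum_(r < q) weight s (j * q + r) ^+ 2 =
    q%:R * ((Oof s j)%:R * (remaining (Oof s) K j)%:R ^+ 2).
  move=> _; rewrite (eq_bigr (fun=> (Oof s j)%:R * (remaining (Oof s) K j)%:R ^+ 2)).
    by rewrite sumr_const card_ord -[LHS]mulr_natl.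
  move=> r _; rewrite /weight divnMDl// divn_small// addn0 exprMn.
  by congr (_ * _); case: (Oof s j); rewrite ?expr1n ?expr0n.
rewrite (eq_bigr _ E).
rewrite -mulr_sumr sum_busy2 -/(mm s) -[leRHS]mulrA ler_wpM2l// -subr_ge0.
rewrite (_ : _ - _ = (mm s + 2^-1) / 12); last by field.
by rewrite divr_ge0// addr_ge0// /mm.
Qed.

(** Up to the drift, the statistic of this weight is the increment of the walk
    over the first r steps of block j. *)
Let bump (j r : nat) (i : nat) : R := ((j * q <= i) && (i < j * q + r))%N%:R.

Let Lam_bump j r w : (j < K)%N -> (r < q)%N ->
  Lam N (bump j r) w = walk (Xw w) (j * q + r) - walk (Xw w) (j * q) + r%:R * delta.
Proof.
move=> jK rq.
have jrN : (j * q + r <= N)%N.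
  rewrite /N (leq_trans (n := j.+1 * q)%N) ?leq_mul2r ?jK ?orbT//.
  by rewrite mulSn addnC leq_add2r ltnW.
have jN : (j * q <= N)%N by rewrite (leq_trans _ jrN)// leq_addr.
have e i : bump j r i = (i < j * q + r)%N%:R - (i < j * q)%N%:R.
  rewrite /bump; case: (leqP (j * q) i) => ji /=; first by rewrite subr0.
  by rewrite ltn_addr// subrr.
rewrite /Lam /linear_statistic.
under eq_bigr do rewrite e mulrBl !(mulrC (_%:R)).
rewrite big_split/= sumrN.
rewrite (sum_below (fun i => X i w + delta))// (sum_below (fun i => X i w + delta))//.
rewrite !big_split/= !sumr_const !card_ord -[delta *+ (_ + _)]mulr_natl.
rewrite -[delta *+ _]mulr_natl natrD /walk /Xw; ring.
Qed.

Let bump_sq j r (e : bool) : (j < K)%N -> (r < q)%N ->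
  \sum_(i < N) ((-1) ^+ e * bump j r i) ^+ 2 <= q%:R.
Proof.
move=> jK rq.
under eq_bigr do rewrite exprMn sqrr_sign mul1r.
rewrite (sum_blocks (fun i => bump j r i ^+ 2)).
rewrite (bigD1 (Ordinal jK))//= [X in _ + X]big1 ?addr0; last first.
  move=> k kj; apply: big1 => t _; rewrite /bump.
  case: (ltngtP k j) => [kltj|jltk|kE]; last 1 first.
  - by move: kj; rewrite -val_eqE/= kE eqxx.
  - rewrite leqNgt (_ : (k * q + t < j * q)%N) ?expr0n//.
    by rewrite (leq_trans (n := k.+1 * q)%N) ?leq_mul2r ?kltj ?orbT// mulSn addnC ltn_add2r.
  - rewrite [X in _ && X]ltnNge (_ : (j * q + r <= k * q + t)%N) ?andbF ?expr0n//.
    rewrite (leq_trans (n := j.+1 * q)%N)//.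
      by rewrite mulSn addnC leq_add2r ltnW.
    by rewrite (leq_trans (n := k * q)%N) ?leq_addr// leq_mul2r jltk orbT.
apply: (@le_trans _ _ (\sum_(t < q) 1)); last by rewrite sumr_const card_ord.
by apply: ler_sum => t _; rewrite /bump; case: (_ && _); rewrite ?expr1n ?expr0n.
Qed.

Let mge n c a : measurable [set w | a <= Lam n c w].
Proof.
rewrite (_ : [set w | _] = Lam n c @^-1` `[a, +oo[).
  by rewrite -[X in measurable X]setTI; exact: measurable_linear_statistic.
by apply/seteqP; split => w /=; rewrite in_itv/= andbT.
Qed.

(** If the walk fluctuates by at most eps N in each block, the area is controlled
    by the walk on blocks, and [busy_summation] bounds the latter by the statistic
    of its own busy pattern.  The first term is the union bound over the
    fluctuations, and the sum is the union bound over the busy patterns. *)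
Lemma area_block_bound (n : nat) (z eps : R) :
  (0 < n)%N -> (0 < K)%N -> (n < N)%N -> 0 < eps -> 2 * delta <= eps * K%:R ->
  0 <= (z * n%:R ^+ 2 - 2 * eps * N%:R ^+ 2) ->
  (P [set w | (z <= area P X n w)%R] <=
   (2 * K%:R * q%:R * expR (- (N%:R * (eps ^+ 2 * K%:R / (8 * sigma ^+ 2)))))%:E +
   \sum_(s : K.-tuple bool) (expR (- (((z * n%:R ^+ 2 - 2 * eps * N%:R ^+ 2) / q%:R
      + q%:R * delta * (mm s * (mm s + 1) / 2)) ^+ 2 /
       (2 * sigma ^+ 2 * (q%:R * (mm s + 2^-1) ^+ 3 / 3)))))%:E)%E.
Proof.
move=> n0 K0 nN e0 deK A0.
have q0R : 0 < q%:R :> R by rewrite ltr0n.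
have K0R : 0 < K%:R :> R by rewrite ltr0n.
have NE : N%:R = K%:R * q%:R :> R by rewrite /N natrM.
(* the other half of eps * N absorbs the drift inside a block *)
pose a := eps * N%:R / 2.
have a0 : 0 < a by rewrite divr_gt0// NE !mulr_gt0.
pose Th s := (z * n%:R ^+ 2 - 2 * eps * N%:R ^+ 2) / q%:R
      + q%:R * delta * (mm s * (mm s + 1) / 2).
pose B (i : ('I_K * 'I_q * bool) + K.-tuple bool) : set T :=
  match i with
  | inl (j, r, e) => [set w | a <= Lam N (fun i => (-1) ^+ e * bump j r i) w]
  | inr s => [set w | Th s <= Lam N (weight s) w]
  end.
have mB i : measurable (B i) by case: i => [[[j r] e]|s]; exact: mge.
have mA : measurable [set w | z <= area P X n w].
  rewrite (_ : [set w | _] = area P X n @^-1` `[z, +oo[).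
    by rewrite -[X in measurable X]setTI; exact: measurable_area.
  by apply/seteqP; split => w /=; rewrite in_itv/= andbT.
have cover w : [set w | z <= area P X n w] w -> exists2 i, i \in enum {: ('I_K * 'I_q * bool) + K.-tuple bool} & B i w.
  move=> /= zw; apply: contrapT => noB.
  have nB i : ~ B i w by move=> Bi; apply: noB; exists i; rewrite ?mem_enum.
  have fluct j r : (j < K)%N -> (r < q)%N ->
     `|walk (Xw w) (j * q + r) - walk (Xw w) (j * q)| <= eps * N%:R.
    move=> jK rq.
    have := nB (inl (Ordinal jK, Ordinal rq, false)); rewrite /B/= => /negP.
    rewrite -ltNge (_ : (fun i => _) = bump j r); last by apply/funext => i; rewrite mul1r.
    rewrite Lam_bump// => H1.
    have := nB (inl (Ordinal jK, Ordinal rq, true)); rewrite /B/= => /negP.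
    rewrite -ltNge /Lam linear_statisticZ -/Lam Lam_bump// mulN1r => H2.
    have rd0 : 0 <= r%:R * delta by rewrite mulr_ge0// ltW.
    have rd : r%:R * delta <= eps * N%:R / 2.
      apply: (@le_trans _ _ (q%:R * delta)).
        by rewrite ler_pM2r// ler_nat ltnW.
      have : q%:R * (2 * delta) <= q%:R * (eps * K%:R) by rewrite ler_pM2l.
      rewrite NE (_ : q%:R * (eps * K%:R) = eps * (K%:R * q%:R)); last by ring.
      by lra.
    by rewrite /a in H1 H2; rewrite ler_norml; lra.
  have SW := sum_W_block w _ fluct.
  pose s := [tuple 0 < W (xB w) (val i).+1 | i < K].
  have sE j : (j < K)%N -> Oof s j = (0 < W (xB w) j.+1).
    by move=> jK; rewrite /Oof (nth_mktuple _ _ (Ordinal jK)).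
  have := @busy_summation R (xB w) (fun j => (remaining (Oof s) K j)%:R) K.
  have H1 : forall j, (j < K)%N -> (remaining (Oof s) K j)%:R =
      (remaining (Oof s) K j.+1)%:R + (0 < W (xB w) j.+1)%R%:R :> R.
    by move=> j jK; rewrite remainingS// natrD sE.
  move=> /(_ H1 (fun j => ler0n _ _)).
  rewrite remainingK mul0r add0r.
  rewrite [X in _ <= X](_ : _ = \sum_(j < K) (Oof s j)%:R * (remaining (Oof s) K j)%:R * xB w j); last first.
    by apply: eq_bigr => j _; rewrite sE.
  move=> H2.
  have := nB (inr s); rewrite /B/= => /negP; rewrite -ltNge /Th Lam_weight ltrD2r => H3.
  have sumn : z * n%:R ^+ 2 <= \sum_(i < N) W (Xw w) i.
    have nR0 : 0 < n%:R :> R by rewrite ltr0n.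
    have : z * n%:R ^+ 2 <= \sum_(1 <= i < n.+1) W (Xw w) i.
      move: zw; rewrite /area /Wbar mulrA -invfM -expr2 => zw.
      by rewrite mulrC -ler_pdivlMl ?exprn_gt0.
    move=> /le_trans; apply.
    rewrite -(big_mkord xpredT (fun i => W (Xw w) i)).
    rewrite (@big_cat_nat _ _ _ n.+1 0 N)//= (@big_cat_nat _ _ _ 1 0 n.+1)//=.
    by rewrite -addrA addrCA lerDl addr_ge0// sumr_ge0// => i _; exact: W_ge0.
  have := le_lt_trans H2 H3.
  have : (z * n%:R ^+ 2 - 2 * eps * N%:R ^+ 2) / q%:R <= \sum_(j < K) W (xB w) j.+1.
    rewrite ler_pdivrMr// lerBlDr (le_trans sumn)// (le_trans SW)//.
    by rewrite le_eqVlt; apply/orP; left; apply/eqP; ring.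
  by lra.
apply: (le_trans (measure_finite_union_le _ _ _ _ _ mA mB cover)).
rewrite big_enum/= big_sumType/=; apply: leeD; last first.
  apply: lee_sum => s _.
  have mm0 : 0 <= mm s by rewrite /mm.
  apply: (linear_statistic_tail P X delta sigma sigma_gt0 X_iid); last exact: weight_sq.
    apply: addr_ge0; first by rewrite divr_ge0// ltW.
    apply: mulr_ge0; first by rewrite mulr_ge0// ltW.
    by rewrite divr_ge0// mulr_ge0// addr_ge0.
  rewrite divr_gt0// mulr_gt0// exprn_gt0//; lra.
apply: (@le_trans _ _ (\sum_(i : 'I_K * 'I_q * bool)
    (expR (- (N%:R * (eps ^+ 2 * K%:R / (8 * sigma ^+ 2)))))%:E)%E).
  apply: lee_sum => -[[j r] e] _.
  have := linear_statistic_tail P X delta sigma sigma_gt0 X_iid N (fun i => (-1) ^+ e * bump j r i)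
    a q%:R (ltW a0) q0R (bump_sq j r e (ltn_ord j) (ltn_ord r)).
  move=> /le_trans; apply; rewrite lee_fin ler_expR lerN2 /a NE.
  rewrite le_eqVlt; apply/orP; left; apply/eqP; field.
  by rewrite !gt_eqF.
rewrite sumEFin sumr_const !card_prod !card_ord card_bool lee_fin -mulr_natl.
by rewrite !natrM le_eqVlt; apply/orP; left; apply/eqP; ring.
Qed.

End Blocks.
End WaitingTimesUpper.

Section BusyCostRelaxed.
Context {R : realType}.
Variables (delta sigma : R).
Hypotheses (delta_gt0 : 0 < delta) (sigma_gt0 : 0 < sigma).

(** The discrete busy lengths are (m + 1/2) / K with m <= K, so they may slightly
    exceed 1; they cost at least almost the rate. *)
Lemma rate_le_busy_cost_relaxed (x z l : R) : 0 <= z -> 0 <= x -> 0 < l <= 1 + x ->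
  (1 - 3 * x) * Wbar_rate delta sigma z <= busy_cost delta sigma z l.
Proof.
move=> z0 x0 /andP[l0 lx].
have x1 : 0 < 1 + x by rewrite ltr_pwDl.
have r0 : 0 <= Wbar_rate delta sigma z by exact: rate_ge0.
pose l' := l / (1 + x).
have l'0 : 0 < l' by rewrite divr_gt0.
have l'1 : l' <= 1 by rewrite ler_pdivrMr// mul1r.
have lE : l = (1 + x) * l' by rewrite /l' mulrC divfK// gt_eqF.
clearbody l'.
have H : busy_cost delta sigma z l' <= (1 + x) ^+ 3 * busy_cost delta sigma z l.
  rewrite /busy_cost lE.
  rewrite (_ : (1 + x) ^+ 3 * _ = 3 * (z + delta / 2 * ((1 + x) * l') ^+ 2) ^+ 2 /
    (2 * sigma ^+ 2 * l' ^+ 3)); last by field; rewrite !gt_eqF.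
  rewrite ler_pM2r; last by rewrite invr_gt0 !mulr_gt0 ?exprn_gt0.
  rewrite ler_pM2l//.
  have q0 : 0 <= delta / 2 * l' ^+ 2.
    by apply: mulr_ge0; [rewrite divr_ge0// ltW|rewrite sqr_ge0].
  have q1 : delta / 2 * l' ^+ 2 <= delta / 2 * ((1 + x) * l') ^+ 2.
    rewrite ler_pM2l ?divr_gt0// exprMn ler_peMl ?sqr_ge0//.
    by rewrite exprn_ege1// lerDl.
  by rewrite ler_sqr ?nnegrE; lra.
have H2 : Wbar_rate delta sigma z <= (1 + x) ^+ 3 * busy_cost delta sigma z l.
  by apply: le_trans H; apply: rate_le_busy_cost => //; rewrite l'0.
have b0 : 0 <= busy_cost delta sigma z l.
  by rewrite -(pmulr_rge0 _ (exprn_gt0 3 x1)) (le_trans r0).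
have [x3|x3] := leP (1 - 3 * x) 0.
  by apply: le_trans b0; rewrite mulr_le0_ge0.
apply: (le_trans (ler_wpM2l (ltW x3) H2)).
rewrite mulrA ler_piMl//.
rewrite -subr_ge0 (_ : _ - _ = x ^+ 2 * (6 + 8 * x + 3 * x ^+ 2)); last by ring.
by rewrite mulr_ge0 ?sqr_ge0// !addr_ge0// mulr_ge0// sqr_ge0.
Qed.

End BusyCostRelaxed.

Section UpperBound.
Context {d : measure_display} {T : measurableType d} {R : realType}.
Variables (P : probability T R) (X : nat -> {RV P >-> R}).
Variables (delta sigma : R).
Hypotheses (delta_gt0 : 0 < delta) (sigma_gt0 : 0 < sigma)
  (X_iid : iid_gaussian (- delta) sigma X).

Lemma area_upper_bound (z kappa : R) : 0 < z -> 0 < kappa ->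
  exists N, forall n, (N <= n)%N ->
    (P [set w | (z <= area P X n w)%R] <=
     (expR (- (n%:R * (Wbar_rate delta sigma z - kappa))))%:E)%E.
Proof.
move=> z0 k0.
set r := Wbar_rate delta sigma z.
have r0 : 0 <= r by apply: rate_ge0 => //; exact: ltW.
have r1 : 0 < r + 1 by rewrite ltr_wpDl.
(* th is the relative precision: the errors below reduce the rate by a factor
   at least 1 - 3 * th, that is by at most kappa / 2 *)
pose th : R := Num.min 2^-1 (kappa / (6 * (r + 1))).
have th0 : 0 < th by rewrite lt_min invr_gt0 ltr0n divr_gt0// mulr_gt0.
have th1 : th <= 2^-1 by rewrite ge_min lexx.
have thr : 3 * th * r <= kappa / 2.
  have t2 : th <= kappa / (6 * (r + 1)) by rewrite ge_min lexx orbT.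
  have : th * (6 * (r + 1)) <= kappa by rewrite -ler_pdivlMr// mulr_gt0.
  have : 0 <= th * r by rewrite mulr_ge0// ltW.
  by move: th0; lra.
pose eps : R := z * th / 8.
have e0 : 0 < eps by rewrite divr_gt0// mulr_gt0.
have s20 : 0 < sigma ^+ 2 by rewrite exprn_gt0.
(* K is chosen above four bounds: b1 makes busy lengths up to 1 + 1 / (2 K)
   harmless, b2 makes the drift inside a block small, b3 makes the fluctuations
   inside a block as unlikely as the event, and b4 makes the discretization
   error on the area small *)
pose b1 : R := 3 / (2 * th).
pose b2 : R := 2 * delta / eps.
pose b3 : R := 8 * sigma ^+ 2 * r / eps ^+ 2.
pose b4 : R := delta / (2 * z * th).
have b10 : 0 <= b1 by rewrite divr_ge0// mulr_ge0// ltW.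
have b20 : 0 <= b2 by rewrite divr_ge0 ?(ltW e0)// mulr_ge0// ltW.
have b30 : 0 <= b3.
  by apply: divr_ge0; [rewrite mulr_ge0// mulr_ge0// ltW|rewrite sqr_ge0].
have b40 : 0 <= b4 by rewrite divr_ge0 ?(ltW delta_gt0)// mulr_ge0 ?mulr_ge0 ?(ltW z0) ?(ltW th0).
pose K := (Num.truncn (b1 + b2 + b3 + b4)).+1.
have KB : b1 + b2 + b3 + b4 <= K%:R by apply/ltW; exact: truncnS_gt.
have K0 : (0 < K)%N by [].
have K0R : 1 <= K%:R :> R by rewrite ler1n.
have Kp : 0 < K%:R :> R by rewrite ltr0n.
have Kb1 : 3 / (2 * K%:R) <= th.
  have : b1 <= K%:R by lra.
  rewrite /b1 ler_pdivrMr ?mulr_gt0// => H.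
  by rewrite ler_pdivrMr ?mulr_gt0//; lra.
have Kb2 : 2 * delta <= eps * K%:R.
  have : b2 <= K%:R by lra.
  by rewrite /b2 ler_pdivrMr// => H; lra.
have Kb3 : r <= eps ^+ 2 * K%:R / (8 * sigma ^+ 2).
  have : b3 <= K%:R by lra.
  by rewrite /b3 ler_pdivrMr ?exprn_gt0// => H; rewrite ler_pdivlMr ?mulr_gt0//; lra.
have Kb4 : delta / (8 * K%:R ^+ 2) <= z * th / 4.
  have : b4 <= K%:R by lra.
  rewrite /b4 ler_pdivrMr ?mulr_gt0// => H.
  rewrite ler_pdivrMr ?mulr_gt0 ?exprn_gt0//.
  have zt : 0 <= 2 * z * th by rewrite mulr_ge0 ?mulr_ge0 ?(ltW z0) ?(ltW th0).
  apply: (le_trans H); rewrite (_ : z * th / 4 * _ = K%:R * (K%:R * (2 * z * th))); last by field.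
  by rewrite ler_peMl// mulr_ge0.
have [N1 HN1] := exp_beats_linear (2 * K%:R + (2 ^ K)%N%:R) (kappa / 2)
  (addr_ge0 (mulr_ge0 (ler0n _ _) (ler0n _ _)) (ler0n _ _)) (divr_gt0 k0 (ltr0Sn _ _)).
pose N2 := (Num.truncn (4 * K%:R / th)).+1.
exists (maxn N1 N2) => n; rewrite geq_max => /andP[nN1 nN2].
have n0 : (0 < n)%N by apply: leq_trans nN2.
have n0R : 0 < n%:R :> R by rewrite ltr0n.
pose q := (n %/ K).+1.
have q0 : (0 < q)%N by [].
have q0R : 0 < q%:R :> R by rewrite ltr0n.
have nN : (n < K * q)%N by rewrite mulnC ltn_ceil.
have NnK : (K * q <= n + K)%N by rewrite mulnS addnC leq_add2r mulnC leq_trunc_div.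
have qn : (q <= n.+1)%N by rewrite ltnS leq_div.
pose N : R := (K * q)%:R.
have NE : N = K%:R * q%:R by rewrite /N natrM.
have N0 : 0 < N by rewrite NE mulr_gt0.
have nNR : n%:R <= N by rewrite ler_nat ltnW.
have NnR : N <= n%:R * (1 + th / 4).
  apply: (@le_trans _ _ (n%:R + K%:R)); first by rewrite -natrD ler_nat.
  have : 4 * K%:R / th <= n%:R.
    by apply/ltW; apply: (lt_le_trans (truncnS_gt _)); rewrite ler_nat.
  by rewrite ler_pdivrMr//; lra.
have n2N2 : (1 - th / 2) * N ^+ 2 <= n%:R ^+ 2.
  have c1 : 0 <= 1 - th / 2 by lra.
  have N2n : N ^+ 2 <= (n%:R * (1 + th / 4)) ^+ 2.
    by rewrite ler_sqr ?nnegrE ?(ltW N0)// (le_trans (ltW N0)).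
  apply: (le_trans (ler_wpM2l c1 N2n)).
  rewrite -subr_ge0 (_ : _ - _ = n%:R ^+ 2 * (th ^+ 2 * (3 / 16 + th / 32))); last by field.
  by apply: mulr_ge0; rewrite ?sqr_ge0// mulr_ge0 ?sqr_ge0//; lra.
pose z' := (z * n%:R ^+ 2 - 2 * eps * N ^+ 2) / N ^+ 2.
have z'E : z * n%:R ^+ 2 - 2 * eps * N ^+ 2 = z' * N ^+ 2.
  by rewrite /z' divfK// gt_eqF// exprn_gt0.
have z'ge : z * (1 - th) + delta / (8 * K%:R ^+ 2) <= z'.
  rewrite /z' ler_pdivlMr ?exprn_gt0//.
  have : (z * (1 - th) + delta / (8 * K%:R ^+ 2)) * N ^+ 2 <=
     (z * (1 - th) + z * th / 4) * N ^+ 2 by rewrite ler_pM2r ?exprn_gt0// lerD2l.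
  have : z * ((1 - th / 2) * N ^+ 2) <= z * n%:R ^+ 2 by rewrite ler_pM2l.
  by rewrite /eps; lra.
(* m (m + 1) = (m + 1/2)^2 - 1/4 for the number m of busy blocks, whence this
   correction when m is replaced by m + 1/2 *)
pose z'' := z' - delta / (8 * K%:R ^+ 2).
have z''ge : (1 - th) * z <= z'' by rewrite /z''; lra.
have z0th : 0 <= (1 - th) * z by rewrite mulr_ge0 ?(ltW z0)//; lra.
have z''0 : 0 <= z'' by exact: le_trans z''ge.
have z'0 : 0 <= z'.
  apply: le_trans z'ge; apply: addr_ge0; first by rewrite mulrC.
  by rewrite divr_ge0 ?(ltW delta_gt0)// mulr_ge0// exprn_ge0.
have A0 : 0 <= z * n%:R ^+ 2 - 2 * eps * N ^+ 2 by rewrite z'E mulr_ge0// sqr_ge0.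
have := area_block_bound P X delta sigma delta_gt0 sigma_gt0 X_iid K q q0 n z eps
  n0 K0 nN e0 Kb2 A0.
move=> /le_trans; apply.
pose E := expR (- (n%:R * ((1 - 3 * th) * r))).
have E0 : 0 <= E by exact: expR_ge0.
have th3 : (1 - 3 * th) * r <= r by rewrite ler_piMl//; lra.
have first : expR (- (N * (eps ^+ 2 * K%:R / (8 * sigma ^+ 2)))) <= E.
  rewrite ler_expR lerN2; apply: (@le_trans _ _ (n%:R * r)).
    by rewrite ler_pM2l.
  by apply: ler_pM => //; exact: ltW.
have second (s : K.-tuple bool) :
  expR (- (((z * n%:R ^+ 2 - 2 * eps * N ^+ 2) / q%:R + q%:R * delta *
    ((remaining (fun j => nth false s j) K 0)%:R *
     ((remaining (fun j => nth false s j) K 0)%:R + 1) / 2)) ^+ 2 /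
   (2 * sigma ^+ 2 * (q%:R * ((remaining (fun j => nth false s j) K 0)%:R + 2^-1) ^+ 3 / 3)))) <= E.
  set m : R := (remaining _ K 0)%:R.
  have m0 : 0 <= m by rewrite ler0n.
  have mK : m <= K%:R by rewrite ler_nat remaining0_le.
  pose l := (m + 2^-1) / K%:R.
  have l0 : 0 < l by rewrite divr_gt0// ltr_wpDl.
  have l1 : l <= 1 + (2 * K%:R)^-1.
    rewrite ler_pdivrMr// mulrDl mul1r invfM -mulrA mulVf ?gt_eqF// mulr1.
    by rewrite lerD2r.
  rewrite ler_expR lerN2.
  rewrite (_ : _ ^+ 2 / (2 * sigma ^+ 2 * _) = N * busy_cost delta sigma z'' l); last first.
    have [M M0 mE] : exists2 M, 0 < M & m = M - 2^-1.
      by exists (m + 2^-1); rewrite ?addrK// ltr_wpDl.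
    by rewrite z'E /busy_cost /z'' /l NE mE subrK; field; rewrite !gt_eqF.
  have c0 : 0 <= (2 * K%:R)^-1 :> R by rewrite invr_ge0 mulr_ge0.
  have H := rate_le_busy_cost_relaxed delta sigma delta_gt0 sigma_gt0 _ z'' l z''0 c0.
  rewrite l0 l1 in H; have {}H := H isT.
  have u01 : 0 <= 1 - th <= 1 by lra.
  have H2 := rate_scale delta sigma delta_gt0 sigma_gt0 (1 - th) z'' z u01 (ltW z0) z''ge.
  rewrite -/r in H2.
  have H3 : 1 - th <= 1 - 3 * (2 * K%:R)^-1 by lra.
  have u0 : 0 <= 1 - th by lra.
  have H4 : (1 - 3 * th) * r <= busy_cost delta sigma z'' l.
    apply: le_trans H; apply: (@le_trans _ _ ((1 - th) * ((1 - th) ^+ 2 * r))).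
      rewrite mulrA ler_wpM2r// -subr_ge0.
      rewrite (_ : _ - _ = th ^+ 2 * (3 - th)); last by ring.
      by rewrite mulr_ge0 ?sqr_ge0//; lra.
    apply: ler_pM => //.
    by rewrite mulr_ge0 ?sqr_ge0.
  apply: (@le_trans _ _ (n%:R * busy_cost delta sigma z'' l)).
    by rewrite ler_pM2l.
  rewrite ler_wpM2r//.
  apply: le_trans H; rewrite mulr_ge0//; first lra.
  exact: rate_ge0.
apply: (@le_trans _ _ ((2 * K%:R * q%:R * E)%:E + \sum_(s : K.-tuple bool) E%:E)%E).
  apply: leeD; first by rewrite lee_fin ler_wpM2l// !mulr_ge0.
  by apply: lee_sum => s _; rewrite lee_fin; exact: second.
rewrite sumEFin sumr_const card_tuple card_bool -EFinD lee_fin -[E *+ _]mulr_natl -mulrDl.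
have H1 := HN1 n nN1.
have H5 : 2 * K%:R * q%:R + (2 ^ K)%:R <= (2 * K%:R + (2 ^ K)%N%:R) * (n%:R + 1) :> R.
  rewrite [leRHS]mulrDl; apply: lerD.
    by rewrite ler_wpM2l ?mulr_ge0// natr1 ler_nat.
  by rewrite ler_peMr// lerDr.
apply: (@le_trans _ _ (expR (kappa / 2 * n%:R) * E)).
  by rewrite ler_wpM2r// (le_trans H5).
rewrite /E -expRD ler_expR.
have : n%:R * (3 * th * r) <= n%:R * (kappa / 2) by rewrite ler_pM2l.
by lra.
Qed.

End UpperBound.

(** * The large deviation principle *)

Lemma limn_esup_le_near {R : realType} (u : nat -> \bar R) (M : \bar R) N :
  (forall n, (N <= n)%N -> (u n <= M)%E) -> (limn_esup u <= M)%E.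
Proof.
move=> H; apply: (@le_trans _ _ (ereal_sup (u @` [set n | (N <= n)%N]))).
  by apply: ereal_inf_lbound; exists [set n | (N <= n)%N] => //; exists N.
by apply: ge_ereal_sup => _ [n /= Nn <-]; exact: H.
Qed.

Lemma limn_einf_ge_near {R : realType} (u : nat -> \bar R) (M : \bar R) N :
  (forall n, (N <= n)%N -> (M <= u n)%E) -> (M <= limn_einf u)%E.
Proof.
move=> H; rewrite leeNr; apply: (limn_esup_le_near _ _ N) => n Nn.
by rewrite leeN2; exact: H.
Qed.

Section LargeDeviations.
Context {d : measure_display} {T : measurableType d} {R : realType}.
Variables (P : probability T R) (X : nat -> {RV P >-> R}).
Variables (delta sigma : R).
Hypotheses (delta_gt0 : 0 < delta) (sigma_gt0 : 0 < sigma)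
  (X_iid : iid_gaussian (- delta) sigma X).

Let rate z := Wbar_rate delta sigma z.

Let maY n A : measurable A -> measurable (area P X n @^-1` A).
Proof. by move=> mA; rewrite -[X in measurable X]setTI; exact: measurable_area. Qed.

Let scaled_lne_le (p : \bar R) (n : nat) (s : R) : (0 < n)%N ->
  (0 <= p)%E -> (p <= (expR (n%:R * s))%:E)%E -> ((n%:R^-1)%:E * lne p <= s%:E)%E.
Proof.
move=> n0 p0 ple.
have nR0 : 0 < n%:R :> R by rewrite ltr0n.
have : (lne p <= (n%:R * s)%:E)%E.
  rewrite -[X in (_ <= X%:E)%E]expRK -lne_EFin ?expR_gt0// lee_lne//.
    by rewrite in_itv/= p0 leey.
  by rewrite in_itv/= lee_fin expR_ge0 leey.
move=> /(@lee_wpmul2l _ (n%:R^-1)%:E) H.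
apply: (le_trans (H _)); first by rewrite lee_fin invr_ge0.
by rewrite -EFinM lee_fin mulKf// gt_eqF.
Qed.

Let scaled_lne_ge (p : \bar R) (n : nat) (s : R) : (0 < n)%N ->
  ((expR (n%:R * s))%:E <= p)%E -> (s%:E <= (n%:R^-1)%:E * lne p)%E.
Proof.
move=> n0 ple.
have nR0 : 0 < n%:R :> R by rewrite ltr0n.
have p0 : (0 <= p)%E by apply: le_trans ple; rewrite lee_fin expR_ge0.
have : ((n%:R * s)%:E <= lne p)%E.
  rewrite -[X in (X%:E <= _)%E]expRK -lne_EFin ?expR_gt0// lee_lne//.
    by rewrite in_itv/= lee_fin expR_ge0 leey.
  by rewrite in_itv/= p0 leey.
move=> /(@lee_wpmul2l _ (n%:R^-1)%:E) H.
apply: (le_trans _ (H _)); last by rewrite lee_fin invr_ge0.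
by rewrite -EFinM lee_fin mulKf// gt_eqF.
Qed.

(** The closed set is the closure of the sublevel set.  By [rate_scale], a limit x
    of points of the sublevel set satisfies u^2 rate x <= a for all u < 1, whence
    rate x <= a. *)
Lemma rate_function_Wbar :
  rate_function [set x | 0 <= x] (fun z => (rate z)%:E).
Proof.
split=> [x /= x0|a]; first by rewrite lee_fin; exact: rate_ge0.
pose S := [set x | 0 <= x /\ ((rate x)%:E <= a%:E)%E].
exists (closure S); first exact: closed_closure.
apply/seteqP; split=> x /= [x0].
  by move=> xa; split => //; apply: subset_closure; split.
move=> xS; split => //; rewrite lee_fin.
have scale u : 0 <= u < 1 -> u ^+ 2 * rate x <= a.
  move=> /andP[u0 u1].
  have [y [y0 ya] uxy] : exists2 y, S y & u * x <= y.
    move: x0; rewrite le_eqVlt => /predU1P[x0|x0].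
      have [y [[y0 ya] _]] := xS setT filterT.
      by exists y => //; rewrite -x0 mulr0.
    have e0 : 0 < (1 - u) * x by rewrite mulr_gt0// subr_gt0.
    have [y [yS]] := xS _ (nbhsx_ballx x _ e0).
    rewrite -ball_normE /= => xy; exists y => //.
    by move: xy; rewrite ltr_norml; lra.
  rewrite lee_fin in ya; apply: le_trans ya.
  by apply: rate_scale => //; rewrite u0 ltW.
have r0 : 0 <= rate x by exact: rate_ge0.
rewrite leNgt; apply/negP => ar.
have rp : 0 < rate x.
  rewrite lt_neqAle r0 andbT eq_sym; apply: contraTneq ar => rx0.
  by rewrite -leNgt rx0; have := scale 0; rewrite expr0n mul0r; apply; rewrite lexx ltr01.
pose t := (rate x - a) / (2 * rate x).
pose u := Num.max 0 (1 - t / 2).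
have t0 : 0 < t by rewrite divr_gt0 ?subr_gt0// mulr_gt0.
have u01 : 0 <= u < 1 by rewrite le_max lexx/= gt_max ltr01/=; lra.
have := scale u u01; apply/negP; rewrite -ltNge.
have tE : t * (2 * rate x) = rate x - a by rewrite /t divfK// gt_eqF// mulr_gt0.
have ut : 1 - t / 2 <= u by rewrite le_max lexx orbT.
have u2 : 1 - t <= u ^+ 2.
  have [t2|t2] := leP t 2.
    have : (1 - t / 2) ^+ 2 <= u ^+ 2 by rewrite ler_sqr ?nnegrE; lra.
    have : (1 - t / 2) ^+ 2 = 1 - t + t ^+ 2 / 4 by field.
    have := sqr_ge0 t; lra.
  by apply: (@le_trans _ _ 0); [lra|exact: sqr_ge0].
have : (1 - t) * rate x <= u ^+ 2 * rate x by rewrite ler_pM2r.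
by lra.
Qed.

(** Only the least point m of the closed set matters: the event lies in that of an
    area at least m. *)
Lemma ldp_upper (C : set R) : closed C ->
  (limn_esup (fun n => (n%:R^-1)%:E * lne (P (area P X n @^-1` ([set x | 0 <= x]%R `&` C))))
    <= - ereal_inf ((fun z => (rate z)%:E) @` ([set x | 0 <= x]%R `&` C)))%E.
Proof.
move=> cC; set E := _ `&` C.
have cE : closed E by apply: closedI => //; exact: closed_ge.
have [[x0 Ex0]|/set0P/negP/negPn/eqP E0] := pselect (E !=set0); last first.
  rewrite E0 image_set0 ereal_inf0 /=.
  apply: (limn_esup_le_near _ _ 1%N) => n n0.
  rewrite preimage_set0 measure0 le0_lneNy// gt0_muleNy// lte_fin invr_gt0 ltr0n.
  exact: n0.
have hE : has_inf E by split; [exists x0|exists 0 => y []].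
have mE : E (inf E).
  rewrite {1}((closure_id E).1 cE) => V /nbhs_ballP[e /= e0 eV].
  have [y Ey ye] := inf_adherent e0 hE; exists y; split => //.
  have yl : inf E <= y by apply: ge_inf => //; case: hE.
  by apply: eV; rewrite -ball_normE /= ltr_norml; lra.
set m := inf E in mE.
have m0 : 0 <= m by case: mE.
have Em y : E y -> m <= y by move=> Ey; apply: ge_inf => //; case: hE.
apply: (@le_trans _ _ (- rate m)%:E); last first.
  by rewrite EFinN leeN2; apply: ereal_inf_lbound; exists m.
apply/lee_addgt0Pr => kappa k0; rewrite -EFinD.
have Pm n : (P (area P X n @^-1` E) <= P [set w | (m <= area P X n w)%R])%E.
  apply: le_measure; rewrite ?inE.
  - by apply: maY; exact: closed_measurable.
  - rewrite (_ : [set w | _] = area P X n @^-1` `[m, +oo[); first exact: maY.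
    by apply/seteqP; split => w /=; rewrite in_itv/= andbT.
  - by move=> w /= /Em.
move: m0; rewrite le_eqVlt => /predU1P[m0|m0].
  apply: (limn_esup_le_near _ _ 1%N) => n n0; apply: scaled_lne_le => //.
  apply: (@le_trans _ _ 1%E).
    by apply: probability_le1; apply: maY; exact: closed_measurable.
  rewrite lee_fin -m0 /rate rate0 // oppr0 add0r -expR0 ler_expR.
  by rewrite mulr_ge0// ltW.
have [N HN] := area_upper_bound P X delta sigma delta_gt0 sigma_gt0 X_iid m kappa m0 k0.
apply: (limn_esup_le_near _ _ N.+1) => n nN; apply: scaled_lne_le => //.
  by apply: leq_trans nN.
apply: (le_trans (Pm n)); apply: (le_trans (HN n (ltnW nN))).
by rewrite lee_fin ler_expR -mulrN opprB addrC.
Qed.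

(** Each positive point of the open set is handled by [area_lower_bound]; the
    point 0, where the rate vanishes, is approached by small positive points of
    small rate. *)
Lemma ldp_lower (U : set R) : open U ->
  (- ereal_inf ((fun z => (rate z)%:E) @` ([set x | 0 <= x]%R `&` U)) <=
   limn_einf (fun n => (n%:R^-1)%:E * lne (P (area P X n @^-1` ([set x | 0 <= x]%R `&` U)))))%E.
Proof.
move=> oU; rewrite leeNl; apply: le_ereal_inf_tmp => _ [x [/= x0 Ux] <-].
rewrite leeNl.
have mEU : measurable ([set x | 0 <= x] `&` U).
  by apply: measurableI; [apply: closed_measurable; exact: closed_ge|exact: open_measurable].
have pos z : 0 < z -> U z ->
  ((- rate z)%:E <= limn_einf (fun n => (n%:R^-1)%:E *
     lne (P (area P X n @^-1` ([set x | 0 <= x]%R `&` U)))))%E.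
  move=> z0 Uz; apply/lee_addgt0Pr => kappa k0.
  rewrite -leeBlDr// -EFinN -EFinD.
  have /nbhs_ballP[e /= e0 eU] : nbhs z U by exact: open_nbhs_nbhs.
  have [N HN] := area_lower_bound P X delta sigma delta_gt0 sigma_gt0 X_iid z e kappa z0 e0 k0.
  apply: (limn_einf_ge_near _ _ N.+1) => n nN; apply: scaled_lne_ge.
    by apply: leq_trans nN.
  rewrite -opprD mulrN; apply: (le_trans (HN n (ltnW nN))).
  apply: le_measure; rewrite ?inE.
  - rewrite (_ : [set w | _] = area P X n @^-1` ball z e).
      by apply: maY; exact: measurable_ball.
    by apply/seteqP; split => w; rewrite /= -ball_normE /= distrC.
  - exact: maY.
  - move=> w /= aw; split; first exact: area_ge0.
    by apply: eU; rewrite -ball_normE /= distrC.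
move: x0; rewrite le_eqVlt => /predU1P[x0|x0]; last first.
  exact: pos.
rewrite -x0 /rate rate0//; rewrite -x0 in Ux.
apply/lee_addgt0Pr => kappa k0.
have /nbhs_ballP[e /= e0 eU] : nbhs 0 U by exact: open_nbhs_nbhs.
pose r := Num.min 1 (Num.min (3 * e / delta) (kappa * (3 * sigma ^+ 2) / (2 * delta ^+ 2))).
have r0 : 0 < r by rewrite !lt_min ltr01 !divr_gt0// !mulr_gt0// exprn_gt0.
have r1 : r <= 1 by rewrite ge_min lexx.
have re : r <= 3 * e / delta by rewrite !ge_min lexx orbT.
have rk : r <= kappa * (3 * sigma ^+ 2) / (2 * delta ^+ 2) by rewrite !ge_min lexx !orbT.
pose z := delta * r ^+ 2 / 6.
have z0 : 0 < z by rewrite divr_gt0// mulr_gt0// exprn_gt0.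
have rz : rate z <= kappa.
  rewrite /rate rate_sqr ?(ltW r0)// ler_pdivrMr ?mulr_gt0 ?exprn_gt0//.
  by rewrite mulrC -ler_pdivlMr ?mulr_gt0 ?exprn_gt0.
have Uz : U z.
  apply: eU; rewrite -ball_normE /= sub0r normrN gtr0_norm//.
  have : r ^+ 2 <= r by rewrite expr2 ler_piMl// ltW.
  rewrite -(ler_pM2l delta_gt0) => H.
  have : r * delta <= 3 * e by rewrite -ler_pdivlMr.
  by rewrite /z; lra.
apply: (@le_trans _ _ ((- rate z)%:E + kappa%:E)%E); last by apply: leeD => //; exact: pos.
by rewrite -EFinD lee_fin; lra.
Qed.

Lemma ldp_waiting_times :
  ldp P [set x | 0 <= x] (area P X) (fun z => (rate z)%:E).
Proof.
split; [exact: area_ge0|exact: rate_function_Wbar|exact: ldp_upper|exact: ldp_lower].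
Qed.

End LargeDeviations.

(** * Absolutely continuous functions *)

Section AbsolutelyContinuous.
Context {R : realType}.
Variables (a b : R).
Implicit Types (f g : R -> R).
Local Notation AC := (absolutely_continuous a b).

Lemma AC_eq f g : (forall t, a <= t <= b -> f t = g t) -> AC f -> AC g.
Proof.
move=> fg ACf e e0; have [eta eta0 H] := ACf e e0; exists eta => // n u v uv tI luv.
rewrite (eq_bigr (fun i => `|f (v i) - f (u i)|)); first exact: H.
move=> i _; have [au uvi vb] := uv i.
by rewrite !fg// ?au ?vb ?andbT ?(le_trans au)// (le_trans uvi).
Qed.

Lemma AC_lipschitz f (K : R) :
  (forall x y, a <= x -> x <= y -> y <= b -> `|f y - f x| <= K * (y - x)) -> AC f.
Proof.
move=> fK e e0; pose K' := Num.max K 1.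
have K'0 : 0 < K' by rewrite lt_max ltr01 orbT.
exists (e / K'); first by rewrite divr_gt0.
move=> n u v uv tI luv.
apply: (@le_lt_trans _ _ (K' * \sum_(i < n) (v i - u i))).
  rewrite mulr_sumr; apply: ler_sum => i _; have [au uvi vb] := uv i.
  apply: (le_trans (fK _ _ au uvi vb)); rewrite ler_wpM2r ?subr_ge0//.
  by rewrite le_max lexx.
by rewrite mulrC -ltr_pdivlMr.
Qed.

Lemma AC_cst c : AC (fun=> c).
Proof. by apply: (@AC_lipschitz _ 0) => x y _ xy _; rewrite subrr normr0 mul0r. Qed.

Lemma AC_add f g : AC f -> AC g -> AC (fun t => f t + g t).
Proof.
move=> ACf ACg e e0; have e20 : 0 < e / 2 by rewrite divr_gt0.
have [e1 e10 H1] := ACf _ e20; have [e2 e20' H2] := ACg _ e20.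
exists (Num.min e1 e2); first by rewrite lt_min e10.
move=> n u v uv tI; rewrite lt_min => /andP[l1 l2].
have := ltrD (H1 n u v uv tI l1) (H2 n u v uv tI l2).
rewrite -splitr; apply: le_lt_trans; rewrite -big_split/=; apply: ler_sum => i _.
by apply: le_trans (ler_normD _ _); rewrite opprD addrACA.
Qed.

Lemma AC_unif f : AC f -> forall e, 0 < e -> exists2 eta, 0 < eta &
  forall x y, a <= x -> x <= y -> y <= b -> y - x < eta -> `|f y - f x| < e.
Proof.
move=> ACf e e0; have [eta eta0 H] := ACf e e0; exists eta => // x y ax xy yb lxy.
have := H 1%N (fun=> x) (fun=> y); rewrite !big_ord1; apply => //.
by move=> i j _ _ _; rewrite !ord1.
Qed.

Lemma AC_within_continuous f : a < b -> AC f -> {within `[a, b], continuous f}.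
Proof.
move=> ab ACf; apply/continuous_within_itvP => //.
have H e : 0 < e -> exists2 eta, 0 < eta & forall x y, a <= x <= b -> a <= y <= b ->
    `|x - y| < eta -> `|f x - f y| < e.
  move=> e0; have [eta eta0 H] := AC_unif f ACf e e0; exists eta => // x y.
  move=> /andP[ax xb] /andP[ay yb]; have [xy|/ltW yx] := leP x y.
    by rewrite ler0_norm ?subr_le0// opprB distrC; exact: H.
  by rewrite ger0_norm ?subr_ge0//; exact: H.
split.
- move=> x; rewrite in_itv/= => /andP[ax xb].
  apply/cvgrPdist_lt => e e0; have [eta eta0 He] := H e e0.
  near=> t; apply: He; [by rewrite !ltW| |].
    apply/andP; split; apply/ltW; near: t; first exact: lt_nbhsr.
    exact: lt_nbhsl.
  by near: t; exact: (nbhsx_ballx x eta).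
- apply/cvgrPdist_lt => e e0; have [eta eta0 He] := H e e0.
  near=> t; apply: He; first by rewrite lexx ltW.
    by apply/andP; split; near: t; [exact: nbhs_right_ge|exact: nbhs_right_ltW].
  rewrite distrC ger0_norm; first by near: t; exact: nbhs_right_ltDr.
  by rewrite subr_ge0; near: t; exact: nbhs_right_ge.
- apply/cvgrPdist_lt => e e0; have [eta eta0 He] := H e e0.
  near=> t; apply: He; first by rewrite lexx ltW.
    by apply/andP; split; near: t; [exact: nbhs_left_ge|exact: nbhs_left_le].
  rewrite ger0_norm; first by near: t; exact: nbhs_left_ltBl.
  by rewrite subr_ge0; near: t; exact: nbhs_left_le.
Unshelve. all: by end_near. Qed.

(** The cells of a subdivision are disjoint intervals. *)
Lemma AC_small_variation f e : AC f -> 0 < e -> exists2 eta, 0 < eta &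
  forall c d, a <= c -> c <= d -> d <= b -> d - c < eta ->
    ubound (variations c d f) e.
Proof.
move=> ACf e0; have [eta eta0 H] := ACf e e0; exists eta => // c d ac cd db lcd.
move=> _ [s cds <-]; rewrite /variation.
pose p := nth d (c :: s).
have ps : path <%R c s by case: cds.
have pmono i j : (i <= j)%N -> (j <= size s)%N -> p i <= p j.
  move=> ij js; have srt : sorted <=%R (c :: s).
    by rewrite /=; apply: sub_path ps => x y /ltW.
  by apply: (sorted_leq_nth le_trans le_refl) => //; rewrite inE/= ltnS// (leq_trans ij).
have p0 : p 0%N = c by [].
have pl : p (size s) = d by rewrite /p nth_last; case: cds => _ /eqP.
rewrite big_mkord.
apply/ltW/(H (size s) (fun i => p i) (fun i => p i.+1)).
- move=> i; split.
  + by rewrite (le_trans ac)// -p0 pmono// ltnW.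
  + by rewrite pmono.
  + by rewrite (le_trans _ db)// -pl pmono.
- move=> i j _ _ [x [/=]]; rewrite !in_itv/= => /andP[x1 x2] /andP[x3 x4].
  apply/val_inj; case: (ltngtP i j) => // ij.
    have := pmono i.+1 j ij (ltnW (ltn_ord j)).
    by rewrite leNgt (lt_trans x3 x2).
  have := pmono j.+1 i ij (ltnW (ltn_ord i)).
  by rewrite leNgt (lt_trans x1 x4).
- rewrite -(big_mkord xpredT (fun i => p i.+1 - p i)) telescope_sumr//.
  by rewrite pl p0.
Qed.

(** [a, b] is cut into M intervals shorter than the modulus of absolute
    continuity for e = 1; each has variation at most 1. *)
Lemma AC_bounded_variation f : a <= b -> AC f -> bounded_variation a b f.
Proof.
move=> ab ACf; have [eta eta0 H] := AC_small_variation _ _ ACf ltr01.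
pose M := (Num.truncn ((b - a) / eta)).+1.
have M0 : 0 < M%:R :> R by rewrite ltr0n.
pose h := (b - a) / M%:R.
have h0 : 0 <= h by rewrite divr_ge0 ?subr_ge0.
have hM : a + M%:R * h = b by rewrite /h mulrC divfK ?gt_eqF// addrC subrK.
have heta : h < eta.
  by rewrite /h ltr_pdivrMr// mulrC -ltr_pdivrMr// truncnS_gt.
have BV k : (k <= M)%N -> total_variation a (a + k%:R * h) f \is a fin_num.
  elim: k => [_|k IH kM]; first by rewrite mul0r addr0 total_variationxx.
  have kb : a + k.+1%:R * h <= b by rewrite -hM lerD2l ler_wpM2r// ler_nat.
  have ak : a <= a + k%:R * h by rewrite lerDl mulr_ge0.
  have kk : a + k%:R * h <= a + k.+1%:R * h by rewrite lerD2l ler_wpM2r// ler_nat.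
  rewrite (total_variationD f ak kk) fin_numD IH ?(ltnW kM)//=.
  apply/bounded_variationP => //; exists 1; apply: H => //.
  by rewrite -natr1; lra.
by apply/bounded_variationP => //; rewrite -hM; exact: BV.
Qed.

Lemma AC_bounded f : a <= b -> AC f -> exists2 M, 0 < M & forall t, a <= t <= b -> `|f t| <= M.
Proof.
move=> ab ACf; have BVf := AC_bounded_variation _ ab ACf.
have TVfin : total_variation a b f \is a fin_num by apply/bounded_variationP.
exists (1 + `|f a| + fine (total_variation a b f)).
  by rewrite -addrA ltr_pwDl// addr_ge0// fine_ge0// total_variation_ge0.
move=> t /andP[at_ tb].
have : (`|f t - f a|%:E <= total_variation a b f)%E.
  apply: (le_trans (total_variation_ge f at_)).
  by rewrite (total_variationD f at_ tb) leeDl// total_variation_ge0.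
rewrite -(fineK TVfin) lee_fin.
have := ler_normD (f t - f a) (f a); rewrite subrK; lra.
Qed.

Lemma AC_mul f g : a <= b -> AC f -> AC g -> AC (fun t => f t * g t).
Proof.
move=> ab ACf ACg e e0.
have [M1 M10 HM1] := AC_bounded _ ab ACf; have [M2 M20 HM2] := AC_bounded _ ab ACg.
have f0 : 0 < e / (2 * M2) by rewrite divr_gt0// mulr_gt0.
have g0 : 0 < e / (2 * M1) by rewrite divr_gt0// mulr_gt0.
have [e1 e10 H1] := ACf _ f0; have [e2 e20' H2] := ACg _ g0.
exists (Num.min e1 e2); first by rewrite lt_min e10.
move=> n u v uv tI; rewrite lt_min => /andP[l1 l2].
have {}H1 := H1 n u v uv tI l1; have {}H2 := H2 n u v uv tI l2.
apply: (@le_lt_trans _ _ (M2 * \sum_(i < n) `|f (v i) - f (u i)| +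
   M1 * \sum_(i < n) `|g (v i) - g (u i)|)).
  rewrite !mulr_sumr -big_split/=; apply: ler_sum => i _.
  have [au uvi vb] := uv i.
  have -> : f (v i) * g (v i) - f (u i) * g (u i) =
    g (v i) * (f (v i) - f (u i)) + f (u i) * (g (v i) - g (u i)) by ring.
  apply: (le_trans (ler_normD _ _)); rewrite !normrM; apply: lerD.
    by rewrite ler_wpM2r// HM2// (le_trans au).
  by rewrite ler_wpM2r// HM1// au/= (le_trans uvi).
rewrite ltr_pdivlMr ?mulr_gt0// in H1; rewrite ltr_pdivlMr ?mulr_gt0// in H2.
by lra.
Qed.

Lemma AC_scale f c : AC f -> AC (fun t => c * f t).
Proof.
move=> ACf e e0; have c0 : 0 < `|c| + 1 by rewrite ltr_wpDl.
have [eta eta0 H] := ACf (e / (`|c| + 1)) (divr_gt0 e0 c0).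
exists eta => // n u v uv tI l; have := H n u v uv tI l.
rewrite ltr_pdivlMr//; apply: le_lt_trans.
rewrite mulr_suml; apply: ler_sum => i _.
by rewrite -mulrBr normrM mulrC ler_wpM2l// lerDl.
Qed.

End AbsolutelyContinuous.

(** * Approximation of Borel sets by dyadic unions *)

Section Dyadic.
Context {R : realType}.
Local Notation D := (`]0%R, 1%R]%classic : set R).

Definition dyadic_cell (n k : nat) : set R := `]k%:R / 2 ^+ n, k.+1%:R / 2 ^+ n]%classic.

Definition dyadic_union (n : nat) (B : nat -> bool) : set R :=
  \big[setU/set0]_(i < 2 ^ n | B i) dyadic_cell n i.

Let p2 n : 0 < 2 ^+ n :> R. Proof. by rewrite exprn_gt0. Qed.

Let cellP n k x : dyadic_cell n k x <-> (k%:R < x * 2 ^+ n) && (x * 2 ^+ n <= k.+1%:R).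
Proof. by rewrite /dyadic_cell /= in_itv/= ltr_pdivrMr// ler_pdivlMr. Qed.

Let unionP n B x : dyadic_union n B x <->
  exists k, [/\ (k < 2 ^ n)%N, B k & dyadic_cell n k x].
Proof.
rewrite /dyadic_union -(big_mkord B (dyadic_cell n)) -bigcup_seq_cond; split.
  by move=> [k /= /andP[]]; rewrite mem_index_iota => /= kn Bk kx; exists k.
by move=> [k [kn Bk kx]]; exists k => //=; rewrite mem_index_iota kn Bk.
Qed.

Let cell_ex n x : D x -> exists2 k, (k < 2 ^ n)%N & dyadic_cell n k x.
Proof.
rewrite /= in_itv/= => /andP[x0 x1].
have xn : x * 2 ^+ n <= (2 ^ n)%:R by rewrite natrX ler_piMl// ltW.
have ex : exists k, x * 2 ^+ n <= k.+1%:R.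
  by exists (2 ^ n)%N; rewrite (le_trans xn)// ler_nat.
case: (ex_minnP ex) => k xk kmin; exists k.
  have n0 : (0 < 2 ^ n)%N by rewrite expn_gt0.
  by rewrite -(prednK n0) ltnS; apply: kmin; rewrite prednK.
apply/cellP; rewrite xk andbT.
case: k kmin {xk} => [_|k kmin]; first by rewrite mulr_gt0.
by rewrite ltNge; apply/negP => /kmin; rewrite ltnn.
Qed.

Let cell_uniq n j k x : dyadic_cell n j x -> dyadic_cell n k x -> j = k.
Proof.
move=> /cellP/andP[j1 j2] /cellP/andP[k1 k2].
have := lt_le_trans j1 k2; have := lt_le_trans k1 j2.
by rewrite !ltr_nat !ltnS => ? ?; apply/eqP; rewrite eqn_leq; apply/andP.
Qed.

Let cellD n k : (k < 2 ^ n)%N -> dyadic_cell n k `<=` D.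
Proof.
move=> kn x /cellP/andP[k1 k2]; rewrite /= in_itv/=; apply/andP; split.
  by rewrite -(pmulr_lgt0 x (p2 n)) (le_lt_trans _ k1).
rewrite -(ler_pM2r (p2 n)) mul1r (le_trans k2)//.
by rewrite -natrX ler_nat.
Qed.

Let cell_half n k : dyadic_cell n.+1 k `<=` dyadic_cell n k./2.
Proof.
move=> x /cellP/andP[]; rewrite exprS mulrCA => k1 k2; apply/cellP.
have h1 : k./2%:R * 2 <= k%:R :> R by rewrite -natrM muln2 ler_nat -[leqRHS]odd_double_half leq_addl.
have h2 : k.+1%:R <= k./2.+1%:R * 2 :> R.
  by rewrite -natrM muln2 ler_nat -{1}(odd_double_half k); case: (odd k); rewrite doubleS.
by apply/andP; split; lra.
Qed.

Let unionE n B k x : (k < 2 ^ n)%N -> dyadic_cell n k x -> dyadic_union n B x <-> B k.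
Proof.
move=> kn kx; split; last by move=> Bk; apply/unionP; exists k.
by move=> /unionP[j [jn Bj jx]]; rewrite (cell_uniq _ _ _ _ kx jx).
Qed.

Let union_subD n B : dyadic_union n B `<=` D.
Proof. by move=> x /unionP[k [kn _ kx]]; exact: (cellD n k). Qed.

Let measurable_union n B : measurable (dyadic_union n B).
Proof. by apply: bigsetU_measurable => i _; exact: measurable_itv. Qed.

Let union_lift n p B : exists B', dyadic_union n B = dyadic_union (n + p) B'.
Proof.
elim: p => [|p [B' ->]]; first by exists B; rewrite addn0.
exists (fun k => B' k./2); rewrite addnS; apply/seteqP; split => x.
  move=> Ux; have Dx := union_subD _ _ _ Ux.
  have [k kn kx] := cell_ex (n + p).+1 x Dx.
  apply/(unionE _ _ k) => //; apply/(unionE (n + p)%N B' k./2 x) => //.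
    by rewrite ltn_half_double -mul2n -expnS.
  exact: cell_half.
move=> /unionP[k [kn Bk kx]]; apply/unionP; exists k./2; split => //.
  by rewrite ltn_half_double -mul2n -expnS.
exact: cell_half.
Qed.

Variable m : {measure set (measurableTypeR R) -> \bar R}.
Hypothesis mfin : (m setT < +oo)%E.

Definition sym_diff (A E : set R) : set R := (A `\` E) `|` (E `\` A).

Let approx (A : set R) := measurable A /\ forall e : R, 0 < e ->
  exists n B, (m (D `&` sym_diff A (dyadic_union n B)) < e%:E)%E.

Let mD : measurable D. Proof. exact: measurable_itv. Qed.

Let msd A E : measurable A -> measurable E -> measurable (D `&` sym_diff A E).
Proof.
move=> mA mE; apply: measurableI => //.
by apply: measurableU; apply: measurableD.
Qed.

Let mlt A : measurable A -> (m A < +oo)%E.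
Proof.
by move=> mA; apply: le_lt_trans mfin; apply: le_measure => //; rewrite inE.
Qed.

Let approxC A : approx A -> approx (~` A).
Proof.
move=> [mA HA]; split; first exact: measurableC.
move=> e e0; have [n [B HB]] := HA e e0; exists n, (fun k => ~~ B k).
suff -> : D `&` sym_diff (~` A) (dyadic_union n (fun k => ~~ B k)) =
          D `&` sym_diff A (dyadic_union n B) by [].
apply/seteqP; split => x [Dx]; have [k kn kx] := cell_ex n x Dx.
  move=> [[nA nU]|[U nA]]; split => //.
    right; split => //; apply/(unionE n B k x kn kx).
    by apply: contrapT => /negP nB; apply: nU; apply/(unionE n _ k x kn kx).
  left; split; first exact: contrapT.
  by move: U => /(unionE n _ k x kn kx)/negP nB /(unionE n _ k x kn kx).
move=> [[xA nU]|[U nA]]; split => //.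
  right; split; [|by move=> /(_ xA)].
  by apply/(unionE n _ k x kn kx); apply/negP => Bk; apply: nU; apply/(unionE n _ k x kn kx).
left; split => // /(unionE n _ k x kn kx)/negP; apply.
exact/(unionE n _ k x kn kx).
Qed.

Let approxU A A' : approx A -> approx A' -> approx (A `|` A').
Proof.
move=> [mA HA] [mA' HA']; split; first exact: measurableU.
move=> e e0; have e20 : 0 < e / 2 by rewrite divr_gt0.
have [n [B HB]] := HA _ e20; have [n' [B' HB']] := HA' _ e20.
have [B1 E1] := union_lift n n' B; have [B2] := union_lift n' n B'.
rewrite addnC => E2; rewrite E1 in HB; rewrite E2 in HB'.
exists (n + n')%N, (fun k => B1 k || B2 k).
apply: (@le_lt_trans _ _ (m (D `&` sym_diff A (dyadic_union (n + n') B1)) +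
   m (D `&` sym_diff A' (dyadic_union (n + n') B2)))%E); last first.
  by rewrite [e]splitr EFinD lteD.
apply: le_trans (measureU2 _ _ _); [|exact: msd|exact: msd].
apply: le_measure; rewrite ?inE; [|by apply: measurableU; exact: msd|].
  by apply: msd => //; exact: measurableU.
move=> x [Dx]; have [k kn kx] := cell_ex (n + n') x Dx.
have E B3 := unionE (n + n')%N B3 k x kn kx.
move=> [[[xA|xA'] nU]|[/E/orP U /not_orP[nA nA']]].
- by left; split => //; left; split => // /E Bk; apply: nU; apply/E; rewrite Bk.
- by right; split => //; left; split => // /E Bk; apply: nU; apply/E; rewrite Bk orbT.
- case: U => Bk; [left|right]; split => //; right; split => //; exact/E.
Qed.

Let approx0 : approx set0.
Proof.
split=> // e e0; exists 0%N, (fun=> false).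
rewrite /dyadic_union big_pred0// /sym_diff setDv setU0 setI0 measure0.
by rewrite lte_fin.
Qed.

(** Finite unions converge in measure to the countable union, m being finite. *)
Let approx_bigcup (A : nat -> set R) : (forall n, approx (A n)) -> approx (\bigcup_n A n).
Proof.
move=> HA; have mA : measurable (\bigcup_n A n).
  by apply: bigcupT_measurable => n; case: (HA n).
split => // e e0; have e20 : 0 < e / 2 by rewrite divr_gt0.
pose U k := \big[setU/set0]_(i < k) A i.
have aU k : approx (U k).
  elim: k => [|k IH]; first by rewrite /U big_ord0; exact: approx0.
  by rewrite /U big_ord_recr; exact: approxU.
pose F k := \bigcup_n A n `\` U k.
have mF k : measurable (F k) by apply: measurableD => //; case: (aU k).
have UP k x : U k x <-> exists2 i, (i < k)%N & A i x.
  by rewrite /U -(bigcup_mkord k A); split => -[i ik Ai]; exists i.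
have cap : \bigcap_k F k = set0.
  apply/seteqP; split => // x Fx; have [[i _ Ai] _] := Fx 0%N I.
  by have [_] := Fx i.+1 I; apply; apply/UP; exists i.
have : m \o F @ \oo --> m (\bigcap_k F k).
  have mcap : measurable (\bigcap_k F k) by rewrite cap; exact: measurable0.
  apply: (nonincreasing_cvg_mu (mlt _ (mF 0%N)) mF mcap).
  move=> j k jk; apply/subsetPset => x [Ax nU]; split => // /UP[i ij Ai].
    by apply: nU; apply/UP; exists i => //; exact: leq_trans jk.
rewrite cap measure0 => /fine_cvgP[_ /cvgrPdist_lt/(_ _ e20)].
move=> [k _ /(_ k (leqnn k))]; rewrite /= sub0r normrN.
have Ffin : m (F k) \is a fin_num.
  by rewrite ge0_fin_numE//; apply: mlt; exact: mF.
rewrite ger0_norm ?fine_ge0// -lte_fin fineK// => Fe.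
have [mU /(_ _ e20)[n [B HB]]] := aU k.
exists n, B; apply: (@le_lt_trans _ _ (m (F k) + m (D `&` sym_diff (U k) (dyadic_union n B)))%E); last first.
  by rewrite [e]splitr EFinD lteD.
have mk := msd _ _ mU (measurable_union n B).
apply: (@le_trans _ _ (m (F k `|` (D `&` sym_diff (U k) (dyadic_union n B))))); last exact: (measureU2 m (mF k) mk).
apply: le_measure; rewrite ?inE; [exact: msd|exact: (measurableU _ _ (mF k) mk)|].
move=> x [Dx [[Ax nE]|[Ex nA]]].
  have [Ux|nU] := pselect (U k x); last by left.
  by right; split => //; left.
right; split => //; right; split => // /UP[i _ Ai]; apply: nA.
by exists i.
Qed.

(** At level n only the cell that contains a is wrong; the part of the ray that it
    misses lies in ]a, a + 2 ^- n[, which shrinks to the empty set. *)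
Let approx_ray a : approx `]a, +oo[%classic.
Proof.
split; first exact: measurable_itv.
move=> e e0; pose B n k := (a <= k%:R / 2 ^+ n :> R).
pose F n : set R := `]a, a + (2 ^+ n)^-1[%classic.
have cap : \bigcap_n F n = set0.
  apply/seteqP; split => // x Fx.
  have ax : a < x by have := Fx 0%N I; rewrite /F/= in_itv/= => /andP[].
  pose n := (Num.truncn (x - a)^-1).+1.
  have := Fx n I; rewrite /F/= in_itv/= -ltrBlDl => /andP[_].
  rewrite -[x - a]invrK ltf_pV2 ?posrE ?invr_gt0 ?subr_gt0// => H.
  have := lt_trans H (truncnS_gt (x - a)^-1).
  by rewrite -natrX ltr_nat -/n ltnNge ltnW// ltn_expl.
have mF n : measurable (F n) by exact: measurable_itv.
have : m \o F @ \oo --> m (\bigcap_k F k).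
  have mcap : measurable (\bigcap_k F k) by rewrite cap; exact: measurable0.
  apply: (nonincreasing_cvg_mu (mlt _ (mF 0%N)) mF mcap).
  move=> j k jk; apply/subsetPset => x; rewrite /F/= !in_itv/= => /andP[-> /=].
    move=> /lt_le_trans; apply; rewrite lerD2l lef_pV2 ?posrE//.
    by rewrite ler_weXn2l// ler1n.
rewrite cap measure0 => /fine_cvgP[_ /cvgrPdist_lt/(_ _ e0)].
move=> [n _ /(_ n (leqnn n))]; rewrite /= sub0r normrN.
have Ffin : m (F n) \is a fin_num.
  by rewrite ge0_fin_numE//; apply: mlt; exact: mF.
rewrite ger0_norm ?fine_ge0// -lte_fin fineK// => Fe.
exists n, (B n); apply: le_lt_trans Fe; apply: le_measure; rewrite ?inE.
- by apply: msd => //; exact: measurable_itv.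
- exact: mF.
move=> x [Dx]; have [k kn kx] := cell_ex n x Dx.
have E := unionE n (B n) k x kn kx; have := kx => /cellP/andP[k1 k2].
have rayP : `]a, +oo[%classic x <-> a < x by rewrite /= in_itv/= andbT.
rewrite /F /= in_itv/=; move=> [[/rayP ax nE]|[/E Bk nA]].
  apply/andP; split => //.
  rewrite -(ltr_pM2r (p2 n)) mulrDl mulVf ?gt_eqF//.
  have : ~~ B n k by apply/negP => Bk; apply: nE; exact/E.
  rewrite /B -ltNge ltr_pdivrMr// => H; apply: (le_lt_trans k2).
  by rewrite -natr1 ltrD2r.
exfalso; apply: nA; apply/rayP; move: Bk; rewrite /B ler_pdivlMr// => ak.
by rewrite -(ltr_pM2r (p2 n)); exact: le_lt_trans k1.
Qed.

(** The sets that dyadic unions approximate in measure form a sigma-algebra, and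
    the rays belong to it.  Dyadic unions are finite unions of disjoint intervals,
    which is the form that absolute continuity asks for. *)
Lemma dyadic_approximation (A : set R) (e : R) : measurable A -> 0 < e ->
  exists n B, (m (D `&` sym_diff A (dyadic_union n B)) < e%:E)%E.
Proof.
move=> mA e0; suff [_] : approx A by exact.
move: A mA; rewrite /measurable/= /measurableR RGenOInfty.measurableE.
apply: smallest_sub.
  split; [exact: approx0|by move=> A; rewrite setTD; exact: approxC|exact: approx_bigcup].
by move=> _ [x ->]; exact: approx_ray.
Qed.

End Dyadic.

(** * The fundamental theorem of calculus for absolutely continuous functions *)

Section Density.
Context {R : realType}.
Local Notation mu := (@lebesgue_measure R).
Local Notation AC := (absolutely_continuous 0 1).
Local Notation D := (`]0%R, 1%R]%classic : set R).

Let clip (x : R) : R := Num.max 0 (Num.min x 1).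

Let clip01 x : 0 <= clip x <= 1.
Proof. by rewrite /clip le_max lexx/= ge_max ler01/= ge_min lexx orbT. Qed.

Let clip_id x : 0 <= x <= 1 -> clip x = x.
Proof. by case/andP => x0 x1; rewrite /clip min_l// max_r. Qed.

Let clip_le x y : x <= y -> clip x <= clip y.
Proof.
move=> xy; rewrite /clip.
have mxy : Num.min x 1 <= Num.min y 1 by rewrite le_min !ge_min xy lexx orbT.
by rewrite ge_max !le_max lexx mxy orbT.
Qed.

(** The negative variation is right-continuous where the function is; outside
    [0, 1] it is continued by constants. *)
Lemma cumulative_neg_tv (phi : R -> R) : AC phi ->
  exists F : cumulative R R, forall t, 0 <= t <= 1 -> F t = fine (neg_tv 0 phi t).
Proof.
move=> ACphi; have BVphi := AC_bounded_variation _ _ _ ler01 ACphi.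
have rphi x : 0 <= x -> x < 1 -> phi @ x^'+ --> phi x.
  move=> x0 x1; apply/cvgrPdist_lt => e e0.
  have [eta eta0 H] := AC_unif _ _ _ ACphi e e0.
  near=> t; rewrite distrC; apply: H => //.
  - by near: t; exact: nbhs_right_ltW.
  - by near: t; exact: nbhs_right_ltDr.
pose f x := fine (neg_tv 0 phi (clip x)).
have f_nd : nondecreasing f.
  move=> x y xy; apply: (fine_neg_tv_nondecreasing BVphi); rewrite ?in_itv/= ?clip01//.
  exact: clip_le.
have f_rc : forall x, f t @[t --> x^'+] --> f x.
  move=> x; have [x0|x0] := ltP x 0.
    apply: cvg_near_cst; near=> t; rewrite /f; congr (fine (neg_tv _ _ _)).
    have t0 : t < 0 by near: t; exact: nbhs_right_lt.
    by rewrite /clip !max_l// ge_min ltW.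
  have [x1|x1] := ltP x 1; last first.
    apply: cvg_near_cst; near=> t; rewrite /f; congr (fine (neg_tv _ _ _)).
    have t0 : x <= t by near: t; exact: nbhs_right_ge.
    by rewrite /clip !min_r// (le_trans x1).
  rewrite {2}/f clip_id ?x0 ?(ltW x1)//.
  have := neg_tv_right_continuous x0 x1 BVphi (rphi x x0 x1).
  apply: cvg_trans; apply: near_eq_cvg; near=> t.
  rewrite /f/= clip_id//; apply/andP; split.
    by apply: (le_trans x0); near: t; exact: nbhs_right_ge.
  by near: t; exact: nbhs_right_ltW.
pose F : cumulative R R := HB.pack f (isCumulative.Build R _ R f f_nd f_rc).
by exists F => t t01; rewrite /F/= /f clip_id.
Unshelve. all: by end_near. Qed.

Lemma lebesgue_stieltjes_oc (F : cumulative R R) (u v : R) : u <= v ->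
  lebesgue_stieltjes_measure F `]u, v]%classic = (F v - F u)%:E.
Proof.
move=> uv; rewrite /lebesgue_stieltjes_measure/= /measure_extension.
rewrite measurable_mu_extE/=; last exact: is_ocitv.
by rewrite wlength_itv_bnd.
Qed.

Let mD : @measurable _ (measurableTypeR R) D. Proof. exact: measurable_itv. Qed.

Let LSfin (H : cumulative R R) : (lebesgue_stieltjes_measure H D < +oo)%E.
Proof. by rewrite lebesgue_stieltjes_oc// ltry. Qed.

Section NullSets.
Variables (psi : R -> R) (F G : cumulative R R).
Hypotheses (AC_psi : AC psi) (psiE : forall t, 0 <= t <= 1 -> psi t = F t - G t).

Let mF : {finite_measure set (measurableTypeR R) -> \bar R} := mfrestr mD (LSfin F).
Let mG : {finite_measure set (measurableTypeR R) -> \bar R} := mfrestr mD (LSfin G).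

Let Dfin : (mu D < +oo)%E.
Proof. by rewrite lebesgue_measure_itv/= lte_fin ltr01 -EFinD ltry. Qed.

(** One measure that dominates the three for which an approximation is
    needed. *)
Let m := measure_add (measure_add mF mG) (mfrestr mD Dfin).

Let m_sumE A : m A = (mF A + mG A + mu (A `&` D))%E.
Proof. by rewrite /m measure_addE; congr (_ + _)%E; exact: (measure_addE mF mG). Qed.

Let mfin : (m setT < +oo)%E.
Proof.
rewrite m_sumE setTI; apply: lte_add_pinfty => //; apply: lte_add_pinfty.
  by rewrite -ge0_fin_numE// fin_num_measure.
by rewrite -ge0_fin_numE// fin_num_measure.
Qed.

Let restrD (H : cumulative R R) (A : set R) :
  mfrestr mD (LSfin H) (D `&` A) = mfrestr mD (LSfin H) A.
Proof. by rewrite /mfrestr/= /mrestr/= setIAC setIid setIC. Qed.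

Let cell_sub n i : (i < 2 ^ n)%N -> (dyadic_cell n i : set R) `<=` D.
Proof.
move=> ib x; rewrite /dyadic_cell/= !in_itv/= => /andP[x0 x1]; apply/andP; split.
  by apply: le_lt_trans x0; rewrite divr_ge0// exprn_ge0.
by rewrite (le_trans x1)// ler_pdivrMr ?exprn_gt0// mul1r -natrX ler_nat.
Qed.

Let cell_le n i : i%:R / 2 ^+ n <= i.+1%:R / 2 ^+ n :> R.
Proof. by rewrite ler_pM2r ?invr_gt0 ?exprn_gt0// ler_nat. Qed.

Let cell_triv n : trivIset [set: 'I_(2 ^ n)] (fun i => dyadic_cell n i : set R).
Proof.
move=> i j _ _ [x []]; rewrite /dyadic_cell/= !in_itv/= => /andP[i1 i2] /andP[j1 j2].
have p2 : 0 < 2 ^+ n :> R by rewrite exprn_gt0.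
have := lt_le_trans i1 j2; have := lt_le_trans j1 i2.
rewrite !ltr_pM2r ?invr_gt0// !ltr_nat !ltnS => ? ?; apply/val_inj/eqP.
by rewrite eqn_leq; apply/andP.
Qed.

Let union_sub n B : (dyadic_union n B : set R) `<=` D.
Proof.
move=> x; rewrite /dyadic_union -(big_mkord B (dyadic_cell n)) -bigcup_seq_cond.
by move=> [k /= /andP[]]; rewrite mem_index_iota => /= kn _; exact: cell_sub.
Qed.

Let measure_union (nu : {measure set (measurableTypeR R) -> \bar R}) n B :
  nu (dyadic_union n B) = (\sum_(i < 2 ^ n | B i) nu (dyadic_cell n i))%E.
Proof.
by rewrite /dyadic_union measure_bigsetU_ord// => i; exact: measurable_itv.
Qed.

Let measurable_union n B : @measurable _ (measurableTypeR R) (dyadic_union n B).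
Proof. by apply: bigsetU_measurable => i _; exact: measurable_itv. Qed.

Let restr_union (H : cumulative R R) n B :
  mfrestr mD (LSfin H) (dyadic_union n B) =
  (\sum_(i < 2 ^ n | B i) (H (i.+1%:R / 2 ^+ n) - H (i%:R / 2 ^+ n)))%:E.
Proof.
rewrite measure_union -sumEFin; apply: eq_bigr => i _.
transitivity (lebesgue_stieltjes_measure H (dyadic_cell n i `&` D)) => //.
rewrite setIidl; last exact: cell_sub.
by rewrite lebesgue_stieltjes_oc.
Qed.

Let restr_close (H : cumulative R R) (N E : set R) (e : R) :
  @measurable _ (measurableTypeR R) N -> @measurable _ (measurableTypeR R) E ->
  (mfrestr mD (LSfin H) (D `&` sym_diff N E) < e%:E)%E ->
  `|fine (mfrestr mD (LSfin H) N) - fine (mfrestr mD (LSfin H) E)| <= e.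
Proof.
move=> mN mE; set nu := mfrestr mD (LSfin H).
have nuD A : nu (D `&` A) = nu A by exact: restrD.
rewrite nuD => lte.
have fin A : @measurable _ (measurableTypeR R) A -> nu A = (fine (nu A))%:E.
  by move=> mA; rewrite fineK// fin_num_measure.
have msd : @measurable _ (measurableTypeR R) (sym_diff N E).
  by apply: measurableU; exact: measurableD.
have le1 A A' : @measurable _ (measurableTypeR R) A -> @measurable _ (measurableTypeR R) A' ->
    A `<=` A' `|` sym_diff N E -> fine (nu A) <= fine (nu A') + e.
  move=> mA mA' sub; rewrite -lee_fin EFinD -!fin//.
  apply: (@le_trans _ _ (nu (A' `|` sym_diff N E))).
    by apply: le_measure; rewrite ?inE//; exact: measurableU.
  by apply: (le_trans (measureU2 nu mA' msd)); rewrite leeD2l// ltW.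
have H1 : fine (nu N) <= fine (nu E) + e.
  apply: le1 => // x Nx; have [Ex|nE] := pselect (E x); first by left.
  by right; left.
have H2 : fine (nu E) <= fine (nu N) + e.
  apply: le1 => // x Ex; have [Nx|nN] := pselect (N x); first by left.
  by right; right.
by rewrite ler_norml; lra.
Qed.

(** F and G are the two parts of the Jordan decomposition of psi.  A null set N is
    close to a dyadic union E for F, G and Lebesgue measure at once.  E has small
    length, so the increments of psi over its cells add up to little, and these
    are the increments of F minus those of G.  Hence the two measures of N differ
    by an arbitrarily small amount. *)
Lemma LS_null (N : set R) : @measurable _ (measurableTypeR R) N -> mu N = 0%E ->
  mfrestr mD (LSfin F) N = mfrestr mD (LSfin G) N.
Proof.
move=> mN N0.
rewrite -(@fineK _ (mfrestr mD (LSfin F) N)) ?fin_num_measure//.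
rewrite -(@fineK _ (mfrestr mD (LSfin G) N)) ?fin_num_measure//.
congr EFin; apply/eqP; rewrite -subr_eq0 -normr_le0; apply/ler_addgt0Pl => e e0.
rewrite addr0.
have e20 : 0 < e / 2 by rewrite divr_gt0.
have [eta eta0 Heta] := AC_psi _ e20.
pose e' := Num.min (e / 4) eta.
have e'0 : 0 < e' by rewrite lt_min eta0 divr_gt0.
have e'4 : e' <= e / 4 by rewrite ge_min lexx.
have e'eta : e' <= eta by rewrite ge_min lexx orbT.
have [n [B HB]] := dyadic_approximation m mfin N e' mN e'0.
set E := dyadic_union n B in HB.
have mEE : @measurable _ (measurableTypeR R) E by exact: measurable_union.
have msd : @measurable _ (measurableTypeR R) (D `&` sym_diff N E).
  by apply: measurableI => //; apply: measurableU; exact: measurableD.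
have {}HB : (mF (D `&` sym_diff N E) + mG (D `&` sym_diff N E) +
    mu (D `&` sym_diff N E `&` D) < e'%:E)%E by rewrite -m_sumE.
have HF : (mF (D `&` sym_diff N E) < e'%:E)%E.
  by apply: le_lt_trans HB; rewrite -addeA leeDl// adde_ge0.
have HG : (mG (D `&` sym_diff N E) < e'%:E)%E.
  by apply: le_lt_trans HB; rewrite -addeA addeCA leeDl// adde_ge0.
have HL : (mu (D `&` sym_diff N E `&` D) < e'%:E)%E.
  by apply: le_lt_trans HB; rewrite leeDr// adde_ge0.
have cF := restr_close F N E e' mN mEE HF.
have cG := restr_close G N E e' mN mEE HG.
have lenE : (mu E < eta%:E)%E.
  apply: (@lt_le_trans _ _ e'%:E); last by rewrite lee_fin.
  apply: le_lt_trans HL; rewrite -[leRHS]add0e -N0.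
  apply: (@le_trans _ _ (mu (N `|` (D `&` sym_diff N E `&` D)))).
    apply: le_measure; rewrite ?inE//.
      by apply: measurableU => //; exact: measurableI.
    move=> x Ex; have [Nx|nN] := pselect (N x); [by left|right].
    by have Dx := union_sub n B x Ex; split => //; split => //; right.
  by apply: measureU2 => //; exact: measurableI.
pose u (i : 'I_(2 ^ n)) : R := i%:R / 2 ^+ n.
(* the cells outside E are kept, but collapsed to a point *)
pose v (i : 'I_(2 ^ n)) : R := if B i then i.+1%:R / 2 ^+ n else i%:R / 2 ^+ n.
have uv i : [/\ 0 <= u i, u i <= v i & v i <= 1].
  have p2 : 0 < 2 ^+ n :> R by rewrite exprn_gt0.
  split; first by rewrite divr_ge0 ?(ltW p2).
    by rewrite /u /v; case: ifP.
  by rewrite /v; case: ifP => _; rewrite ler_pdivrMr// mul1r -natrX ler_nat// ltnW.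
have tuv : trivIset [set: 'I_(2 ^ n)] (fun i => `]u i, v i[%classic).
  move=> i j _ _ [x [/= xi xj]]; apply: (cell_triv n i j) => //.
  exists x; move: xi xj; rewrite /u /v /=.
  case: ifP => _; last by rewrite in_itv/= => /andP[/lt_trans h /h]; rewrite ltxx.
  case: ifP => _; last by move=> _; rewrite in_itv/= => /andP[/lt_trans h /h]; rewrite ltxx.
  rewrite !in_itv/= => /andP[a1 /ltW a2] /andP[a3 /ltW a4].
  by split; rewrite /dyadic_cell/= in_itv/= ?a1 ?a2 ?a3 ?a4.
have luv : \sum_(i < 2 ^ n) (v i - u i) < eta.
  move: lenE; rewrite /E (measure_union lebesgue_measure).
  rewrite (eq_bigr (fun i : 'I_(2 ^ n) => (i.+1%:R / 2 ^+ n - i%:R / 2 ^+ n)%:E)); last first.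
    move=> i _; transitivity (mu (`]i%:R / 2 ^+ n, i.+1%:R / 2 ^+ n]%classic : set R)) => //.
    by rewrite lebesgue_measure_itv/= lte_fin
      ltr_pM2r ?invr_gt0 ?exprn_gt0// ltr_nat ltnSn EFinB.
  rewrite sumEFin lte_fin big_mkcond/=; congr (_ < _); apply: eq_bigr => i _.
  by rewrite /v /u; case: ifP => //; rewrite subrr.
have := Heta _ u v uv tuv luv.
have FGE : fine (mF E) - fine (mG E) = \sum_(i < 2 ^ n) (psi (v i) - psi (u i)).
  rewrite (restr_union F n B : mF E = _) (restr_union G n B : mG E = _) /=.
  rewrite -sumrB big_mkcond/=; apply: eq_bigr => i _.
  have p2 : 0 < 2 ^+ n :> R by rewrite exprn_gt0.
  rewrite /v /u; case: ifP => _; last by rewrite subrr.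
  rewrite !psiE; first by ring.
    by rewrite divr_ge0 ?(ltW p2)//= ler_pdivrMr// mul1r -natrX ler_nat ltnW.
  by rewrite divr_ge0 ?(ltW p2)//= ler_pdivrMr// mul1r -natrX ler_nat.
move=> K2.
have K1 : `|\sum_(i < 2 ^ n) (psi (v i) - psi (u i))| <=
    \sum_(i < 2 ^ n) `|psi (v i) - psi (u i)| by exact: ler_norm_sum.
rewrite -FGE in K1; have K3 := le_lt_trans K1 K2.
have cF' : `|fine (mF N) - fine (mF E)| <= e' := cF.
have cG' : `|fine (mG N) - fine (mG E)| <= e' := cG.
change (is_true (`|fine (mF N) - fine (mG N)| <= e)).
move: (fine (mF N)) (fine (mF E)) (fine (mG N)) (fine (mG E)) cF' cG' K3.
move=> a1 a2 a3 a4; rewrite !ler_norml ltr_norml => /andP[? ?] /andP[? ?] /andP[? ?].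
by apply/andP; split; lra.
Qed.

End NullSets.

(** The difference of the two Stieltjes measures is a charge dominated by Lebesgue
    measure ([LS_null]); h is its Radon-Nikodym density. *)
Lemma AC_density (psi : R -> R) : AC psi -> exists h : R -> R,
  mu.-integrable setT (EFin \o h) /\
  forall t, 0 <= t <= 1 -> psi t = psi 0 + (\int[mu]_(s in `[0%R, t]) h s)%R.
Proof.
move=> ACpsi.
have ACN : AC (\- psi).
  by apply: (AC_eq _ _ (fun t => -1 * psi t)); [move=> t _; rewrite mulN1r|exact: AC_scale].
have BVpsi := AC_bounded_variation _ _ _ ler01 ACpsi.
have [F HF] := cumulative_neg_tv _ ACN.
have [G HG] := cumulative_neg_tv _ ACpsi.
have psiE t : 0 <= t <= 1 -> psi t = F t - G t.
  move=> t01; rewrite HF// HG//.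
  by have := bounded_variation_pos_neg_tvE BVpsi; apply; rewrite in_itv.
pose mF : {finite_measure set (measurableTypeR R) -> \bar R} := mfrestr mD (LSfin F).
pose mG : {finite_measure set (measurableTypeR R) -> \bar R} := mfrestr mD (LSfin G).
pose nu : {charge set (measurableTypeR R) -> \bar R} :=
  cadd (charge_of_finite_measure mF) (cscale (-1) (charge_of_finite_measure mG)).
have nuE A : nu A = (mF A - mG A)%E by rewrite /nu/= /cadd/= /cscale/= mulN1e.
have numu : nu `<< mu.
  apply/null_content_dominatesP => N mN N0.
  rewrite nuE; have -> : mF N = mG N by exact: (LS_null psi).
  by rewrite subee// fin_num_measure.
pose h s := fine (Radon_Nikodym nu mu s).
have hE s : (h s)%:E = Radon_Nikodym nu mu s by rewrite fineK// Radon_Nikodym_fin_num.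
have ih : mu.-integrable setT (EFin \o h).
  by apply: eq_integrable (Radon_Nikodym_integrable numu) => // s _; rewrite /= hE.
exists h; split => // t /andP[t0 t1].
suff -> : (\int[mu]_(s in `[0%R, t]) h s)%R = psi t - psi 0 by rewrite addrC subrK.
rewrite /Rintegral.
have -> : (\int[mu]_(s in `[0%R, t]) (h s)%:E)%E = nu `]0, t]%classic.
  rewrite (Radon_Nikodym_integral numu) -?integral_itv_obnd_cbnd//.
  - by apply: eq_integral => s _; rewrite hE.
  - by apply: measurable_funTS; apply: measurable_int ih.
have tD : `]0, t]%classic `<=` D.
  by move=> x /=; rewrite !in_itv/= => /andP[-> /le_trans]; apply.
have mFE : mF `]0, t]%classic = (F t - F 0)%:E.
  transitivity (lebesgue_stieltjes_measure F (`]0, t]%classic `&` D)) => //.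
  by rewrite setIidl// lebesgue_stieltjes_oc.
have mGE : mG `]0, t]%classic = (G t - G 0)%:E.
  transitivity (lebesgue_stieltjes_measure G (`]0, t]%classic `&` D)) => //.
  by rewrite setIidl// lebesgue_stieltjes_oc.
rewrite nuE mFE mGE /= !psiE ?t0 ?lexx ?ler01//; ring.
Qed.

Lemma ae_derive_primitive (h : R -> R) : mu.-integrable setT (EFin \o h) ->
  {ae mu, forall s : R, 0 < s ->
    is_derive s (1 : R) (fun y => (\int[mu]_(r in `[0%R, y]) h r)%R) (h s)}.
Proof.
move=> ih.
have ih' y : mu.-integrable [set` Interval (BLeft 0%R) (BRight y)] (EFin \o h).
  exact: integrableS ih.
have lh : locally_integrable [set: R] h.
  by apply: open_integrable_locally => //; exact: openT.
have := FTC1 ih' lh; apply: filterS; first exact: (ae_filter_ringOfSetsType mu).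
move=> s H s0.
have s0' : (BLeft 0%R < BRight s)%E by rewrite /= lte_fin.
have [dF FE] := H s0'.
by exact: (DeriveDef dF (etrans (esym (derive1E _ _)) FE)).
Qed.

(** By [AC_density], psi is the primitive of an integrable function, and Lebesgue
    differentiation recovers this function as the derivative of psi. *)
Theorem AC_FTC (psi : R -> R) : AC psi -> exists h : R -> R,
  [/\ mu.-integrable setT (EFin \o h),
      forall t, 0 <= t <= 1 -> psi t = psi 0 + (\int[mu]_(s in `[0%R, t]) h s)%R &
      {ae mu, forall s : R, 0 < s < 1 -> is_derive s (1 : R) psi (h s)}].
Proof.
move=> /AC_density[h [ih hE]]; exists h; split => //.
have := ae_derive_primitive h ih.
apply: filterS; first exact: (ae_filter_ringOfSetsType mu).
move=> s H /andP[s0 s1].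
have isG : is_derive s (1 : R) (fun y => psi 0 + (\int[mu]_(r in `[0%R, y]) h r)%R) (h s).
  by rewrite -[h s]add0r; have isF := H s0; apply: is_deriveD.
apply: (near_eq_is_derive _ isG).
near=> y; apply/esym/hE; apply/andP; split; apply/ltW; near: y.
  exact: lt_nbhsr.
exact: lt_nbhsl.
Unshelve. all: by end_near. Qed.

End Density.

(** * Derivatives and integrals up to null sets *)

Section Calculus.
Context {R : realType}.
Implicit Types (f g : R -> R).

Lemma is_derive_mulf f g (s a b : R) : is_derive s (1 : R) f a ->
  is_derive s (1 : R) g b -> is_derive s (1 : R) (fun t => f t * g t) (a * g s + f s * b).
Proof.
move=> df dg; have := is_deriveM df dg.
by move=> H; apply: (is_derive_eq H); rewrite /GRing.scale/=; ring.
Qed.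

Lemma is_derive_addf f g (s a b : R) : is_derive s (1 : R) f a ->
  is_derive s (1 : R) g b -> is_derive s (1 : R) (fun t => f t + g t) (a + b).
Proof. by move=> df dg; exact: is_deriveD. Qed.

Lemma is_derive_scalef f (s a c : R) : is_derive s (1 : R) f a ->
  is_derive s (1 : R) (fun t => c * f t) (c * a).
Proof. by move=> df; exact: is_deriveZ. Qed.

Lemma is_derive_uniq f (s a b : R) : is_derive s (1 : R) f a ->
  is_derive s (1 : R) f b -> a = b.
Proof. by move=> [_ <-] [_ <-]. Qed.

Lemma is_derive_derive1 f (s a : R) : is_derive s (1 : R) f a -> f^`()%classic s = a.
Proof. by move=> [_ <-]; rewrite derive1E. Qed.

(** The difference quotients have opposite signs on the two sides. *)
Lemma is_derive_min f (s a : R) : is_derive s (1 : R) f a ->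
  (\forall t \near s, f s <= f t) -> a = 0.
Proof.
move=> [df da] fmin.
have cv : (fun h => h^-1 *: ((f \o shift s) (h *: (1 : R)) - f s)) @ (0 : R)^' --> a.
  by rewrite -da.
have fs : \forall h \near (0 : R), f s <= f (h + s).
  have sh : (fun h : R => h + s) @ (0 : R) --> s.
    by rewrite -[X in _ --> X]add0r; apply: cvgD; [exact: cvg_id|exact: cvg_cst].
  exact: sh fmin.
have fsl : \forall h \near (0 : R)^'-, f s <= f (h + s) by exact: cvg_within fs.
have fsr : \forall h \near (0 : R)^'+, f s <= f (h + s) by exact: cvg_within fs.
have cvl := cvg_dnbhs_at_left cv; have cvr := cvg_dnbhs_at_right cv.
apply/eqP; rewrite eq_le; apply/andP; split.
  apply: (cvgr_to_le cvl).
  near=> h => /=.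
  have h0 : h < 0 by near: h; exact: nbhs_left_lt.
  rewrite /GRing.scale/= nmulr_rle0 ?invr_lt0// subr_ge0.
  have -> : h * 1 = h by rewrite mulr1.
  by near: h.
apply: (cvgr_to_ge cvr).
near=> h => /=.
have h0 : 0 < h by near: h; exact: nbhs_right_gt.
rewrite /GRing.scale/= pmulr_rge0 ?invr_gt0// subr_ge0.
have -> : h * 1 = h by rewrite mulr1.
by near: h.
Unshelve. all: by end_near. Qed.

Lemma AC_cadlag f : absolutely_continuous 0 1 f -> cadlag f.
Proof.
move=> /(AC_within_continuous _ _ _ ltr01)/(continuous_within_itvP _ ltr01)[ci c0 c1].
split=> t /andP[t0 t1].
  move: t0; rewrite le_eqVlt => /predU1P[<-//|t0].
  by apply/cvg_at_right_filter/ci; rewrite in_itv/= t0.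
move: t1; rewrite le_eqVlt => /predU1P[->|t1]; first by apply/cvg_ex; exists (f 1).
by apply/cvg_ex; exists (f t); apply/cvg_at_left_filter/ci; rewrite in_itv/= t0.
Qed.

End Calculus.

Section NonMeasurable.
Context {d : measure_display} {T : measurableType d} {R : realType}.
Variable mu : {measure set T -> \bar R}.
Local Open Scope ereal_scope.

(** The integral of a nonnegative function is a supremum over the simple functions
    below it, so it is monotone without measurability.  This matters because the
    integrand of the action contains the derivative of an arbitrary path. *)
Lemma le_integral_nonmeasurable (D : set T) (f1 f2 : T -> \bar R) :
  (forall x, D x -> 0 <= f1 x) -> (forall x, D x -> f1 x <= f2 x) ->
  \int[mu]_(x in D) f1 x <= \int[mu]_(x in D) f2 x.
Proof.
move=> f10 f12; rewrite !ge0_integralE//; last first.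
  by move=> x Dx; exact: le_trans (f10 x Dx) (f12 x Dx).
apply: ereal_sup_le => _ [h /= hf <-]; exists h => //= x.
apply: (le_trans (hf x)); rewrite /patch; case: ifPn => // /set_mem Dx; exact: f12.
Qed.

(** The integral over D is reduced to D minus the exceptional set; measurability
    of f1 is what makes this reduction exact on the smaller side. *)
Lemma ae_le_integral_measurablel (D : set T) (f1 f2 : T -> \bar R) :
  measurable D -> measurable_fun D f1 ->
  (forall x, D x -> 0 <= f1 x) -> (forall x, D x -> 0 <= f2 x) ->
  {ae mu, forall x, D x -> f1 x <= f2 x} ->
  \int[mu]_(x in D) f1 x <= \int[mu]_(x in D) f2 x.
Proof.
move=> mD mf1 f10 f20 [N [mN N0 sN]].
rewrite (ge0_negligible_integral mN mD mf1 f10 N0).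
apply: (@le_trans _ _ (\int[mu]_(x in D `\` N) f2 x)).
  apply: le_integral_nonmeasurable => x [Dx Nx]; first exact: f10.
  by apply: contrapT => H; apply: Nx; apply: sN => /=; move/(_ Dx).
rewrite integral_mkcond [leRHS]integral_mkcond.
apply: le_integral_nonmeasurable => x _; rewrite /patch.
  by case: ifPn => // /set_mem[Dx _]; exact: f20.
case: ifPn => [/set_mem[Dx _]|_]; first by rewrite mem_set.
by case: ifPn => // /set_mem Dx; exact: f20.
Qed.

(** f2 is set to +oo on the exceptional set. *)
Lemma ae_le_integral_measurabler (D : set T) (f1 f2 : T -> \bar R) :
  measurable D -> measurable_fun D f2 ->
  (forall x, D x -> 0 <= f1 x) -> (forall x, D x -> 0 <= f2 x) ->
  {ae mu, forall x, D x -> f1 x <= f2 x} ->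
  \int[mu]_(x in D) f1 x <= \int[mu]_(x in D) f2 x.
Proof.
move=> mD mf2 f10 f20 [N [mN N0 sN]].
pose g x := if x \in N then +oo else f2 x.
have mg : measurable_fun D g.
  apply: measurable_fun_if => //.
  - apply: (measurable_fun_bool true) => //.
    rewrite (_ : _ @^-1` _ = N) ?setTI; first exact: measurableI.
    by apply/seteqP; split => x /=; [move/set_mem|move/mem_set].
  - by apply: measurable_funS mf2 => // x [].
rewrite [leRHS](_ : _ = \int[mu]_(x in D) g x).
  apply: le_integral_nonmeasurable => // x Dx; rewrite /g; case: ifPn => [_|/negP xN].
    by rewrite leey.
  by apply: contrapT => H; apply: xN; apply: mem_set; apply: sN => /=; move/(_ Dx).
apply: ge0_ae_eq_integral => //.
  by move=> x Dx; rewrite /g; case: ifPn => // _; exact: f20.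
exists N; split => // x /=; apply: contra_notP => xN Dx.
by rewrite /g ifF//; apply/negbTE/negP => /set_mem.
Qed.

End NonMeasurable.

Section Primitives.
Context {R : realType}.
Local Notation mu := (@lebesgue_measure R).
Local Notation AC := (absolutely_continuous 0 1).

Lemma ae_imp (A B : R -> Prop) : (forall s, A s -> B s) ->
  {ae mu, forall s : R, A s} -> {ae mu, forall s : R, B s}.
Proof. by move=> AB; apply: negligibleS => s /= nB /AB. Qed.

Lemma ae_imp2 (A B C : R -> Prop) : (forall s, A s -> B s -> C s) ->
  {ae mu, forall s : R, A s} -> {ae mu, forall s : R, B s} -> {ae mu, forall s : R, C s}.
Proof.
move=> ABC nA nB; apply: negligibleS (negligibleU nA nB) => s /= nC.
by apply: contrapT => /not_orP[/contrapT HA /contrapT HB]; exact/nC/ABC.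
Qed.

Lemma ae_notin_finite (A : set R) : finite_set A -> {ae mu, forall s : R, ~ A s}.
Proof.
move=> fA; exists A; split.
- by apply: countable_measurable => [t|]; [exact: measurable_set1|exact: finite_set_countable].
- by apply/countable_lebesgue_measure0/finite_set_countable.
- by move=> s /=; exact: contrapT.
Qed.

Lemma AC_measurable (f : R -> R) : AC f -> measurable_fun (`[0%R, 1%R] : set R) f.
Proof.
move=> /(AC_within_continuous _ _ _ ltr01) cf.
apply: subspace_continuous_measurable_fun => //; exact: measurable_itv.
Qed.

(** The converse reading of [AC_FTC]: any measurable function equal to the
    derivative almost everywhere can be integrated. *)
Lemma AC_integral_derive (f k : R -> R) : AC f -> measurable_fun (`[0%R, 1%R] : set R) k ->
  {ae mu, forall s : R, 0 < s < 1 -> is_derive s (1 : R) f (k s)} ->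
  mu.-integrable `[0%R, 1%R] (EFin \o k) /\
  forall t, 0 <= t <= 1 -> (\int[mu]_(s in `[0%R, t]) (k s)%:E)%E = (f t - f 0)%:E.
Proof.
move=> ACf mk dk; have [h [ih fE dh]] := AC_FTC _ ACf.
have hk : {ae mu, forall s : R, (`[0%R, 1%R]%classic : set R) s -> (h s)%:E = (k s)%:E}.
  have hk0 : {ae mu, forall s : R, 0 < s < 1 -> h s = k s}.
    by apply: ae_imp2 dh dk => s H1 H2 s01; exact: is_derive_uniq (H1 s01) (H2 s01).
  have n0 := ae_notin_finite [set 0; 1] (finite_set2 0 1).
  apply: ae_imp2 n0 hk0 => s.
  move=> /not_orP[/eqP s0 /eqP s1] H; rewrite /= in_itv/= !le_eqVlt.
  by rewrite (negbTE s1) eq_sym (negbTE s0)/= => /H ->.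
have ihs t : mu.-integrable `[0%R, t] (EFin \o h) by apply: integrableS ih.
have mh t : measurable_fun (`[0%R, t] : set R) (EFin \o h) by exact: measurable_int (ihs t).
have mD t : measurable (`[0%R, t]%classic : set R) by exact: measurable_itv.
split.
  apply/integrableP; split; first exact/measurable_EFinP.
  have /integrableP[_] := ihs 1; congr (_ < _)%E.
  apply: ge0_ae_eq_integral => //.
  - by apply: measurableT_comp => //; exact: mh.
  - by apply: measurableT_comp => //; exact/measurable_EFinP.
  - by apply: (ae_imp _ _ _ hk) => s H s01; exact: (congr1 abse (H s01)).
move=> t /andP[t0 t1]; rewrite (fE t) ?t0// addrC addKr.
rewrite /Rintegral fineK; last by apply: integrable_fin_num => //; exact: ihs.
have ts : `[0, t]%classic `<=` (`[0, 1]%classic : set R).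
  by move=> x /=; rewrite !in_itv/= => /andP[-> /le_trans]; apply.
apply: ae_eq_integral => //.
- by apply/measurable_EFinP; apply: measurable_funS mk.
- by exact: mh.
- by apply: (ae_imp _ _ _ hk) => s H st; rewrite H//; exact: ts.
Qed.

End Primitives.

(** * Occupation times *)

Section Occupation.
Context {R : realType}.
Local Notation mu := (@lebesgue_measure R).
Variable O : set R.
Hypothesis mO : @measurable _ (measurableTypeR R) O.

Definition occupation (t : R) : R := fine (mu (O `&` `[0, t]%classic)).

Let mOi (i : interval R) : @measurable _ (measurableTypeR R) (O `&` [set` i]).
Proof. by apply: measurableI => //; exact: measurable_itv. Qed.

Let muS (A B : set R) : @measurable _ (measurableTypeR R) A ->
  @measurable _ (measurableTypeR R) B -> A `<=` B -> (mu A <= mu B)%E.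
Proof. by move=> mA mB AB; apply: le_measure; rewrite ?inE. Qed.

Let finO (b0 b1 : bool) (x y : R) : mu (O `&` [set` Interval (BSide b0 x) (BSide b1 y)]) \is a fin_num.
Proof.
rewrite ge0_fin_numE//; apply: (@le_lt_trans _ _ (mu [set` Interval (BSide b0 x) (BSide b1 y)])).
  by apply: muS; [exact: mOi|exact: measurable_itv|exact: subIsetr].
by rewrite lebesgue_measure_itv/=; case: ifP => // _; rewrite ltry.
Qed.

Lemma occupationB (x y : R) : 0 <= x -> x <= y ->
  occupation y - occupation x = fine (mu (O `&` `]x, y]%classic)).
Proof.
move=> x0 xy; rewrite /occupation; apply/eqP; rewrite subr_eq addrC -fineD ?finO//.
apply/eqP; congr fine; rewrite -measureU; [|exact: mOi|exact: mOi|].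
  congr (mu _); rewrite -setIUr; congr (_ `&` _); apply/seteqP; split => s /=.
    rewrite !in_itv/= => /andP[s0 sy]; have [sx|xs] := leP s x; [left|right].
      by rewrite s0.
    by [].
  rewrite !in_itv/= => -[/andP[s0 sx]|/andP[xs ->]].
    by rewrite s0 (le_trans sx).
  by rewrite (le_trans x0 (ltW xs)).
apply/seteqP; split => s //=; rewrite !in_itv/= => -[[_ /andP[_ sx]] [_ /andP[xs _]]].
by move: sx; rewrite leNgt xs.
Qed.

Lemma occupation0 : occupation 0 = 0.
Proof.
apply/eqP; rewrite eq_le; apply/andP; split; last exact: fine_ge0.
rewrite -[leRHS]/(fine 0%:E); apply: fine_le; rewrite ?finO//.
apply: (@le_trans _ _ (mu [set (0 : R)])); last by rewrite lebesgue_measure_set1.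
apply: muS; [exact: mOi|exact: measurable_set1|].
by move=> s [_ /=]; rewrite in_itv/= -eq_le => /eqP.
Qed.

Lemma occupation_le (x y : R) : 0 <= x -> x <= y ->
  0 <= occupation y - occupation x <= y - x.
Proof.
move=> x0 xy; rewrite occupationB// fine_ge0//=.
have -> : y - x = fine (mu `]x, y]%classic).
  rewrite lebesgue_measure_itv/= lte_fin; case: ltP => // yx.
  by apply/eqP; rewrite subr_eq0 eq_le yx.
apply: fine_le; rewrite ?finO//.
  by rewrite lebesgue_measure_itv/=; case: ifP.
by apply: muS; [exact: mOi|exact: measurable_itv|exact: subIsetr].
Qed.

Lemma occupation_full (x y : R) : 0 <= x -> x <= y -> `]x, y[%classic `<=` O ->
  occupation y - occupation x = y - x.
Proof.
move=> x0 xy xyO; apply/eqP; rewrite eq_le.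
have /andP[_ ->] := occupation_le _ _ x0 xy; rewrite andTb occupationB//.
have -> : y - x = fine (mu `]x, y[%classic).
  rewrite lebesgue_measure_itv/= lte_fin; case: ltP => // yx.
  by apply/eqP; rewrite subr_eq0 eq_le yx.
apply: fine_le; rewrite ?finO//.
  by rewrite lebesgue_measure_itv/=; case: ifP.
apply: muS; [exact: measurable_itv|exact: mOi|].
move=> s xsy; split; first exact: xyO.
by move: xsy; rewrite /= !in_itv/= => /andP[-> /ltW ->].
Qed.

Lemma occupation_AC : absolutely_continuous 0 1 occupation.
Proof.
apply: (@AC_lipschitz _ _ _ _ 1) => x y x0 xy _; rewrite mul1r.
by have /andP[H1 H2] := occupation_le _ _ x0 xy; rewrite ger0_norm.
Qed.

Hypothesis O1 : O `<=` `[0, 1]%classic.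

Lemma occupation_derive :
  {ae mu, forall s : R, 0 < s < 1 -> is_derive s (1 : R) occupation (\1_O s)}.
Proof.
have iO : mu.-integrable setT (EFin \o (\1_O : R -> R)).
  apply: (le_integrable measurableT _ _ (integrable_indic_itv 0 1 true false)).
    by apply/measurable_EFinP; exact: measurable_indic.
  move=> s _; rewrite lee_fin !ger0_norm// !indicE.
  by have [/set_mem/O1/mem_set ->|//] := boolP (s \in O).
apply: (ae_imp _ _ _ (ae_derive_primitive _ iO)) => s H /andP[s0 _].
have -> : occupation = (fun y => (\int[mu]_(r in `[0%R, y]) (\1_O r))%R).
  apply/funext => y; rewrite /occupation /Rintegral integral_indic//.
exact: H.
Qed.

End Occupation.

(** * Lower bound on the action *)

Section LowerBound.
Context {R : realType}.
Local Notation mu := (@lebesgue_measure R).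
Local Notation AC := (absolutely_continuous 0 1).
Local Notation D := (`[0%R, 1%R]%classic : set R).
Variables (delta sigma : R).
Hypothesis (delta_gt0 : 0 < delta) (sigma_gt0 : 0 < sigma).

Lemma gaussian_rate_ge0 x : 0 <= gaussian_rate delta sigma x.
Proof. by apply: mulr_ge0; rewrite ?sqr_ge0// divr_ge0// mulr_ge0// sqr_ge0. Qed.

(** Staying at 0 costs nothing, because the drift is negative. *)
Lemma inf_gaussian_rate : inf (gaussian_rate delta sigma @` [set y | (y <= 0)%R]) = 0.
Proof.
have rd : gaussian_rate delta sigma (- delta) = 0.
  by rewrite /gaussian_rate addNr expr0n mulr0.
apply/eqP; rewrite eq_le; apply/andP; split.
  apply: ge_inf; first by exists 0 => _ [y _ <-]; exact: gaussian_rate_ge0.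
  by exists (- delta) => //=; rewrite oppr_le0 ltW.
apply: lb_le_inf; last by move=> _ [y _ <-]; exact: gaussian_rate_ge0.
by exists 0, (- delta) => //=; rewrite oppr_le0 ltW.
Qed.

Definition busy_set (psi : R -> R) : set R := [set s | 0 < s < 1 /\ 0 < psi s].

Lemma actionE psi : AC psi -> psi 0 = 0 -> action (gaussian_rate delta sigma) psi =
  (\int[mu]_(s in D) (gaussian_rate delta sigma (derive1 psi s) *
     \1_[set r | (0 < psi r)%R] s)%:E)%E.
Proof.
move=> ACpsi psi0; rewrite /action ifT; last exact/asboolP.
by apply: eq_integral => s _; rewrite inf_gaussian_rate mul0r addr0.
Qed.

Definition profile_slope (z l : R) : R := 3 * (z + delta / 2 * l ^+ 2) / l ^+ 3.

(** Height of the path of least energy, of area z and of total busy time l, after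
    a busy time u.  It solves profile' = profile_slope z l * (l - u) - delta. *)
Definition profile (z l u : R) : R :=
  profile_slope z l * (l * u - u ^+ 2 / 2) - delta * u.

Section Path.
Variables (psi : R -> R) (z : R).
Hypotheses (z0 : 0 < z) (AC_psi : AC psi) (psi0 : psi 0 = 0).
Hypotheses (psi_ge0 : forall t, 0 <= t <= 1 -> 0 <= psi t).
Hypothesis (psi_z : (\int[mu]_(s in D) (psi s)%:E)%E = z%:E).

Let O := busy_set psi.
Let tau := occupation O.
Let L := tau 1.
Let c := profile_slope z L.

Let mD : @measurable _ (measurableTypeR R) D. Proof. exact: measurable_itv. Qed.

Let mpsi : measurable_fun D psi. Proof. exact: AC_measurable. Qed.

Lemma measurable_busy_set : @measurable _ (measurableTypeR R) O.
Proof.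
have -> : O = `]0, 1[%classic `&` (D `&` psi @^-1` `]0, +oo[%classic).
  apply/seteqP; split => s; rewrite /O /busy_set /= !in_itv/= andbT.
    by move=> [/andP[s0 s1] p0]; rewrite s0 s1 !ltW.
  by move=> [s01 [_ p0]].
apply: measurableI; first exact: measurable_itv.
by apply: mpsi => //; exact: measurable_itv.
Qed.
Let mO := measurable_busy_set.

Let O1 : O `<=` `[0, 1]%classic.
Proof. by move=> s [/andP[s0 s1] _]; rewrite /= in_itv/= !ltW. Qed.

Let tau0 : tau 0 = 0. Proof. exact: occupation0. Qed.

Let ACtau : AC tau. Proof. exact: occupation_AC. Qed.

Let ae01 : {ae mu, forall s : R, D s -> 0 < s < 1}.
Proof.
apply: (ae_imp _ _ _ (ae_notin_finite [set 0; 1] (finite_set2 0 1))) => s.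
move=> /not_orP[/eqP s0 /eqP s1]; rewrite /= in_itv/= !le_eqVlt.
by rewrite (negbTE s1) eq_sym (negbTE s0).
Qed.

(** Otherwise psi would vanish almost everywhere, and so would its area. *)
Lemma busy_time_gt0 : 0 < L.
Proof.
have : 0 <= L.
  by have /andP[] := occupation_le _ mO _ _ (lexx 0) ler01; rewrite -/tau tau0 subr0.
rewrite le_eqVlt => /predU1P[L0|//].
have muO : mu O = 0%E.
  have finO : mu O \is a fin_num.
    rewrite ge0_fin_numE//; apply: (@le_lt_trans _ _ (mu D)).
      by apply: le_measure; rewrite ?inE.
    by rewrite lebesgue_measure_itv/= lte_fin ltr01 -EFinD ltry.
  rewrite -(fineK finO); congr EFin; rewrite [RHS]L0 /L /tau /occupation setIidl//.
have : (\int[mu]_(s in D) (psi s)%:E = \int[mu]_(s in D) (cst 0%E s))%E.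
  apply: ae_eq_integral => //; first exact/measurable_EFinP.
  have nO : {ae mu, forall s : R, ~ O s}.
    by exists O; split => // s /=; exact: contrapT.
  apply: (ae_imp2 _ _ _ _ nO ae01) => s Os s01 Ds; have {}s01 := s01 Ds.
  congr EFin; apply/eqP; rewrite eq_le psi_ge0; last by move: Ds; rewrite /= in_itv.
  by rewrite andbT leNgt; apply/negP => p0; apply: Os.
by rewrite psi_z integral0 => -[] z00; move: z0; rewrite z00 ltxx.
Qed.

Lemma busy_time_le1 : L <= 1.
Proof.
have /andP[_] := occupation_le _ mO _ _ (lexx 0) ler01.
by rewrite -/tau tau0 !subr0.
Qed.

Let c0 : 0 < c.
Proof.
have L0 := busy_time_gt0.
rewrite /c /profile_slope divr_gt0 ?exprn_gt0// mulr_gt0// ltr_wpDr//.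
by rewrite mulr_ge0 ?sqr_ge0// divr_ge0// ltW.
Qed.

(** Off the busy set psi is at its minimum 0, so its derivative vanishes
    wherever it exists: the energy is entirely spent on the busy set. *)
Lemma busy_derivatives : exists h : R -> R, measurable_fun D h /\
  {ae mu, forall s : R, 0 < s < 1 ->
    [/\ is_derive s (1 : R) psi (h s), is_derive s (1 : R) tau (\1_O s) &
     ~ O s -> psi s = 0 /\ h s = 0]}.
Proof.
have [h [ih _ dh]] := AC_FTC _ AC_psi; exists h; split.
  by apply: measurable_funTS; apply/measurable_EFinP; exact: measurable_int ih.
apply: (ae_imp2 _ _ _ _ dh (occupation_derive _ mO O1)) => s H1 H2 s01; split.
- exact: H1.
- exact: H2.
- move=> Os; have p0 : psi s = 0.
    apply/eqP; rewrite eq_le psi_ge0; last by case/andP: s01 => ? ?; rewrite !ltW.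
    by rewrite andbT leNgt; apply/negP => p0; apply: Os.
  split => //; apply: (is_derive_min _ _ _ (H1 s01)).
  case/andP: s01 => s0 s1; near=> t; rewrite p0 psi_ge0//.
  apply/andP; split; apply/ltW; near: t; [exact: lt_nbhsr|exact: lt_nbhsl].
Unshelve. all: by end_near. Qed.

Let a : R := 1 / (2 * sigma ^+ 2).

Let a_gt0 : 0 < a. Proof. by rewrite /a divr_gt0// mulr_gt0// exprn_gt0. Qed.

Section Derivative.
Variable h : R -> R.
Hypothesis mh : measurable_fun D h.
Hypothesis hE : {ae mu, forall s : R, 0 < s < 1 ->
    [/\ is_derive s (1 : R) psi (h s), is_derive s (1 : R) tau (\1_O s) &
     ~ O s -> psi s = 0 /\ h s = 0]}.

Let b (s : R) : R := c * (L - tau s).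
Let chi (s : R) : R := \1_O s.
(** q is the integrand of the action, r the defect in Cauchy-Schwarz, and p the
    part whose integral is known: up to a multiple of psi it is the derivative k
    of Phi below. *)
Let k (s : R) : R := a * (chi s * (2 * (h s + delta) * b s - b s * b s) - 2 * c * psi s).
Let p (s : R) : R := k s + 2 * a * c * psi s.
Let q (s : R) : R := gaussian_rate delta sigma (h s) * chi s.
Let r (s : R) : R := a * (chi s * ((h s + delta - b s) * (h s + delta - b s))).

Let qE s : q s = p s + r s.
Proof. by rewrite /q /p /k /r /gaussian_rate -/a; ring. Qed.

Let mchi : measurable_fun D chi.
Proof. by apply: measurable_funTS; exact: measurable_indic. Qed.

Let mb : measurable_fun D b.
Proof.
apply: measurable_funM; first exact: measurable_cst.
by apply: measurable_funB; [exact: measurable_cst|exact: AC_measurable].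
Qed.

Let mhd : measurable_fun D (fun s => h s + delta).
Proof. by apply: measurable_funD => //; exact: measurable_cst. Qed.

Let mk : measurable_fun D k.
Proof.
apply: measurable_funM; first exact: measurable_cst.
apply: measurable_funB.
  apply: measurable_funM => //; apply: measurable_funB; last exact: measurable_funM.
  by apply: measurable_funM => //; apply: measurable_funM => //; exact: measurable_cst.
by apply: measurable_funM => //; exact: measurable_cst.
Qed.

Let mr : measurable_fun D r.
Proof.
apply: measurable_funM; first exact: measurable_cst.
by apply: measurable_funM => //; apply: measurable_funM; apply: measurable_funB.
Qed.

Let mp : measurable_fun D p.
Proof.
by apply: measurable_funD => //; apply: measurable_funM => //; exact: measurable_cst.
Qed.

Let mq : measurable_fun D q.
Proof. by rewrite (_ : q = p \+ r); [exact: measurable_funD|apply/funext => s; exact: qE]. Qed.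

Let M (t : R) : R := L + -1 * tau t.
Let Phi (t : R) : R := a * (2 * c * (psi t * M t) + (- (delta * c)) * (M t * M t) +
  c ^+ 2 / 3 * (M t * (M t * M t))).

Let ACM : AC M. Proof. by apply: AC_add; [exact: AC_cst|exact: AC_scale]. Qed.

Let ACPhi : AC Phi.
Proof.
apply: AC_scale; apply: AC_add; first apply: AC_add.
- by apply: AC_scale; exact: AC_mul ler01 _ _.
- by apply: AC_scale; exact: AC_mul ler01 _ _.
- by apply: AC_scale; apply: (AC_mul _ _ _ _ ler01) => //; exact: AC_mul ler01 _ _.
Qed.

Let dPhi : {ae mu, forall s : R, 0 < s < 1 -> is_derive s (1 : R) Phi (k s)}.
Proof.
apply: (ae_imp _ _ _ hE) => s H /H[dpsi dtau Os].
have dM : is_derive s (1 : R) M (0 + -1 * chi s).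
  by apply: is_derive_addf; exact: is_derive_scalef.
have dMM := is_derive_mulf _ _ _ _ _ dM dM.
have dMMM := is_derive_mulf _ _ _ _ _ dM dMM.
have := is_derive_scalef _ _ _ a (is_derive_addf _ _ _ _ _ (is_derive_addf _ _ _ _ _
  (is_derive_scalef _ _ _ (2 * c) (is_derive_mulf _ _ _ _ _ dpsi dM))
  (is_derive_scalef _ _ _ (- (delta * c)) dMM)) (is_derive_scalef _ _ _ (c ^+ 2 / 3) dMMM)).
move=> H1; apply: (is_derive_eq H1).
have bE : b s = c * M s by rewrite /b /M mulN1r.
rewrite /k bE; have [Os1|Os1] := pselect (O s).
  by rewrite /chi indicE mem_set//=; field.
have [-> ->] := Os Os1.
by rewrite /chi indicE memNset//=; ring.
Qed.

Let ipsi : mu.-integrable D (EFin \o psi).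
Proof.
apply: continuous_compact_integrable; first exact: segment_compact.
exact: AC_within_continuous ltr01 AC_psi.
Qed.

Let icpsi : mu.-integrable D (EFin \o (fun s => 2 * a * c * psi s)).
Proof.
have := integrableZl mD (2 * a * c) ipsi.
by apply: eq_integrable => // s _; rewrite /= EFinM.
Qed.

Let ip : mu.-integrable D (EFin \o p).
Proof.
have [ik _] := AC_integral_derive _ _ ACPhi mk dPhi.
apply: (@integrableD _ _ _ mu D mD (EFin \o k) (EFin \o (fun s => 2 * a * c * psi s))).
- exact: ik.
- exact: icpsi.
Qed.

Lemma busy_costE : busy_cost delta sigma z L = a * c * (z + delta / 2 * L ^+ 2).
Proof.
rewrite /busy_cost /a /c /profile_slope; field.
by rewrite !gt_eqF// busy_time_gt0.
Qed.

(** Phi vanishes at 1, where no busy time remains, and Phi 0 only involves L. *)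
Let intp : (\int[mu]_(s in D) (p s)%:E)%E = (busy_cost delta sigma z L)%:E.
Proof.
have [ik kE] := AC_integral_derive _ _ ACPhi mk dPhi.
rewrite (_ : (\int[mu]_(s in D) (p s)%:E)%E =
  (\int[mu]_(s in D) (k s)%:E + \int[mu]_(s in D) (2 * a * c * psi s)%:E)%E); last first.
  by rewrite -(integralD mD ik icpsi).
rewrite kE ?ler01 ?lexx//.
under eq_integral do rewrite EFinM.
rewrite integralZl//.
rewrite psi_z -EFinM -EFinD; congr EFin.
have M1 : M 1 = 0 by rewrite /M mulN1r subrr.
have M0 : M 0 = L by rewrite /M mulN1r tau0 subr0.
rewrite busy_costE /Phi M1 M0 psi0 /c /profile_slope.
by field; rewrite gt_eqF// busy_time_gt0.
Qed.

Let q_ge0 s : 0 <= q s.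
Proof. by apply: mulr_ge0; [exact: gaussian_rate_ge0|rewrite /chi indicE]. Qed.

Let r_ge0 s : 0 <= r s.
Proof.
apply: mulr_ge0; first exact: ltW.
by apply: mulr_ge0; [rewrite /chi indicE|rewrite -expr2 sqr_ge0].
Qed.

Let q_action : (\int[mu]_(s in D) (q s)%:E <= action (gaussian_rate delta sigma) psi)%E.
Proof.
rewrite actionE//; apply: ae_le_integral_measurablel => //.
- exact/measurable_EFinP.
- by move=> s _; rewrite lee_fin.
- by move=> s _; rewrite lee_fin mulr_ge0// gaussian_rate_ge0.
apply: (ae_imp2 _ _ _ _ hE ae01) => s H H01 Ds; have s01 := H01 Ds.
have [dpsi _ _] := H s01.
rewrite (is_derive_derive1 _ _ _ dpsi) lee_fin /q /chi.
rewrite (_ : \1_O s = \1_[set r0 | 0 < psi r0] s)// !indicE; congr (_%:R).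
have [ps|ps] := boolP (s \in [set r0 | 0 < psi r0]).
  by rewrite mem_set//; split => //; move/set_mem: ps.
by rewrite memNset// => -[_ ps']; move/negP: ps; apply; exact: mem_set.
Qed.

Let q_split : (\int[mu]_(s in D) (q s)%:E < +oo)%E ->
  (\int[mu]_(s in D) (q s)%:E =
   (busy_cost delta sigma z L)%:E + \int[mu]_(s in D) (r s)%:E)%E.
Proof.
move=> qfin.
have iq : mu.-integrable D (EFin \o q).
  apply/integrableP; split; first exact/measurable_EFinP.
  by under eq_integral => s _ do rewrite /= ger0_norm//.
have ir : mu.-integrable D (EFin \o r).
  have := integrableB mD iq ip; apply: eq_integrable => // s _ /=.
  by rewrite qE -EFinB addrC addKr.
rewrite -intp -(integralD mD ip ir); apply: eq_integral => s _.
by rewrite qE.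
Qed.

Lemma busy_cost_le_action_derivative :
  ((busy_cost delta sigma z L)%:E <= action (gaussian_rate delta sigma) psi)%E.
Proof.
apply: le_trans q_action.
have [qfin|] := ltP (\int[mu]_(s in D) (q s)%:E)%E +oo%E; last first.
  by rewrite leye_eq => /eqP ->; rewrite leey.
rewrite q_split//; apply: leeDl; apply: integral_ge0 => s _.
by rewrite lee_fin.
Qed.

(** If the defect r vanishes, psi and its candidate profile have the same
    derivative almost everywhere and the same value at 0. *)
Let E (t : R) : R := psi t + (-1) * (c * (L * tau t + (- 2^-1) * (tau t * tau t)) +
   (- delta) * tau t).

Let ACE : AC E.
Proof.
apply: AC_add => //; apply: AC_scale; apply: AC_add; last exact: AC_scale.
apply: AC_scale; apply: AC_add; first exact: AC_scale.
by apply: AC_scale; exact: AC_mul ler01 _ _.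
Qed.

Lemma minimal_action_profile_derivative :
  (action (gaussian_rate delta sigma) psi <= (busy_cost delta sigma z L)%:E)%E ->
  forall t, 0 <= t <= 1 -> psi t = profile z L (tau t).
Proof.
move=> action_le.
have qle := le_trans q_action action_le.
have qfin : (\int[mu]_(s in D) (q s)%:E < +oo)%E by apply: le_lt_trans qle _; rewrite ltry.
have r0 : (\int[mu]_(s in D) (r s)%:E = 0)%E.
  apply/eqP; rewrite eq_le; apply/andP; split; last first.
    by apply: integral_ge0 => s _; rewrite lee_fin.
  by move: qle; rewrite q_split// -[leRHS]adde0 leeD2lE.
have ae_r : {ae mu, forall s : R, D s -> (r s)%:E = 0%E}.
  have mEr : measurable_fun D (EFin \o r) by exact/measurable_EFinP.
  have := (ae_eq_integral_abs mu mD mEr).1; apply.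
  by rewrite -[RHS]r0; apply: eq_integral => s _; rewrite gee0_abs ?lee_fin.
have dE : {ae mu, forall s : R, 0 < s < 1 -> is_derive s (1 : R) E 0}.
  apply: (ae_imp2 _ _ _ _ hE ae_r) => s H Hr s01; have [dpsi dtau Os] := H s01.
  have dtt := is_derive_mulf _ _ _ _ _ dtau dtau.
  have := is_derive_addf _ _ _ _ _ dpsi (is_derive_scalef _ _ _ (-1)
    (is_derive_addf _ _ _ _ _ (is_derive_scalef _ _ _ c
     (is_derive_addf _ _ _ _ _ (is_derive_scalef _ _ _ L dtau)
       (is_derive_scalef _ _ _ (- 2^-1) dtt))) (is_derive_scalef _ _ _ (- delta) dtau))).
  move=> H1; apply: (is_derive_eq H1).
  have : r s = 0.
    by apply: EFin_inj; apply: Hr; case/andP: s01 => ? ?; rewrite /= in_itv/= !ltW.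
  rewrite /r /chi; have [Os1|Os1] := pselect (O s).
    rewrite indicE mem_set//= mul1r => /eqP; rewrite mulf_eq0 (gt_eqF a_gt0)/=.
    rewrite mulf_eq0 orbb /b => /eqP br.
    by rewrite -[RHS]br; field.
  by move=> _; have [_ ->] := Os Os1; rewrite indicE memNset//=; ring.
move=> t t01.
have m0 : measurable_fun D (fun=> 0 : R) by exact: measurable_cst.
have [_ /(_ t t01)] := AC_integral_derive _ _ ACE m0 dE.
rewrite integral0 => E0.
have : E t = E 0 by apply/eqP; rewrite -subr_eq0 -eqe -E0.
rewrite /E psi0 tau0 => Et; 
have -> : psi t = c * (L * tau t + - 2^-1 * (tau t * tau t)) + - delta * tau t.
  by apply/eqP; rewrite -subr_eq0 -mulN1r Et; apply/eqP; ring.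
by rewrite /profile -/c; field.
Qed.

End Derivative.

(** The defect in Cauchy-Schwarz has a nonnegative integral, and the rest of the
    action is exactly the busy cost. *)
Lemma busy_cost_le_action :
  ((busy_cost delta sigma z L)%:E <= action (gaussian_rate delta sigma) psi)%E.
Proof.
by have [h [mh hE]] := busy_derivatives; exact: busy_cost_le_action_derivative mh hE.
Qed.

(** Equality in Cauchy-Schwarz determines psi as a function of its own occupation
    time. *)
Lemma minimal_action_profile :
  (action (gaussian_rate delta sigma) psi <= (busy_cost delta sigma z L)%:E)%E ->
  forall t, 0 <= t <= 1 -> psi t = profile z L (tau t).
Proof.
by have [h [mh hE]] := busy_derivatives; exact: minimal_action_profile_derivative mh hE.
Qed.

End Path.
End LowerBound.

(** * Paths with a single busy interval *)

Section Clamp.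
Context {R : realType}.
Local Notation mu := (@lebesgue_measure R).
Local Notation AC := (absolutely_continuous 0 1).
Local Notation D := (`[0%R, 1%R]%classic : set R).
Variables (T0 L : R).
Hypotheses (L0 : 0 < L).

(** Occupation time at t of a path whose busy interval is ]T0, T0 + L[. *)
Definition clamp (t : R) : R := Num.max 0 (Num.min (t - T0) L).

Lemma clamp_before t : t <= T0 -> clamp t = 0.
Proof. by move=> tT; rewrite /clamp max_l// ge_min subr_le0 tT. Qed.

Lemma clamp_after t : T0 + L <= t -> clamp t = L.
Proof. by move=> tT; rewrite /clamp min_r ?max_r ?(ltW L0)// lerBrDl. Qed.

Lemma clamp_inside t : T0 <= t <= T0 + L -> clamp t = t - T0.
Proof.
by case/andP=> T0t tT; rewrite /clamp min_l ?max_r ?subr_ge0// lerBlDl.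
Qed.

Lemma clamp_range t : 0 <= clamp t <= L.
Proof. by rewrite /clamp le_max lexx ge_max (ltW L0) ge_min lexx orbT. Qed.

Lemma clamp_AC : AC clamp.
Proof.
apply: (@AC_lipschitz _ _ _ _ 1) => x y _ xy _; rewrite mul1r.
have [xT|xT] := leP x T0.
  rewrite (clamp_before _ xT) subr0 ger0_norm; last by case/andP: (clamp_range y).
  by rewrite /clamp ge_max subr_ge0 xy ge_min lerB.
have [yT|yT] := leP y (T0 + L); last first.
  have [xL|xL] := leP x (T0 + L).
    rewrite (clamp_after _ (ltW yT)) clamp_inside; last by rewrite xL ltW.
    by rewrite ger0_norm; lra.
  by rewrite !clamp_after ?subrr ?normr0 ?subr_ge0// ltW.
rewrite !clamp_inside; [|by rewrite (ltW xT) (le_trans xy)|by rewrite yT (le_trans (ltW xT))].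
by rewrite ger0_norm; lra.
Qed.

Lemma clamp_derive (s : R) : s != T0 -> s != T0 + L ->
  is_derive s (1 : R) clamp (\1_(`]T0, T0 + L[%classic : set R) s).
Proof.
move=> sT sL; case: (ltgtP s T0) sT => // [sT|Ts] _.
  rewrite indicE memNset/=; last by rewrite in_itv/= => /andP[/lt_trans/(_ sT)]; rewrite ltxx.
  apply: (near_eq_is_derive _ (is_derive_cst (0 : R) s 1)).
  by near=> t; rewrite clamp_before//; apply/ltW; near: t; exact: lt_nbhsl.
case: (ltgtP s (T0 + L)) sL => // [sL|Ls] _; last first.
  rewrite indicE memNset/=; last by rewrite in_itv/= => /andP[_ /(lt_trans Ls)]; rewrite ltxx.
  apply: (near_eq_is_derive _ (is_derive_cst (L : R) s 1)).
  by near=> t; rewrite clamp_after//; apply/ltW; near: t; exact: lt_nbhsr.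
rewrite indicE mem_set/= ?in_itv/= ?Ts//.
have := is_deriveB (is_derive_id s (1 : R)) (is_derive_cst (T0 : R) s 1).
rewrite subr0; apply: near_eq_is_derive.
near=> t; rewrite clamp_inside//; apply/andP; split; apply/ltW; near: t.
  exact: lt_nbhsr.
exact: lt_nbhsl.
Unshelve. all: by end_near. Qed.

Lemma clamp_ae_derive :
  {ae mu, forall s : R, [/\ s != T0, s != T0 + L &
    is_derive s (1 : R) clamp (\1_(`]T0, T0 + L[%classic : set R) s)]}.
Proof.
apply: (ae_imp _ _ _ (ae_notin_finite [set T0; T0 + L] (finite_set2 _ _))) => s.
by move=> /not_orP[/eqP s0 /eqP s1]; split => //; exact: clamp_derive.
Qed.

End Clamp.

Section Attained.
Context {R : realType}.
Local Notation mu := (@lebesgue_measure R).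
Local Notation AC := (absolutely_continuous 0 1).
Local Notation D := (`[0%R, 1%R]%classic : set R).
Variables (delta sigma : R).
Hypothesis (delta_gt0 : 0 < delta) (sigma_gt0 : 0 < sigma).
Variables (z : R) (T0 : R) (psi : R -> R).
Hypothesis z0 : 0 < z.
Let L := busy_length delta z.
Hypotheses (T00 : 0 <= T0) (T01 : T0 + L <= 1).
Let kappa := clamp T0 L.
Let c := profile_slope delta z L.
Hypothesis psiE : forall t, 0 <= t <= 1 -> psi t = profile delta z L (kappa t).

Let L0 : 0 < L. Proof. exact: busy_length_gt0. Qed.

Let L1 : L <= 1. Proof. exact: busy_length_le1. Qed.

Let cE : c * L ^+ 3 = 3 * (z + delta / 2 * L ^+ 2).
Proof. by rewrite /c /profile_slope divfK// expf_neq0// gt_eqF. Qed.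

(** Equivalent to 2 * delta <= c * L, which makes the profile nonnegative. *)
Let L2 : delta * L ^+ 2 <= 6 * z.
Proof.
have LS : L <= Num.sqrt (6 * z / delta) by rewrite /L /busy_length ge_min lexx orbT.
have zE := sqrt_param _ delta_gt0 z (ltW z0).
have L2S : L ^+ 2 <= Num.sqrt (6 * z / delta) ^+ 2.
  by rewrite ler_sqr ?nnegrE ?sqrtr_ge0// ltW.
have := ler_wpM2l (ltW delta_gt0) L2S; rewrite [in leRHS](_ : delta * _ = 6 * z)//.
by rewrite [in RHS]zE; field.
Qed.

Let cL : 2 * delta <= c * L.
Proof.
have L3 : 0 < L ^+ 2 by rewrite exprn_gt0.
rewrite -(ler_pM2r L3) (_ : c * L * L ^+ 2 = c * L ^+ 3); last by ring.
by rewrite cE; have := L2; lra.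
Qed.

Let profile0 : profile delta z L 0 = 0.
Proof. by rewrite /profile !(mulr0, expr0n)/= !(mul0r, subr0, mulr0). Qed.

(** If the busy interval is shorter than [0, 1], the profile has come back to 0 at
    its end, and the path can stay there. *)
Let profile_end : L < 1 -> profile delta z L L = 0.
Proof.
rewrite {1}/L /busy_length gt_min ltxx/= => S1.
have LE : L = Num.sqrt (6 * z / delta) by rewrite /L /busy_length min_r// ltW.
have zE := sqrt_param _ delta_gt0 z (ltW z0); rewrite -LE in zE.
have cLE : c * L = 2 * delta.
  by rewrite /c /profile_slope [in LHS]zE; field; rewrite gt_eqF.
rewrite /profile -/c (_ : _ - _ = L * (c * L / 2 - delta)); last by field.
by rewrite cLE; field.
Qed.

Let profile_ge0 u : 0 <= u <= L -> 0 <= profile delta z L u.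
Proof.
case/andP=> u0 uL; rewrite /profile -/c.
rewrite (_ : _ - _ = u * (c * L - delta - c * u / 2)); last by field.
have c0 : 0 <= c.
  by rewrite -(pmulr_lge0 _ L0) (le_trans _ cL)// mulr_ge0// ltW.
by apply: mulr_ge0 => //; have := ler_wpM2l c0 uL; have := cL; lra.
Qed.

Let AC_kappa : AC kappa. Proof. exact: clamp_AC. Qed.

Let G (t : R) : R := c * (L * kappa t + (- 2^-1) * (kappa t * kappa t)) +
   (- delta) * kappa t.

Let GE t : G t = profile delta z L (kappa t).
Proof. by rewrite /G /profile -/c; field. Qed.

Lemma profile_path_AC : AC psi.
Proof.
apply: (@AC_eq _ _ _ G); first by move=> t t01; rewrite GE psiE.
apply: AC_add; last exact: AC_scale.
apply: AC_scale; apply: AC_add; first exact: AC_scale.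
by apply: AC_scale; exact: AC_mul ler01 _ _.
Qed.

Lemma profile_path0 : psi 0 = 0.
Proof. by rewrite psiE ?lexx ?ler01// /kappa clamp_before. Qed.

Lemma profile_path_ge0 t : 0 <= t <= 1 -> 0 <= psi t.
Proof. by move=> t01; rewrite psiE// profile_ge0// clamp_range. Qed.

Let I : set R := `]T0, T0 + L[%classic.

Let outside s : 0 < s < 1 -> s != T0 -> s != T0 + L -> ~ I s -> psi s = 0.
Proof.
move=> /andP[s0 s1] sT sL Is; rewrite psiE ?(ltW s0) ?(ltW s1)//.
case: (ltgtP s T0) sT => // [sT|Ts] _; first by rewrite /kappa clamp_before// ltW.
case: (ltgtP s (T0 + L)) sL => // [sL|Ls] _.
  by exfalso; apply: Is; rewrite /I /= in_itv/= Ts.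
rewrite /kappa clamp_after ?profile_end//; last exact: ltW.
by apply: le_lt_trans s1; apply: le_trans (ltW Ls); rewrite lerDr.
Qed.

Let ae_kappa := clamp_ae_derive T0 L L0.

(** The primitive of the profile, composed with the occupation time. *)
Let Fint (t : R) : R := c * (L / 2 * (kappa t * kappa t) +
   (- 6^-1) * (kappa t * (kappa t * kappa t))) + (- (delta / 2)) * (kappa t * kappa t).

Let kappa0 : kappa 0 = 0. Proof. by rewrite /kappa clamp_before. Qed.

Let kappa1 : kappa 1 = L. Proof. by rewrite /kappa clamp_after. Qed.

Lemma profile_path_integral : (\int[mu]_(s in D) (psi s)%:E)%E = z%:E.
Proof.
have ACF : AC Fint.
  have ACkk := AC_mul _ _ _ _ ler01 AC_kappa AC_kappa.
  apply: AC_add; last exact: AC_scale.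
  apply: AC_scale; apply: AC_add; first exact: AC_scale.
  by apply: AC_scale; exact: AC_mul ler01 _ _.
have dF : {ae mu, forall s : R, 0 < s < 1 -> is_derive s (1 : R) Fint (psi s)}.
  apply: (ae_imp _ _ _ ae_kappa) => s [sT sL dk] s01.
  have dkk := is_derive_mulf _ _ _ _ _ dk dk.
  have dkkk := is_derive_mulf _ _ _ _ _ dk dkk.
  have := is_derive_addf _ _ _ _ _ (is_derive_scalef _ _ _ c
    (is_derive_addf _ _ _ _ _ (is_derive_scalef _ _ _ (L / 2) dkk)
      (is_derive_scalef _ _ _ (- 6^-1) dkkk))) (is_derive_scalef _ _ _ (- (delta / 2)) dkk).
  move=> H; apply: (is_derive_eq H).
  have [Is|Is] := pselect (I s).
    rewrite indicE mem_set//= psiE -?GE /G -/kappa; last by case/andP: s01 => *; rewrite !ltW.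
    by field.
  by rewrite outside// indicE memNset//= !(mulr0, mul0r, addr0).
have [_ /(_ 1)] := AC_integral_derive _ _ ACF (AC_measurable _ profile_path_AC) dF.
rewrite ler01 lexx => ->//; congr EFin.
rewrite /Fint kappa1 kappa0 -[RHS](_ : c * L ^+ 3 / 3 - delta / 2 * L ^+ 2 = z).
  by field.
by rewrite cE; field.
Qed.

Lemma profile_path_admissible : admissible z psi.
Proof.
split.
- exact: profile_path_ge0.
- exact/AC_cadlag/profile_path_AC.
- exact: AC_bounded_variation ler01 profile_path_AC.
- exact: profile_path_integral.
Qed.

Let a : R := 1 / (2 * sigma ^+ 2).

Let k (s : R) : R := a * c ^+ 2 * ((L + -1 * kappa s) * (L + -1 * kappa s)) * \1_I s.

Lemma profile_path_action :
  (action (gaussian_rate delta sigma) psi <= (Wbar_rate delta sigma z)%:E)%E.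
Proof.
have a0 : 0 < a by rewrite /a divr_gt0// mulr_gt0// exprn_gt0.
rewrite (actionE _ _ delta_gt0)//; [|exact: profile_path_AC|exact: profile_path0].
have ACM : AC (fun t => L + -1 * kappa t) by apply: AC_add; [exact: AC_cst|exact: AC_scale].
pose M (t : R) : R := L + -1 * kappa t.
(* a primitive of the energy, a * c ^+ 2 times the square of the remaining busy
   time *)
pose Q (t : R) : R := (- (a * c ^+ 2 / 3)) * (M t * (M t * M t)).
have ACQ : AC Q.
  by apply: AC_scale; apply: AC_mul ler01 _ _ => //; exact: AC_mul ler01 _ _.
have mk : measurable_fun D k.
  apply: measurable_funM; last by apply: measurable_funTS; apply: measurable_indic; exact: measurable_itv.
  apply: measurable_funM; first exact: measurable_cst.
  by apply: measurable_funM; exact: AC_measurable.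
have dQ : {ae mu, forall s : R, 0 < s < 1 -> is_derive s (1 : R) Q (k s)}.
  apply: (ae_imp _ _ _ ae_kappa) => s [sT sL dk] s01.
  have dM : is_derive s (1 : R) M (0 + -1 * \1_I s).
    by apply: is_derive_addf; exact: is_derive_scalef.
  have dMMM := is_derive_mulf _ _ _ _ _ dM (is_derive_mulf _ _ _ _ _ dM dM).
  have H := is_derive_scalef _ _ _ (- (a * c ^+ 2 / 3)) dMMM.
  by apply: (is_derive_eq H); rewrite /k -/(M s); field.
have k0 s : 0 <= k s.
  apply: mulr_ge0; last by rewrite indicE.
  by apply: mulr_ge0; [apply: mulr_ge0; [exact: ltW|exact: sqr_ge0]|rewrite -expr2 sqr_ge0].
have [_ /(_ 1)] := AC_integral_derive _ _ ACQ mk dQ.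
rewrite ler01 lexx => /(_ isT) kE.
rewrite (_ : Wbar_rate delta sigma z = Q 1 - Q 0) -?kE; last first.
  rewrite (rate_busy_length _ _ delta_gt0 sigma_gt0)// -/L /busy_cost.
  rewrite /Q /M kappa1 kappa0 /a /c /profile_slope; field.
  by rewrite !gt_eqF.
apply: ae_le_integral_measurabler => //.
- exact/measurable_EFinP.
- by move=> s _; rewrite lee_fin mulr_ge0 ?gaussian_rate_ge0// indicE.
- by move=> s _; rewrite lee_fin.
have dpsi : {ae mu, forall s : R, 0 < s < 1 -> [/\ s != T0, s != T0 + L &
    is_derive s (1 : R) psi (c * (L * \1_I s - kappa s * \1_I s) - delta * \1_I s)]}.
  apply: (ae_imp _ _ _ ae_kappa) => s [sT sL dk] /andP[s0 s1]; split => //.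
  have dG : is_derive s (1 : R) G (c * (L * \1_I s - kappa s * \1_I s) - delta * \1_I s).
    have dkk := is_derive_mulf _ _ _ _ _ dk dk.
    have H := is_derive_addf _ _ _ _ _ (is_derive_scalef _ _ _ c
     (is_derive_addf _ _ _ _ _ (is_derive_scalef _ _ _ L dk)
       (is_derive_scalef _ _ _ (- 2^-1) dkk))) (is_derive_scalef _ _ _ (- delta) dk).
    by apply: (is_derive_eq H); rewrite -/kappa -/I; field.
  apply: (near_eq_is_derive _ dG).
  near=> t; rewrite GE psiE//; apply/andP; split; apply/ltW; near: t.
    exact: lt_nbhsr.
  exact: lt_nbhsl.
apply: (ae_imp2 _ _ _ _ (ae_notin_finite [set 0; 1] (finite_set2 0 1)) dpsi) => s.
move=> /not_orP[/eqP s0 /eqP s1] H; rewrite /= in_itv/= => s01.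
have {}s01 : 0 < s < 1 by case/andP: s01 => s0' s1'; rewrite !lt_neqAle s0' s1' eq_sym s0 s1.
have [sT sL dps] := H s01; rewrite (is_derive_derive1 _ _ _ dps) lee_fin.
have [Is|Is] := pselect (I s).
  rewrite /k /gaussian_rate -/a !(@indicE _ _ I) mem_set//= !mulr1.
  rewrite (_ : _ + delta = c * (L + -1 * kappa s)); last by ring.
  apply: (@le_trans _ _ (a * (c * (L + -1 * kappa s)) ^+ 2 * 1)); last first.
    by rewrite le_eqVlt; apply/orP; left; apply/eqP; ring.
  apply: ler_wpM2l; first by apply: mulr_ge0; [exact: ltW|exact: sqr_ge0].
  by rewrite indicE lern1 leq_b1.
rewrite [\1_[set r | 0 < psi r] s]indicE memNset/= ?mulr0 ?k0//.
by rewrite outside// ltxx.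
Unshelve. all: by end_near. Qed.

End Attained.

(** * Minimizers of the action *)

Section Minimizers.
Context {R : realType}.
Local Notation mu := (@lebesgue_measure R).
Local Notation AC := (absolutely_continuous 0 1).
Variables (delta sigma : R).
Hypothesis (delta_gt0 : 0 < delta) (sigma_gt0 : 0 < sigma).

(** A competitor, known to be optimal, used to bound the action of minimizers. *)
Let path (z t : R) : R :=
  profile delta z (busy_length delta z) (clamp 0 (busy_length delta z) t).

Lemma action_lower_bound z psi : 0 < z -> admissible z psi ->
  ((Wbar_rate delta sigma z)%:E <= action (gaussian_rate delta sigma) psi)%E.
Proof.
move=> z0 [psi_ge0 _ _ psiz]; have [[ACpsi psi0]|H] :=
  pselect (AC psi /\ psi 0 = 0); last first.
  by rewrite /action ifF ?leey//; apply/negbTE/negP => /asboolP.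
apply: le_trans (busy_cost_le_action _ _ delta_gt0 sigma_gt0 _ _ z0 ACpsi psi0 psi_ge0 psiz).
rewrite lee_fin; apply: rate_le_busy_cost => //; first exact: ltW.
rewrite (busy_time_gt0 _ _ z0 ACpsi psi_ge0 psiz).
exact: busy_time_le1 ACpsi.
Qed.

Lemma most_likely_path_action z psi : 0 < z ->
  most_likely_path (gaussian_rate delta sigma) z psi <->
  admissible z psi /\
    (action (gaussian_rate delta sigma) psi <= (Wbar_rate delta sigma z)%:E)%E.
Proof.
move=> z0; split=> -[adm H]; split => //.
  have L1 := busy_length_le1 delta z.
  apply: (@le_trans _ _ (action (gaussian_rate delta sigma) (path z))).
    apply: H; apply: (profile_path_admissible _ delta_gt0 z 0) => //.
    by rewrite add0r.
  by apply: (profile_path_action _ _ delta_gt0 sigma_gt0 z 0) => //; rewrite add0r.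
by move=> phi adm'; apply: le_trans H _; exact: action_lower_bound.
Qed.

Lemma most_likely_path_profile z T0 psi : 0 < z -> 0 <= T0 ->
  T0 + busy_length delta z <= 1 ->
  (forall t, 0 <= t <= 1 ->
    psi t = profile delta z (busy_length delta z) (clamp T0 (busy_length delta z) t)) ->
  most_likely_path (gaussian_rate delta sigma) z psi.
Proof.
move=> z0 T00 T01 psiE; apply/most_likely_path_action => //; split.
  exact: (profile_path_admissible _ delta_gt0 z T0).
exact: (profile_path_action _ _ delta_gt0 sigma_gt0 z T0).
Qed.

(** A minimizer achieves equality both in Cauchy-Schwarz and in the optimization
    over the busy time. *)
Lemma most_likely_path_occupation z psi : 0 < z ->
  most_likely_path (gaussian_rate delta sigma) z psi ->
  let tau := occupation (busy_set psi) in
  [/\ @measurable _ (measurableTypeR R) (busy_set psi), tau 1 = busy_length delta z &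
   forall t, 0 <= t <= 1 -> psi t = profile delta z (busy_length delta z) (tau t)].
Proof.
move=> z0 /(most_likely_path_action _ _ z0)[[psi_ge0 _ _ psiz] le_rate] tau.
have [[ACpsi psi0]|H] := pselect (AC psi /\ psi 0 = 0); last first.
  by move: le_rate; rewrite /action ifF//; apply/negbTE/negP => /asboolP.
have L0 := busy_time_gt0 _ _ z0 ACpsi psi_ge0 psiz.
have L1 := busy_time_le1 _ ACpsi.
have le_cost := busy_cost_le_action _ _ delta_gt0 sigma_gt0 _ _ z0 ACpsi psi0 psi_ge0 psiz.
have L01 : 0 < tau 1 <= 1 by rewrite L0.
have rate_cost := rate_le_busy_cost _ _ delta_gt0 sigma_gt0 z _ (ltW z0) L01.
have tau1 : tau 1 = busy_length delta z.
  apply: busy_cost_eq_rate sigma_gt0 _ _ z0 L01 _ => //.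
  apply/eqP; rewrite eq_le rate_cost/= -lee_fin; exact: le_trans le_cost le_rate.
split => //; first exact: measurable_busy_set.
rewrite -tau1; apply: minimal_action_profile delta_gt0 sigma_gt0 _ _ z0 ACpsi psi0 psi_ge0 psiz _.
by apply: (le_trans le_rate); rewrite lee_fin.
Qed.

Lemma full_pathE z t : full_path delta z t = profile delta z 1 t.
Proof. by rewrite /full_path /profile /profile_slope; field. Qed.

(** A busy time equal to 1 leaves no room for idleness: tau is 1-Lipschitz, with
    tau 0 = 0 and tau 1 = 1. *)
Lemma most_likely_full_path z psi : delta / 6 <= z ->
  most_likely_path (gaussian_rate delta sigma) z psi <->
  forall t : R, 0 <= t <= 1 -> psi t = full_path delta z t.
Proof.
move=> z1; have z0 : 0 < z by apply: lt_le_trans z1; rewrite divr_gt0.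
have LE := busy_length_large _ delta_gt0 z z1; split; last first.
  move=> psiE; apply: (most_likely_path_profile z 0) => //; first by rewrite LE add0r.
  by move=> t t01; rewrite psiE// full_pathE LE clamp_inside ?add0r ?subr0.
move=> /(most_likely_path_occupation _ _ z0)[mO tau1 psiE] t t01.
rewrite psiE// full_pathE LE; congr profile.
case/andP: t01 => t0 t1; rewrite LE in tau1.
have /andP[_ H0] := occupation_le _ mO _ _ (lexx 0) t0.
have /andP[_ H1] := occupation_le _ mO _ _ t0 t1.
by move: H0 H1; rewrite occupation0// tau1; lra.
Qed.

Lemma profile_pos z u : 0 < z <= delta / 6 -> 0 < u < busy_length delta z ->
  0 < profile delta z (busy_length delta z) u.
Proof.
case/andP=> z0 z1 /andP[u0 uL]; have LE := busy_length_small _ delta_gt0 z.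
rewrite (ltW z0) z1 in LE; have {}LE := LE isT.
have zE := sqrt_param _ delta_gt0 z (ltW z0); rewrite -LE in zE.
move: zE uL; set L := busy_length delta z => zE uL.
have L0 : 0 < L := lt_trans u0 uL.
rewrite /profile /profile_slope.
rewrite (_ : _ - _ = delta * u * (L - u) / L); last first.
  by rewrite [in LHS]zE; field; rewrite gt_eqF.
by rewrite divr_gt0// !mulr_gt0// subr_gt0.
Qed.

Lemma excursion_pathE z T0 t : 0 < z <= delta / 6 ->
  excursion_path delta z T0 t =
  profile delta z (busy_length delta z) (clamp T0 (busy_length delta z) t).
Proof.
case/andP=> z0 z1; have LE := busy_length_small _ delta_gt0 z.
rewrite (ltW z0) z1 in LE; have {}LE := LE isT.
have zE := sqrt_param _ delta_gt0 z (ltW z0); rewrite -LE in zE.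
have L0 := busy_length_gt0 _ delta_gt0 z z0.
have SV : Num.sqrt (delta / (6 * z)) = (busy_length delta z)^-1.
  by rewrite LE -sqrtrV ?divr_ge0 ?mulr_ge0 ?(ltW z0) ?(ltW delta_gt0)// invf_div.
rewrite /excursion_path -LE SV; move: zE L0; set L := busy_length delta z => zE L0.
have pE u : profile delta z L u = delta * u - delta * L^-1 * u ^+ 2.
  by rewrite /profile /profile_slope [in LHS]zE; field; rewrite gt_eqF.
case: ifPn => [tT|]; first by rewrite clamp_inside// pE.
rewrite negb_and -!ltNge => /orP[tT|tT].
  by rewrite clamp_before ?ltW// pE expr0n/= !mulr0 subrr.
by rewrite clamp_after ?ltW// pE; field; rewrite gt_eqF.
Qed.

(** tau starts at 0, ends at L, and has slope 1 wherever it lies strictly between,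
    because psi is then positive.  So T0 can be read off from any time t1 where
    tau t1 = L / 2, and tau is the occupation time of ]T0, T0 + L[. *)
Lemma most_likely_excursion z psi : 0 < z <= delta / 6 ->
  most_likely_path (gaussian_rate delta sigma) z psi <->
  exists2 T0 : R, 0 <= T0 <= 1 - Num.sqrt (6 * z / delta) &
    forall t : R, 0 <= t <= 1 -> psi t = excursion_path delta z T0 t.
Proof.
move=> z01; have /andP[z0 z1] := z01.
have <- : busy_length delta z = Num.sqrt (6 * z / delta).
  by apply: busy_length_small; rewrite // ltW.
split; last first.
  move=> [T0 /andP[T00 T01] psiE]; apply: (most_likely_path_profile z T0) => //.
    by rewrite -lerBrDr.
  by move=> t t01; rewrite psiE// excursion_pathE.
move=> /(most_likely_path_occupation _ _ z0)[mO].
set tau := occupation _; have L0 := busy_length_gt0 _ delta_gt0 z z0.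
have Lpos := profile_pos z; move: L0 Lpos.
set L := busy_length delta z => L0 Lpos tau1 psiE.
have tau_le x y : 0 <= x -> x <= y -> 0 <= tau y - tau x <= y - x.
  exact: occupation_le.
have tau0 : tau 0 = 0 by exact: occupation0.
have [t1 t1I tau_t1] : exists2 t1, t1 \in `[0, 1] & tau t1 = L / 2.
  apply: IVT => //; first exact: AC_within_continuous ltr01 (occupation_AC _ mO).
  rewrite tau0 tau1 min_l ?max_r ?(ltW L0)//; apply/andP; split; lra.
move: t1I; rewrite in_itv/= => /andP[t10 t11].
have busy t : 0 < t < 1 -> 0 < tau t < L -> busy_set psi t.
  move=> t01 tauL; split => //; rewrite psiE; first exact: Lpos.
  by case/andP: t01 => ? ?; rewrite !ltW.
have tau_mono x y : 0 <= x -> x <= y -> tau x <= tau y.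
  by move=> x0 xy; have /andP[+ _] := tau_le x y x0 xy; rewrite subr_ge0.
have tau_linear x y : 0 <= x -> x <= y -> y <= 1 -> 0 < tau x -> tau y < L ->
    tau y - tau x = y - x.
  move=> x0 xy y1 taux tauy; apply: occupation_full => //.
  move=> s /=; rewrite in_itv/= => /andP[xs sy]; apply: busy.
    by rewrite (le_lt_trans x0 xs) (lt_le_trans sy y1).
  rewrite (lt_le_trans taux) ?tau_mono ?(ltW xs)//=.
  by apply: le_lt_trans tauy; rewrite tau_mono ?(le_trans x0)// ltW.
pose T0 := t1 - L / 2.
have tauE t : 0 <= t <= 1 -> [\/ tau t = t - T0, tau t = 0 /\ t <= T0 |
    tau t = L /\ T0 + L <= t].
  case/andP=> t0 t1'; have [tt|tt] := leP t t1.
    have := tau_mono 0 t (lexx 0) t0; rewrite tau0 le_eqVlt => /predU1P[taut|taut].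
      have := tau_le t t1 t0 tt; rewrite -taut tau_t1 => /andP[_ H].
      by apply: Or32; split=> //; rewrite /T0; lra.
    have tL : tau t1 < L by rewrite tau_t1; lra.
    have := tau_linear t t1 t0 tt t11 taut tL; rewrite tau_t1 /T0 => H.
    by apply: Or31; lra.
  have := tau_mono t 1 t0 t1'; rewrite tau1 le_eqVlt => /predU1P[taut|taut].
    have := tau_le t1 t t10 (ltW tt); rewrite taut tau_t1 => /andP[_ H].
    by apply: Or33; split=> //; rewrite /T0; lra.
  have tL : 0 < tau t1 by rewrite tau_t1 divr_gt0.
  have := tau_linear t1 t t10 (ltW tt) t1' tL taut; rewrite tau_t1 /T0 => H.
  by apply: Or31; lra.
exists T0.
  have := tauE 0; have := tauE 1; rewrite tau0 tau1 !lexx ler01.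
  by move=> /(_ isT)[H|[H ?]|[_ H]] /(_ isT)[G|[_ G]|[G ?]]; apply/andP; split; lra.
move=> t t01; rewrite psiE// excursion_pathE// -/L; congr profile.
have taut := tau_mono 0 t (lexx 0); rewrite tau0 in taut.
have taut1 := tau_mono t 1; rewrite tau1 in taut1.
case/andP: (t01) => t0 t1'; have {}taut := taut t0; have {}taut1 := taut1 t0 t1'.
case: (tauE t t01) => [H|[-> H]|[-> H]].
- by rewrite clamp_inside//; apply/andP; split; lra.
- by rewrite clamp_before.
- by rewrite clamp_after.
Qed.

End Minimizers.

Theorem proposition2 (R : realType) (d : measure_display) (T : measurableType d)
    (P : probability T R) (X : nat -> {RV P >-> R}) (delta sigma : R)
    (delta_gt0 : 0 < delta) (sigma_gt0 : 0 < sigma)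
    (X_iid : iid_gaussian (- delta) sigma X) :
  [/\ ldp P [set x | 0 <= x]
        (fun n w => n%:R^-1 * Wbar (fun k => X k w) n)
        (fun z => (Wbar_rate delta sigma z)%:E),
      forall z : R, 0 < z <= delta / 6 -> forall psi : R -> R,
        most_likely_path (gaussian_rate delta sigma) z psi <->
        exists2 T0 : R, 0 <= T0 <= 1 - Num.sqrt (6 * z / delta) &
          forall t : R, 0 <= t <= 1 -> psi t = excursion_path delta z T0 t
    & forall z : R, delta / 6 <= z -> forall psi : R -> R,
        most_likely_path (gaussian_rate delta sigma) z psi <->
        forall t : R, 0 <= t <= 1 -> psi t = full_path delta z t].
Proof.
split.
- exact: ldp_waiting_times.
- by move=> z z01 psi; exact: most_likely_excursion.
- by move=> z z1 psi; exact: most_likely_full_path.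
Qed.
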